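(* Fix an integer $d\ge2$ and $\kappa\in\mathbb R$. Let $\tau_1^+,\ldots,\tau_d^+>0$ and $\tau_1^-,\ldots,\tau_d^->0$, and let $$P=\operatorname{conv}\left\{\frac{e_1}{\tau_1^+},\ldots,\frac{e_d}{\tau_d^+},-\frac{e_1}{\tau_1^-},\ldots,-\frac{e_d}{\tau_d^-}\right\}\subseteq\mathbb R^d$$ with $e_1,\dots,e_d$ the standard basis. Assume that $P\subseteq\bar{\mathbb B}^d(\kappa)$. For $k\in\{1,\ldots,d\}$, let $F=\operatorname{conv}(e_1/\tau_1^+,\ldots,e_k/\tau_k^+)$, and let $x\in\operatorname{relint}(F)\cap\mathbb B^d(\kappa)$. Put $s_k(\kappa)=(\kappa+(\tau_1^+)^2+\cdots+(\tau_k^+)^2)^{1/2}$ (under the preceding assumptions, $s_k(\kappa)>0$). Then the following assertions hold. (a) The normal cone $N_x(F,P)$ is isometric to the cone $$C^{\mathrm{cube}}_{d-k}\left(\left(\frac{\tau_{k+1}^+}{s_k(\kappa)},\frac{\tau_{k+1}^-}{s_k(\kappa)}\right),\ldots,\left(\frac{\tau_d^+}{s_k(\kappa)},\frac{\tau_d^-}{s_k(\kappa)}\right)\right).$$ (b) The external angle at $F$ is $$\alpha_x(N_x(F,P))=\frac1{\sqrt{2\pi}}\int_0^\infty\prod_{j=k+1}^d\left(\Phi\left(\frac{\tau_j^+y}{s_k(\kappa)}\right)-\Phi\left(-\frac{\tau_j^-y}{s_k(\kappa)}\right)\right)e^{-y^2/2}\,dy.$$ (c) The tangent cone $T_x(F,P)$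 is isometric to the direct orthogonal sum of $\mathbb R^{k-1}$ and the cone $$C^{\mathrm{cross}}_{d-k}\left(\left(\frac{\tau_{k+1}^-}{s_k(\kappa)},\frac{\tau_{k+1}^+}{s_k(\kappa)}\right),\ldots,\left(\frac{\tau_d^-}{s_k(\kappa)},\frac{\tau_d^+}{s_k(\kappa)}\right)\right).$$ (d) The internal angle at $F$ is $$\alpha_x(T_x(F,P))=\frac12+\frac{\mathrm i}{2\pi}\int_0^\infty\frac{e^{-t^2/2}}{t}\Bigg[\prod_{j=k+1}^d\left(e^{-\frac{(\tau_j^-t)^2}{2s_k(\kappa)^2}}\Phi\left(\frac{\mathrm i\tau_j^-t}{s_k(\kappa)}\right)+e^{-\frac{(\tau_j^+t)^2}{2s_k(\kappa)^2}}\Phi\left(\frac{\mathrm i\tau_j^+t}{s_k(\kappa)}\right)\right)$$ $$-\prod_{j=k+1}^d\left(e^{-\frac{(\tau_j^-t)^2}{2s_k(\kappa)^2}}\Phi\left(-\frac{\mathrm i\tau_j^-t}{s_k(\kappa)}\right)+e^{-\frac{(\tau_j^+t)^2}{2s_k(\kappa)^2}}\Phi\left(-\frac{\mathrm i\tau_j^+t}{s_k(\kappa)}\right)\right)\Bigg]dt.$$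
   Context: Klein model. $\mathbb B^d(\kappa):=\mathbb R^d$ if $\kappa\ge0$ and $\mathbb B^d(\kappa):=\{x\in\mathbb R^d:\|x\|<1/\sqrt{-\kappa}\}$ if $\kappa<0$; $\bar{\mathbb B}^d(\kappa)$ is its Euclidean closure. The tangent space at $x\in\mathbb B^d(\kappa)$ is identified with $\mathbb R^d$ and carries the inner product $$g_x(u,v)=\frac{\langle u,v\rangle}{1+\kappa\|x\|^2}-\frac{\kappa\langle x,u\rangle\langle x,v\rangle}{(1+\kappa\|x\|^2)^2}.$$ Cones and angles. Let $P=\{y\in\mathbb R^d:\langle a_r,y\rangle\le b_r,\ r=1,\ldots,m\}\subseteq\bar{\mathbb B}^d(\kappa)$ be a full-dimensional polytope with irredundant inequalities ($a_r\neq 0$), $F\ne P$ a (nonempty) face, $I(F)=\{r:\langle a_r,y\rangle=b_r\ \forall y\in F\}$. For $x\in\operatorname{relint}(F)\cap\mathbb B^d(\kappa)$: $T_x(F,P)=\{u\in\mathbb R^d:\langle a_r,u\rangle\le0\ \forall r\in I(F)\}$ (tangent cone) and $N_x(F,P)=\{v\in\mathbb R^d: g_x(v,u)\le0\ \forall u\in T_x(F,P)\}$ (normal cone), both regarded as cones in $(\mathbb R^d,g_x)$. For a polyhedral cone $K$ in a finite-dimensional inner product space with linear hull $L$, its solid angle is the ratio of the $(\dim L)$-dimensional volumes of $K\cap B$ and $L\cap B$, $B$ the unit ball; $\alpha_x$ is the solid angle with respect to $g_x$. The internal and external angles at $F$ are $\alpha_x(T_x(F,P))$ and $\alpha_x(N_x(F,P))$.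 Two cones in inner product spaces are isometric if a linear isometry between their linear hulls maps one onto the other. Cones over crosspolytopes and boxes. For $n\ge1$ and $\vec\mu=((\mu_1^+,\mu_1^-),\ldots,(\mu_n^+,\mu_n^-))$ with all entries positive, and $e_0,\ldots,e_n$ the standard basis of $\mathbb R^{n+1}$, $$C^{\mathrm{cross}}_n(\vec\mu)=\operatorname{pos}\left\{e_0+\frac{e_i}{\mu_i^+},\,e_0-\frac{e_i}{\mu_i^-}:i=1,\ldots,n\right\},\quad C^{\mathrm{cube}}_n(\vec\mu)=\operatorname{pos}\left\{e_0+\sum_{i=1}^n\varepsilon_i\mu_i^{[\varepsilon_i]}e_i:\varepsilon_1,\ldots,\varepsilon_n\in\{\pm1\}\right\},$$ where $\mu_i^{[+1]}=\mu_i^+$, $\mu_i^{[-1]}=\mu_i^-$, and $\operatorname{pos}$ is the set of nonnegative linear combinations. For $n=0$: $C^{\mathrm{cross}}_0=C^{\mathrm{cube}}_0=[0,\infty)\subseteq\mathbb R$. Empty products equal $1$. $\Phi$ is the entire function $\Phi(z)=\frac12+\frac1{\sqrt{2\pi}}\int_0^z e^{-t^2/2}\,dt$, and $\mathrm i=\sqrt{-1}$. *)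

(* Defs.v *)
From HB Require Import structures.
From mathcomp Require Import all_boot all_order all_algebra.
From mathcomp Require Import all_classical all_reals all_analysis.
From mathcomp Require Import complex.

Set Implicit Arguments.
Unset Strict Implicit.
Unset Printing Implicit Defensive.

Import Order.TTheory GRing.Theory Num.Theory.
Import numFieldNormedType.Exports.

Local Open Scope classical_set_scope.
Local Open Scope ring_scope.
Local Open Scope complex_scope.

Section Hulls.
Context {R : realType} {V : lmodType R}.
Implicit Types A : set V.

Definition lin_hull A : set V :=
  [set y | exists (n : nat) (c : 'I_n -> R) (p : 'I_n -> V),
     (forall i, A (p i)) /\ y = \sum_i c i *: p i].

Definition pos_hull A : set V :=
  [set y | exists (n : nat) (c : 'I_n -> R) (p : 'I_n -> V),
     [/\ forall i, A (p i), forall i, 0 <= c i & y = \sum_i c i *: p i]].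

Definition aff_hull A : set V :=
  [set y | exists (n : nat) (c : 'I_n -> R) (p : 'I_n -> V),
     [/\ forall i, A (p i), \sum_i c i = 1 & y = \sum_i c i *: p i]].

Definition conv_hull A : set V :=
  [set y | exists (n : nat) (c : 'I_n -> R) (p : 'I_n -> V),
     [/\ forall i, A (p i), forall i, 0 <= c i, \sum_i c i = 1
       & y = \sum_i c i *: p i]].

End Hulls.

Definition relint {R : realType} {n : nat} (A : set 'rV[R]_n) : set 'rV[R]_n :=
  [set x | A x /\ \forall y \near x, aff_hull A y -> A y].

Section Euclidean.
Context {R : realType} {n : nat}.
Implicit Types u v : 'rV[R]_n.

Definition dot u v : R := \sum_i u 0 i * v 0 i.

(* The library's norm on row vectors is the sup norm. *)
Definition enorm u : R := Num.sqrt (dot u u).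

Definition evec (i : 'I_n) : 'rV[R]_n := delta_mx 0 i.

End Euclidean.

(* n-dimensional Lebesgue measure, as the n-fold product of the Lebesgue measure
   on the line, by iterated integration.  It is meaningful on Borel sets. *)
Fixpoint vol {R : realType} (n : nat) : set 'rV[R]_n -> \bar R :=
  match n with
  | 0%N => fun A => (\1_A (0 : 'rV[R]_0))%:E
  | n'.+1 => fun A =>
      (\int[@lebesgue_measure R]_t
         vol [set v : 'rV[R]_n' | A (row_mx (const_mx t : 'rV[R]_1) v)])%E
  end.

(* An inner product space is given by a vector space V and a form g on V. *)
Section InnerProduct.
Context {R : realType} {V : lmodType R} (g : V -> V -> R).
Implicit Types K L A : set V.

Definition orthonormal_basis L (E : seq V) : Prop :=
  (forall i j, (i < size E)%N -> (j < size E)%N ->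
     g E`_i E`_j = (i == j)%:R) /\
  L = lin_hull [set` E].

(* Volume in the subspace L, in the coordinates of some orthonormal basis. *)
Definition vol_in L A : \bar R :=
  let E := xget [::] [set E | orthonormal_basis L E] in
  vol [set c : 'rV[R]_(size E) | A (\sum_(i < size E) c 0 i *: E`_i)].

Definition unit_ball : set V := [set v | g v v <= 1].

Definition solid_angle K : R :=
  fine (vol_in (lin_hull K) (K `&` unit_ball)) /
  fine (vol_in (lin_hull K) (lin_hull K `&` unit_ball)).

Definition normal_cone_of K : set V := [set v | forall u, K u -> g v u <= 0].

End InnerProduct.

(* f matters only on the linear hull of K. *)
Definition isometric {R : realType} {V W : lmodType R}
    (g : V -> V -> R) (K : set V) (h : W -> W -> R) (K' : set W) : Prop :=
  exists f : V -> W,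
    [/\ forall (c : R) u v, lin_hull K u -> lin_hull K v ->
          f (c *: u + v) = c *: f u + f v,
        forall u v, lin_hull K u -> lin_hull K v -> h (f u) (f v) = g u v,
        f @` lin_hull K = lin_hull K'
      & f @` K = K'].

Definition klein_ball {R : realType} (d : nat) (kappa : R) : set 'rV[R]_d :=
  [set x | 0 <= kappa \/ enorm x < 1 / Num.sqrt (- kappa)].
Arguments klein_ball {R} d kappa.

Definition klein_form {R : realType} {d : nat} (kappa : R)
    (x u v : 'rV[R]_d) : R :=
  dot u v / (1 + kappa * enorm x ^+ 2) -
  kappa * dot x u * dot x v / (1 + kappa * enorm x ^+ 2) ^+ 2.

Section Polytopes.
Context {R : realType} {d m : nat} (a : 'I_m -> 'rV[R]_d) (b : 'I_m -> R).

Definition irredundant_description (P : set 'rV[R]_d) : Prop :=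
  [/\ P = [set y | forall r, dot (a r) y <= b r],
      forall r, a r != 0
    & forall r, [set y | forall s, s != r -> dot (a s) y <= b s] <> P].

Definition active (F : set 'rV[R]_d) : set 'I_m :=
  [set r | forall y, F y -> dot (a r) y = b r].

Definition tangent_cone (F : set 'rV[R]_d) : set 'rV[R]_d :=
  [set u | forall r, active F r -> dot (a r) u <= 0].

Definition normal_cone (kappa : R) (x : 'rV[R]_d) (F : set 'rV[R]_d) :
    set 'rV[R]_d :=
  normal_cone_of (klein_form kappa x) (tangent_cone F).

End Polytopes.

Section Cones.
Context {R : realType} {n : nat} (mup mum : 'I_n -> R).

Definition cross_cone : set 'rV[R]_n.+1 :=
  if n == 0%N then [set v : 'rV[R]_n.+1 | 0 <= v 0 0] else
  pos_hull
    ([set evec 0 + (mup i)^-1 *: evec (lift 0 i) | i in [set: 'I_n]] `|`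
     [set evec 0 - (mum i)^-1 *: evec (lift 0 i) | i in [set: 'I_n]]).

(* For n = 0 this is pos {e_0}, the half-line. *)
Definition cube_cone : set 'rV[R]_n.+1 :=
  pos_hull
    [set v | exists eps : 'I_n -> bool,
       v = evec 0 +
           \sum_i (if eps i then mup i else - mum i) *: evec (lift 0 i)].

End Cones.

(* Orthogonal direct sum of R^p and the cone C. *)
Definition lineality_sum {R : realType} (p n : nat) (C : set 'rV[R]_n) :
    set 'rV[R]_(p + n) :=
  [set w | C (rsubmx w)].
Arguments lineality_sum {R} p {n} C.

Section CrossPolytope.
Context {R : realType} {d : nat} (taup taum : 'I_d -> R).

Definition cross_polytope : set 'rV[R]_d :=
  conv_hull ([set (taup i)^-1 *: evec i | i in [set: 'I_d]] `|`
             [set - ((taum i)^-1 *: evec i) | i in [set: 'I_d]]).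

Definition cross_face (k : nat) : set 'rV[R]_d :=
  conv_hull [set (taup i)^-1 *: evec i | i in [set i : 'I_d | (i < k)%N]].

Definition s_ (k : nat) (kappa : R) : R :=
  Num.sqrt (kappa + \sum_(i < d | (i < k)%N) taup i ^+ 2).

End CrossPolytope.

(* The index k + j of 'I_d. *)
Definition tail_ord (d k : nat) (hkd : (k <= d)%N) (j : 'I_(d - k)) : 'I_d :=
  cast_ord (subnKC hkd) (rshift k j).

Section Complex.
Context {R : realType}.

Definition Cexp (z : R[i]) : R[i] :=
  (expR (complex.Re z))%:C * (cos (complex.Im z) +i* sin (complex.Im z)).

Definition Cintegral (D : set R) (f : R -> R[i]) : R[i] :=
  (\int[@lebesgue_measure R]_(t in D) complex.Re (f t)) +i*
  (\int[@lebesgue_measure R]_(t in D) complex.Im (f t)).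

(* The integral from 0 to z is taken along the segment t |-> t z. *)
Definition Phi (z : R[i]) : R[i] :=
  2^-1 + ((Num.sqrt (2 * pi))^-1)%:C *
    Cintegral `[0, 1] (fun t => z * Cexp (- (t%:C * z) ^+ 2 / 2)).

End Complex.

(* Main.v *)
(* At [x] the tangent cone is cut out by the single inequality
     sum_{i < k} tau_i^+ u_i + sum_{j >= k} max(tau_j^+ u_j, - tau_j^- u_j) <= 0.
   The vectors [- sqrt c (tau + kappa x) / s] and [- sqrt c e_j] (j >= k), where
   tau = (tau_1^+, .., tau_k^+, 0, .., 0) and c = 1 + kappa |x|^2, are orthonormal
   for [g_x]; in a [g_x]-orthonormal frame extending them the tangent cone becomes
   R^(k-1) + a cross cone, and the normal cone the dual of that cross cone, a cube
   cone.

   A solid angle is the Gaussian measure of the cone: by layer cake, volume ratios of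
   cones can be computed with a Gaussian weight instead of the unit ball.  For cube
   cones the Gaussian measure factors, which gives (b).  For cross cones it is
   P(xi_0 >= sum_j max(p_j xi_j, - q_j xi_j)), evaluated by
     P(xi >= s) = 1/2 - 1/pi int_0^oo e^(-t^2/2) sin(ts) / t dt   (s >= 0)
   after integrating out the xi_j one by one with Fubini.  Every such step replaces
   e^(its) by its half-line Fourier transform against the Gaussian, which is
   e^(-y^2/2) Phi(iy), and (d) follows. *)

Require Import Defs.
From HB Require Import structures.
From mathcomp Require Import all_boot all_order all_algebra.
From mathcomp Require Import all_classical all_reals all_analysis.
From mathcomp Require Import complex.
From mathcomp Require Import measurable_realfun ring lra.

Set Implicit Arguments.
Unset Strict Implicit.
Unset Printing Implicit Defensive.

Import Order.TTheory GRing.Theory Num.Theory.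
Import numFieldNormedType.Exports.

Local Open Scope classical_set_scope.
Local Open Scope ring_scope.
Local Open Scope complex_scope.

(** * Measurability and linear changes of variables for iterated integrals *)

(** What shapes the groundwork is the encoding of volume: [vol] is an iterated integral in fixed
    coordinates, and [vol_in] uses an unspecified orthonormal basis. Rotation invariance therefore
    has to be derived for iterated integrals, which is done by factoring an invertible matrix into
    shears and dilations. In the evaluation of cross cones the offset [s] of the tail is carried
    through the induction; it stays nonnegative because every [max (p v, - q v)] with [p, q >= 0]
    is. The factor [1 / t] is not integrable at the origin, and Fubini applies only because the
    imaginary part carried along is [O(t)] there. The polytope comes with an arbitrary system of
    inequalities. Its tangent cone is read off by moving the mean of the vertices of [F] a little in
    direction [u] and comparing that system with the gauge of the crosspolytope. The constant
    [s ^ 2 = kappa + |tau| ^ 2] is [<tau, tau + kappa x>], since [<tau, x> = 1] on [F]. For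
    [kappa < 0] its positivity follows from [|tau + kappa x| ^ 2 >= 0] and [kappa |x| ^ 2 > -1]. *)

Definition row_display : measure_display. Proof. exact: (default_measure_display). Qed.

Section MeasurableRows.
Context {R : realType} {n : nat}.

(** Generated by the coordinate maps, the sigma-algebra on rows is the product one, so measurability
    into rows is checked coordinate by coordinate. *)
Let coors : 'I_n -> 'rV[R]_n -> measurableTypeR R := fun i v => v 0 i.

Let row_set0 : g_sigma_preimage coors set0.
Proof. exact: sigma_algebra0. Qed.

Let row_setC A : g_sigma_preimage coors A -> g_sigma_preimage coors (~` A).
Proof. exact: sigma_algebraC. Qed.

Let row_bigcup (F : _^nat) : (forall i, g_sigma_preimage coors (F i)) ->
  g_sigma_preimage coors (\bigcup_i (F i)).
Proof. exact: sigma_algebra_bigcup. Qed.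

HB.instance Definition _ := @isMeasurable.Build row_display
  'rV[R]_n (g_sigma_preimage coors) row_set0 row_setC row_bigcup.

Lemma measurable_coord (i : 'I_n) :
  measurable_fun [set: 'rV[R]_n] (fun v : 'rV[R]_n => v 0 i).
Proof.
move=> _ Y mY; rewrite setTI; apply: sub_sigma_algebra => /=.
rewrite -bigcup_seq/=; exists i => /=; first by rewrite mem_index_enum.
by exists Y => //; rewrite setTI.
Qed.

Lemma measurable_rowP d (T : measurableType d) (f : T -> 'rV[R]_n) :
  (forall i, measurable_fun [set: T] (fun x => f x 0 i)) ->
  measurable_fun [set: T] f.
Proof.
move=> mf.
have H : g_sigma_preimage (fun i => coors i \o f) `<=` measurable.
  apply: smallest_sub; first exact: sigma_algebra_measurable.
  move=> A; rewrite -bigcup_seq/= => -[i _] [B mB <-].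
  exact: mf.
by move=> _ A mA; apply: H; rewrite g_sigma_preimage_comp; exists A.
Qed.

End MeasurableRows.

Section IteratedIntegral.
Context {R : realType}.
Notation mu := (@lebesgue_measure R).

Definition cons_row n (t : R) (v : 'rV[R]_n) : 'rV[R]_n.+1 :=
  row_mx (const_mx t : 'rV_1) v.

Lemma cons_row0 n t (v : 'rV[R]_n) : cons_row t v 0 0 = t.
Proof.
have -> : (0 : 'I_n.+1) = lshift n (0 : 'I_1) by exact: val_inj.
by apply: (etrans (row_mxEl (const_mx t : 'rV_1) v 0 0)); rewrite mxE.
Qed.

Lemma cons_rowS n t (v : 'rV[R]_n) i : cons_row t v 0 (lift 0 i) = v 0 i.
Proof.
have -> : lift 0 i = rshift 1 i by exact: val_inj.
exact: row_mxEr.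
Qed.

Lemma measurable_cons_row d (T : measurableType d) n (f : T -> R)
    (g : T -> 'rV[R]_n) :
  measurable_fun setT f -> measurable_fun setT g ->
  measurable_fun setT (fun x => cons_row (f x) (g x)).
Proof.
move=> mf mg; apply: measurable_rowP => i.
case: (unliftP 0 i) => [j ->|->].
  under eq_fun do rewrite cons_rowS.
  exact: (measurableT_comp (measurable_coord j) mg).
by under eq_fun do rewrite cons_row0.
Qed.

(** The iterated integral that [vol] takes of an indicator, for general integrands, so that Gaussian
    weights can be integrated as well. *)
Fixpoint vint (n : nat) : ('rV[R]_n -> \bar R) -> \bar R :=
  match n with
  | 0%N => fun f => f 0
  | n'.+1 => fun f => (\int[mu]_t vint (fun v => f (cons_row t v)))%E
  end.

Lemma vol_vint n (A : set 'rV[R]_n) : vol A = vint (fun v => (\1_A v)%:E).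
Proof.
elim: n A => [//|n IH] A /=.
by apply: eq_integral => t _; rewrite IH.
Qed.

Lemma vint_ge0 n (f : 'rV[R]_n -> \bar R) :
  (forall v, (0 <= f v)%E) -> (0 <= vint f)%E.
Proof.
elim: n f => [|n IH] f f0 /=; first exact: f0.
by apply: integral_ge0 => t _; apply: IH.
Qed.

Lemma eq_vint n (f g : 'rV[R]_n -> \bar R) : f =1 g -> vint f = vint g.
Proof. by move=> fg; congr vint; apply/funext. Qed.

Lemma measurable_fun2 d d1 d2 d3 (T : measurableType d) (T1 : measurableType d1)
    (T2 : measurableType d2) (T3 : measurableType d3) (f : T1 -> T2 -> T3)
    (g : T -> T1) (h : T -> T2) :
  measurable_fun setT (fun p : T1 * T2 => f p.1 p.2) ->
  measurable_fun setT g -> measurable_fun setT h ->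
  measurable_fun setT (fun x => f (g x) (h x)).
Proof. by move=> mf mg mh; exact: (measurableT_comp mf (measurable_fun_pair mg mh)). Qed.

(** The parameter space [T] is arbitrary because the induction on [n] adjoins the outermost
    coordinate to the parameter. *)
Lemma measurable_vint d (T : measurableType d) n (f : T -> 'rV[R]_n -> \bar R) :
  (forall x v, (0 <= f x v)%E) ->
  measurable_fun setT (fun xv : T * 'rV[R]_n => f xv.1 xv.2) ->
  measurable_fun setT (fun x => vint (f x)).
Proof.
elim: n d T f => [|n IH] d T f f0 mf /=.
  exact: (measurable_fun2 mf (@measurable_id _ _ _) (measurable_cst _)).
apply: (@measurable_fun_fubini_tonelli_F _ _ T (measurableTypeR R) R mu
  (fun xt => vint (fun v => f xt.1 (cons_row xt.2 v)))); last first.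
  by move=> x; apply: vint_ge0.
apply: (IH _ _ (fun (xt : T * R) v => f xt.1 (cons_row xt.2 v))) => //.
apply: (measurable_fun2 mf (measurableT_comp measurable_fst measurable_fst)).
apply: measurable_cons_row; last exact: measurable_snd.
exact: measurableT_comp measurable_snd measurable_fst.
Qed.

Lemma measurable_vint_cons n (f : 'rV[R]_n.+1 -> \bar R) :
  (forall v, (0 <= f v)%E) -> measurable_fun setT f ->
  measurable_fun setT (fun t => vint (fun v => f (cons_row t v))).
Proof.
move=> f0 mf; apply: measurable_vint => //.
apply: (measurableT_comp mf).
by apply: measurable_cons_row; [exact: measurable_fst|exact: measurable_snd].
Qed.

Lemma measurable_section_cons n (f : 'rV[R]_n.+1 -> \bar R) t :
  measurable_fun setT f -> measurable_fun setT (fun v => f (cons_row t v)).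
Proof.
move=> mf; apply: (measurableT_comp mf).
by apply: measurable_cons_row => //; exact: measurable_cst.
Qed.

Lemma vint_exchange n (f : R -> 'rV[R]_n -> \bar R) :
  (forall x v, (0 <= f x v)%E) ->
  measurable_fun setT (fun xv : R * 'rV[R]_n => f xv.1 xv.2) ->
  (\int[mu]_t vint (f t) = vint (fun v => \int[mu]_t f t v))%E.
Proof.
elim: n f => [//|n IH] f f0 mf /=.
transitivity (\int[mu]_s \int[mu]_t vint (fun v => f t (cons_row s v)))%E.
  apply: (@fubini_tonelli _ _ (measurableTypeR R) (measurableTypeR R) R mu mu
    (fun ts => vint (fun v => f ts.1 (cons_row ts.2 v)))).
    apply: (@measurable_vint _ _ n (fun (ts : R * R) v => f ts.1 (cons_row ts.2 v))) => //.
    apply: (measurable_fun2 mf (measurableT_comp measurable_fst measurable_fst)).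
    apply: measurable_cons_row; last exact: measurable_snd.
    exact: measurableT_comp measurable_snd measurable_fst.
  by move=> x; apply: vint_ge0.
apply: eq_integral => s _; rewrite IH//.
apply: (measurable_fun2 mf measurable_fst).
by apply: measurable_cons_row; [exact: measurable_cst|exact: measurable_snd].
Qed.

Lemma le_vint n (f g : 'rV[R]_n -> \bar R) : (forall v, (0 <= f v)%E) ->
  measurable_fun setT f -> measurable_fun setT g ->
  (forall v, (f v <= g v)%E) -> (vint f <= vint g)%E.
Proof.
elim: n f g => [|n IH] f g f0 mf mg fg /=; first exact: fg.
apply: ge0_le_integral => //.
- by move=> t _; exact: vint_ge0.
- exact: measurable_vint_cons.
- by apply: measurable_vint_cons => // v; exact: le_trans (fg v).
- by move=> t _; apply: IH => //; exact: measurable_section_cons.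
Qed.

Lemma vintZl n (f : 'rV[R]_n -> \bar R) (c : R) : 0 <= c ->
  (forall v, (0 <= f v)%E) -> measurable_fun setT f ->
  (vint (fun v => c%:E * f v) = c%:E * vint f)%E.
Proof.
move=> c0; elim: n f => [//|n IH] f f0 mf /=.
rewrite -ge0_integralZl_EFin//; last 2 first.
- by move=> t _; apply: vint_ge0.
- exact: measurable_vint_cons.
by apply: eq_integral => t _; apply: IH => //; exact: measurable_section_cons.
Qed.

End IteratedIntegral.

Section Affine.
Context {R : realType}.
Notation mu := (@lebesgue_measure R).

Lemma measurable_affine (a b : R) : measurable_fun setT (fun t : R => a * t + b).
Proof. by apply: measurable_funD => //; apply: measurable_funM. Qed.

Lemma lebesgue_measure_affine_itv (a b x y : R) : a != 0 ->
  (`|a|%:E * mu ((fun t => a * t + b)%R @^-1` `]x, y]%classic) =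
   mu `]x, y]%classic)%E.
Proof.
rewrite neq_lt => /orP[a_lt0|a_gt0].
  have -> : (fun t => a * t + b) @^-1` `]x, y] = `[(y - b) / a, (x - b) / a[%classic.
    apply/seteqP; split => t /=; rewrite !in_itv/= => /andP[h1 h2]; apply/andP; split.
    - by rewrite ler_ndivrMr// mulrC; lra.
    - by rewrite ltr_ndivlMr// mulrC; lra.
    - by move: h2; rewrite ltr_ndivlMr// mulrC; lra.
    - by move: h1; rewrite ler_ndivrMr// mulrC; lra.
  rewrite !lebesgue_measure_itv/= !lte_fin ltr_nM2r ?invr_lt0// ltrD2r.
  case: ifPn => _; last by rewrite mule0.
  by rewrite -!EFinD -EFinM ltr0_norm//; congr _%:E; field; lra.
have -> : (fun t => a * t + b) @^-1` `]x, y] = `](x - b) / a, (y - b) / a]%classic.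
  apply/seteqP; split => t /=; rewrite !in_itv/= => /andP[h1 h2]; apply/andP; split.
  - by rewrite ltr_pdivrMr// mulrC; lra.
  - by rewrite ler_pdivlMr// mulrC; lra.
  - by move: h1; rewrite ltr_pdivrMr// mulrC; lra.
  - by move: h2; rewrite ler_pdivlMr// mulrC; lra.
rewrite !lebesgue_measure_itv/= !lte_fin ltr_pM2r ?invr_gt0// ltrD2r.
case: ifPn => _; last by rewrite mule0.
by rewrite -!EFinD -EFinM gtr0_norm//; congr _%:E; field; lra.
Qed.

(** The pushforward of Lebesgue measure under the affine map, scaled by [|a|], agrees with Lebesgue
    measure on half-open intervals, hence on all Borel sets by uniqueness. *)
Lemma ge0_integral_affine (a b : R) (f : R -> \bar R) : a != 0 ->
  (forall t, (0 <= f t)%E) -> measurable_fun setT f ->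
  (`|a|%:E * \int[mu]_t f (a * t + b)%R = \int[mu]_t f t)%E.
Proof.
move=> a0 f0 mf.
pose g : measurableTypeR R -> measurableTypeR R := fun t => a * t + b.
have mg : measurable_fun setT g by exact: measurable_affine.
unshelve epose (pm := pushforward mu g : {measure set (measurableTypeR R) -> \bar R}).
  exact: mg.
pose nu : {measure set (measurableTypeR R) -> \bar R} := mscale (NngNum (normr_ge0 a)) pm.
have munu : forall A, measurable A -> mu A = nu A.
  apply: lebesgue_measure_unique => _ [[x y] _ <-].
  exact/esym/lebesgue_measure_affine_itv.
transitivity (\int[nu]_t f t)%E; last first.
  by apply: eq_measure_integral => A mA _; exact/esym/munu.
rewrite ge0_integral_mscale//=; congr *%E.
by rewrite ge0_integral_pushforward.
Qed.

End Affine.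

Section LinearChange.
Context {R : realType}.
Notation mu := (@lebesgue_measure R).

Lemma measurable_mulmx m n (M : 'M[R]_(m, n)) :
  measurable_fun setT (fun v : 'rV[R]_m => v *m M).
Proof.
apply: measurable_rowP => i.
under eq_fun do rewrite mxE.
apply: measurable_sum => j; apply: measurable_funM => //.
exact: measurable_coord.
Qed.

Definition tail_row n (v : 'rV[R]_n.+1) : 'rV[R]_n := \row_i v 0 (lift 0 i).

Lemma cons_row_tail n (v : 'rV[R]_n.+1) : cons_row (v 0 0) (tail_row v) = v.
Proof.
apply/rowP => i; case: (unliftP 0 i) => [j ->|->]; last by rewrite cons_row0.
by rewrite cons_rowS mxE.
Qed.

Lemma cons_rowD n s t (u v : 'rV[R]_n) :
  cons_row s u + cons_row t v = cons_row (s + t) (u + v).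
Proof.
apply/rowP => i; case: (unliftP 0 i) => [j ->|->].
  by rewrite mxE !cons_rowS mxE.
by rewrite mxE !cons_row0.
Qed.

Lemma vint_translate n (f : 'rV[R]_n -> \bar R) (w : 'rV[R]_n) :
  (forall v, (0 <= f v)%E) -> measurable_fun setT f ->
  vint (fun v => f (v + w)) = vint f.
Proof.
elim: n f w => [|n IH] f w f0 mf /=; first by congr f; apply/rowP => -[].
transitivity (\int[mu]_t vint (fun v => f (cons_row (1 * t + w 0 0)%R v)))%E.
  apply: eq_integral => t _; rewrite -[in LHS](cons_row_tail w) mul1r.
  under eq_vint do rewrite cons_rowD.
  rewrite (IH (fun v => f (cons_row (t + w 0 0) v)))//; exact: measurable_section_cons.
have := @ge0_integral_affine R 1 (w 0 0) (fun t => vint (fun v => f (cons_row t v))).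
rewrite normr1 mul1e; apply; first exact: oner_neq0.
  by move=> t; exact: vint_ge0.
exact: measurable_vint_cons.
Qed.

(** As a predicate on matrices it is stable under products, so it only has to be checked on the
    factors produced by Gaussian elimination. *)
Definition change_of_variables n (M : 'M[R]_n) := forall f : 'rV[R]_n -> \bar R,
  (forall v, (0 <= f v)%E) -> measurable_fun setT f ->
  (`|\det M|%:E * vint (fun v => f (v *m M)) = vint f)%E.

Lemma change_of_variablesM n (M N : 'M[R]_n) :
  change_of_variables M -> change_of_variables N ->
  change_of_variables (M *m N).
Proof.
move=> HM HN f f0 mf; rewrite -(HN f f0 mf) -(HM (fun v => f (v *m N)))//.
  rewrite det_mulmx normrM mulrC EFinM -muleA; congr (mule _ (mule _ _)).
  by apply: eq_vint => v; rewrite mulmxA.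
exact: (measurableT_comp mf (measurable_mulmx N)).
Qed.

(** For a fixed first coordinate [t] this shear translates the remaining coordinates by [t *: w]. *)
Lemma change_of_variables_upper n (w : 'rV[R]_n) :
  change_of_variables (block_mx 1%:M w 0 1%:M : 'M[R]_(1 + n)).
Proof.
move=> f f0 mf; rewrite det_ublock !det1 mulr1 normr1 mul1e.
apply: eq_integral => t _.
rewrite -[RHS](vint_translate (t *: w)) => [|v|]; first last.
- exact: measurable_section_cons.
- exact: f0.
apply: eq_vint => v; congr f.
rewrite /cons_row mul_row_block !mulmx1 mulmx0 addr0 addrC; congr row_mx.
congr (_ + _); apply/rowP => i; rewrite !mxE big_ord1 !mxE//.
Qed.

(** Here the outer variable is translated by an amount depending on the inner ones. Tonelli moves it
    innermost, where the translation is harmless, and back. *)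
Lemma change_of_variables_lower n (c : 'cV[R]_n) :
  change_of_variables (block_mx 1%:M 0 c 1%:M : 'M[R]_(1 + n)).
Proof.
move=> f f0 mf; rewrite det_lblock !det1 mulr1 normr1 mul1e.
have mt : measurable_fun setT (fun xv : R * 'rV[R]_n => xv.1 + (xv.2 *m c) 0 0).
  apply: measurable_funD; first exact: measurable_fst.
  apply: (measurableT_comp (measurable_coord 0)).
  exact: (measurableT_comp (measurable_mulmx c) measurable_snd).
transitivity (\int[mu]_t vint (fun v => f (cons_row (t + (v *m c) 0 0)%R v)))%E.
  apply: eq_integral => t _; apply: eq_vint => v; congr f.
  rewrite /cons_row mul_row_block !mulmx1 mulmx0 add0r; congr row_mx.
  by apply/rowP => i; rewrite ord1 !mxE.
rewrite (vint_exchange (f := fun t v => f (cons_row (t + (v *m c) 0 0) v)))//; last first.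
  exact: (measurableT_comp mf (measurable_cons_row mt measurable_snd)).
rewrite /= (vint_exchange (f := fun t v => f (cons_row t v)))//; last first.
  exact: (measurableT_comp mf (measurable_cons_row measurable_fst measurable_snd)).
apply: eq_vint => v.
have := @ge0_integral_affine R 1 ((v *m c) 0 0) (fun t => f (cons_row t v)).
under eq_integral do rewrite mul1r.
rewrite normr1 mul1e; apply => //.
apply: (measurableT_comp mf).
by apply: measurable_cons_row; [exact: measurable_id|exact: measurable_cst].
Qed.

Lemma change_of_variables_diag n (a : R) (D : 'M[R]_n) : a != 0 ->
  change_of_variables D ->
  change_of_variables (block_mx a%:M 0 0 D : 'M[R]_(1 + n)).
Proof.
move=> a0 HD f f0 mf; rewrite det_ublock det_scalar expr1 normrM.
have mv := measurable_vint_cons f0 mf.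
rewrite /= -[RHS](@ge0_integral_affine R a 0)//; last by move=> t; apply: vint_ge0.
rewrite EFinM -muleA; congr *%E.
rewrite -ge0_integralZl_EFin//; last 2 first.
- by move=> t _; apply: vint_ge0.
- apply: (@measurable_vint_cons R n (fun v : 'rV[R]_(1 + n) => f (v *m block_mx a%:M 0 0 D))).
    by move=> v; exact: f0.
  exact: (measurableT_comp mf (measurable_mulmx _)).
apply: eq_integral => t _; rewrite addr0.
rewrite -(HD (fun v => f (cons_row (a * t) v)))//; last exact: measurable_section_cons.
congr *%E; apply: eq_vint => v; congr f.
rewrite /cons_row mul_row_block !mulmx0 addr0 add0r; congr row_mx.
by apply/rowP => i; rewrite ord1 !mxE big_ord1 !mxE mulr1n mulrC.
Qed.

(** One elimination step: with a nonzero pivot [a], the matrix is a lower shear times [diag (a, D)]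
    times an upper shear, where [D] is the Schur complement. It is invertible because its
    determinant divides that of [M]. *)
Lemma change_of_variables_pivot n (M : 'M[R]_(1 + n)) :
  (forall D : 'M[R]_n, D \in unitmx -> change_of_variables D) ->
  M \in unitmx -> ulsubmx M 0 0 != 0 -> change_of_variables M.
Proof.
move=> IH uM a0; set a := ulsubmx M 0 0 in a0.
pose D := drsubmx M - a^-1 *: (dlsubmx M *m ursubmx M).
have ulE : ulsubmx M = a%:M.
  by apply/rowP => i; rewrite ord1 [RHS]mxE mulr1n.
have ME : M = block_mx 1%:M 0 (a^-1 *: dlsubmx M) 1%:M *m
              (block_mx a%:M 0 0 D *m block_mx 1%:M (a^-1 *: ursubmx M) 0 1%:M).
  have -> : block_mx a%:M 0 0 D *m block_mx 1%:M (a^-1 *: ursubmx M) 0 1%:M =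
            block_mx a%:M (ursubmx M) 0 D.
    rewrite mulmx_block !mulmx1 !mul0mx mulmx0 !addr0 add0r mul_scalar_mx.
    by rewrite scalerA divff// scale1r.
  rewrite mulmx_block !mul1mx !mul0mx !addr0 mul_mx_scalar scalerA.
  by rewrite divff// scale1r -scalemxAl /D addrC subrK -ulE submxK.
have uD : D \in unitmx.
  move: uM; rewrite ME !unitmx_mul => /andP[_ /andP[+ _]].
  by rewrite !unitmxE det_ublock det_scalar unitrM => /andP[].
rewrite ME; apply: change_of_variablesM; first exact: change_of_variables_lower.
apply: change_of_variablesM; last exact: change_of_variables_upper.
exact/change_of_variables_diag/IH.
Qed.

Lemma change_of_variables_unitmx n (M : 'M[R]_n) :
  M \in unitmx -> change_of_variables M.
Proof.
elim: n M => [|n IH] M uM.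
  move=> f f0 mf; rewrite det_mx00 normr1 mul1e /=; congr f.
  by apply/rowP => -[].
have [a0|a0] := eqVneq (ulsubmx (M : 'M[R]_(1 + n)) 0 0) 0; last exact: change_of_variables_pivot.
(* If the whole first column vanished, so would the determinant. *)
have [i ci0] : exists i, dlsubmx (M : 'M[R]_(1 + n)) i 0 != 0.
  apply/existsP; apply: contraLR uM => /existsPn c0.
  rewrite unitmxE (_ : \det M = 0) ?unitr0//.
  change (\det (M : 'M[R]_(1 + n)) = 0); rewrite -[M](@submxK _ 1 n 1 n).
  have -> : dlsubmx (M : 'M[R]_(1 + n)) = 0.
    by apply/colP => i; rewrite [RHS]mxE; exact/eqP/negPn/c0.
  have -> : ulsubmx (M : 'M[R]_(1 + n)) = 0.
    by apply/rowP => i; rewrite ord1 [RHS]mxE.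
  by rewrite det_ublock det_mx11 mxE mul0r.
(* A shear brings a nonzero entry of the first column into pivot position. *)
pose S w : 'M[R]_(1 + n) := block_mx 1%:M w 0 1%:M.
have SE w (N : 'M[R]_(1 + n)) : ulsubmx (S w *m N) = ulsubmx N + w *m dlsubmx N.
  by rewrite -[N in LHS]submxK mulmx_block block_mxKul mul1mx.
pose e : 'rV[R]_n := delta_mx 0 i.
have -> : M = S (- e) *m (S e *m M).
  rewrite mulmxA /S mulmx_block !mulmx1 !mulmx0 !mul0mx !mul1mx !addr0 !add0r.
  by rewrite subrr -scalar_mx_block mul1mx.
apply: change_of_variablesM; first exact: change_of_variables_upper.
apply: change_of_variables_pivot => //.
  by rewrite unitmx_mul uM andbT unitmxE det_ublock !det1 mulr1 unitr1.
by rewrite SE mxE a0 add0r -rowE mxE.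
Qed.

End LinearChange.

(** * Solid angles as Gaussian measures *)

Section GaussianVolume.
Context {R : realType}.
Notation mu := (@lebesgue_measure R).

Definition gauss_weight (t : R) : R := expR (- (t ^+ 2) / 2).

Lemma measurable_gauss_weight : measurable_fun setT gauss_weight.
Proof.
rewrite /gauss_weight; apply: measurableT_comp => //; apply: measurable_funM => //.
by apply: measurableT_comp => //; exact: measurable_funX.
Qed.

Lemma gauss_weight_ge0 t : 0 <= gauss_weight t.
Proof. exact: expR_ge0. Qed.

Lemma integral_gauss_weight :
  (\int[mu]_t (gauss_weight t)%:E = (Num.sqrt (2 * pi))%:E)%E.
Proof.
have s2 : Num.sqrt 2 != 0 :> R by rewrite gt_eqF// sqrtr_gt0.
(* The substitution [t -> sqrt 2 * t] turns the weight into [e^(-t^2)], whose integral is known. *)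
rewrite -(ge0_integral_affine 0 s2); last 2 first.
- by move=> t; rewrite lee_fin gauss_weight_ge0.
- apply/measurable_EFinP; exact: measurable_gauss_weight.
have := @integralT_gauss R; rewrite /gauss_fun => gE.
under eq_integral => t _.
  rewrite /gauss_weight addr0 exprMn sqr_sqrtr// -mulNr mulrAC mulNr mulfV// mulN1r.
  over.
by rewrite gE ger0_norm ?sqrtr_ge0// -EFinM sqrtrM.
Qed.

Lemma vint_prod n (h : 'I_n -> R -> R) :
  (forall i t, 0 <= h i t) -> (forall i, measurable_fun setT (h i)) ->
  (vint (fun v : 'rV[R]_n => (\prod_i h i (v 0 i))%:E) =
   \prod_i \int[mu]_t (h i t)%:E)%E.
Proof.
elim: n h => [|n IH] h h0 mh; first by rewrite /= !big_ord0.
rewrite [RHS]big_ord_recl -ge0_integralZr//; last 3 first.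
- by apply/measurable_EFinP; exact: mh.
- by move=> t _; rewrite lee_fin.
- by apply: prode_ge0 => i _; apply: integral_ge0 => t _; rewrite lee_fin.
apply: eq_integral => t _.
rewrite -(IH (fun i => h (lift 0 i)))// -vintZl//; last 2 first.
- by move=> v; rewrite lee_fin prodr_ge0.
- apply/measurable_EFinP; apply: measurable_prod => i _.
  exact: (measurableT_comp (mh _) (measurable_coord i)).
apply: eq_vint => v; rewrite -EFinM big_ord_recl cons_row0.
by congr (_ * _)%:E; apply: eq_bigr => i _; rewrite cons_rowS.
Qed.

Lemma dot_sum n (v : 'rV[R]_n) : dot v v = \sum_i v 0 i ^+ 2.
Proof. by apply: eq_bigr => i _; rewrite expr2. Qed.

Lemma measurable_dot n : measurable_fun setT (fun v : 'rV[R]_n => dot v v).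
Proof.
apply: measurable_sum => i.
by apply: measurable_funM; exact: measurable_coord.
Qed.

Lemma measurable_unit_ball n : measurable [set v : 'rV[R]_n | dot v v <= 1].
Proof.
rewrite -[X in measurable X]setTI; apply: measurable_fun_le => //.
exact: measurable_dot.
Qed.

Lemma dot_ge0 n (v : 'rV[R]_n) : 0 <= dot v v.
Proof. by rewrite dot_sum sumr_ge0// => i _; exact: sqr_ge0. Qed.

Lemma dotZ n c (v : 'rV[R]_n) : dot (c *: v) (c *: v) = c ^+ 2 * dot v v.
Proof.
by rewrite !dot_sum mulr_sumr; apply: eq_bigr => i _; rewrite mxE exprMn.
Qed.

(** The Gaussian measure without its normalising factor: the total mass is [sqrt (2 pi) ^ n]. *)
Definition gvol n (K : set 'rV[R]_n) : \bar R :=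
  vint (fun v => (\1_K v * expR (- dot v v / 2))%:E).

Lemma expR_dot n (v : 'rV[R]_n) :
  expR (- dot v v / 2) = \prod_i gauss_weight (v 0 i).
Proof.
rewrite dot_sum -sumrN mulr_suml expR_sum.
by apply: eq_bigr.
Qed.

Lemma gvolT n : gvol [set: 'rV[R]_n] = (Num.sqrt (2 * pi) ^+ n)%:E.
Proof.
transitivity (\prod_(i < n) \int[mu]_t (gauss_weight t)%:E)%E.
  rewrite -vint_prod//; last 2 first.
  - by move=> _ t; exact: gauss_weight_ge0.
  - by move=> _; exact: measurable_gauss_weight.
  by apply: eq_vint => v; rewrite indicT mul1r expR_dot.
under eq_bigr do rewrite integral_gauss_weight.
by rewrite prodEFin prodr_const card_ord.
Qed.

Definition scalable_set n (K : set 'rV[R]_n) :=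
  forall c v, 0 < c -> K v -> K (c *: v).

(* [expR (- q / 2)] is the length of [`]0, expR (- q / 2)]], so that by Tonelli
   the Gaussian weight of a cone is an integral of volumes of its dilated
   truncations. *)
Definition radius (t : R) : R := Num.sqrt (- (2 * ln t)).

Definition layer n : set (R * 'rV[R]_n) :=
  [set p | 0 < p.1 < 1 /\ p.1 <= expR (- dot p.2 p.2 / 2)].

Lemma measurable_layer n : measurable (@layer n).
Proof.
rewrite (_ : @layer n = (fst @^-1` `]0, 1[%classic) `&`
  [set p : R * 'rV[R]_n | p.1 <= expR (- dot p.2 p.2 / 2)]); last first.
  by apply/seteqP; split => -[t v]; rewrite /layer/= in_itv.
apply: measurable_fun_le => //.
- rewrite -[X in measurable X]setTI; apply: measurable_fst => //.
- exact: measurable_funTS.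
- apply: measurable_funTS; apply: measurableT_comp => //.
  apply: measurable_funM => //; apply: measurableT_comp => //.
  exact: (measurableT_comp (@measurable_dot n) measurable_snd).
Qed.

Lemma integral_layer n (v : 'rV[R]_n) :
  (\int[mu]_t (\1_(@layer n) (t, v))%:E = (expR (- dot v v / 2))%:E)%E.
Proof.
have e0 := expR_gt0 (- dot v v / 2).
have e1 : expR (- dot v v / 2) <= 1.
  by rewrite -expR0 ler_expR mulNr oppr_le0 divr_ge0// dot_ge0.
set e := expR _ in e0 e1 *.
transitivity (\int[mu]_(t in `]0%R, 1%R[) (\1_(`]0%R, e]%classic : set R) t)%:E)%E.
  rewrite [RHS]integral_mkcond; apply: eq_integral => t _.
  rewrite patchE /layer !indicE mem_setE in_itv/=.
  case: ifPn => t01.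
    congr ((_ : bool)%:R%:E); apply/idP/idP; rewrite !inE/= in_itv/=.
      by move=> [] /andP[-> _].
    by move=> /andP[]; rewrite t01.
  by rewrite memNset//= => -[]; rewrite (negbTE t01).
(* At [v = 0] the height [e] equals [1]; adding the null endpoint makes []0, e]] a subset of the
   domain. *)
have -> : (\int[mu]_(t in `]0%R, 1%R[) (\1_(`]0%R, e]%classic : set R) t)%:E =
           \int[mu]_(t in `]0%R, 1%R]) (\1_(`]0%R, e]%classic : set R) t)%:E)%E.
  apply: integral_itv_bndo_bndc; apply/measurable_EFinP.
  exact: measurable_indic.
rewrite integral_indic//= setIidl; last first.
  by move=> t /=; rewrite !in_itv/= => /andP[-> /le_trans]; apply.
by rewrite lebesgue_measure_itv/= lte_fin e0 oppr0 adde0.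
Qed.

(** For [0 < t < 1] the condition [t <= e^(-|v|^2 / 2)] means [|v| <= radius t]. Rescaling by
    [radius t] turns it into the unit ball, leaves the cone invariant and produces the Jacobian
    [radius t ^ n]. *)
Lemma vint_layer n (K : set 'rV[R]_n) t : measurable K -> scalable_set K ->
  vint (fun v => (\1_K v * \1_(@layer n) (t, v))%:E) =
  ((\1_(`]0%R, 1%R[%classic : set R) t * radius t ^+ n)%:E *
   vol (K `&` [set v | dot v v <= 1]%R))%E.
Proof.
move=> mK cK; rewrite indicE mem_setE in_itv/=; case: (boolP (0 < t < 1)) => t01; last first.
  rewrite mul0r mul0e (_ : (fun v => _) = (fun v => 0%:E * 0%:E)%E); last first.
    apply/funext => v; rewrite mule0 [\1_(@layer n) _]indicE memNset ?mulr0//.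
    by rewrite /layer/= (negbTE t01) => -[].
  by rewrite (@vintZl _ _ (cst 0%:E))// mul0e.
move/andP: t01 => [t0 t1].
have lt0 : 0 < - (2 * ln t) by rewrite oppr_gt0 pmulr_rlt0// ln_lt0// t0.
have r0 : 0 < radius t by rewrite sqrtr_gt0.
have mB : measurable (K `&` [set v : 'rV[R]_n | dot v v <= 1]).
  by apply: measurableI => //; exact: measurable_unit_ball.
rewrite mul1r vol_vint.
rewrite -(change_of_variables_unitmx (M := (radius t)%:M)); last 3 first.
- by rewrite unitmxE det_scalar unitrX// unitfE gt_eqF.
- by move=> v; rewrite lee_fin mulr_ge0// indicE.
- apply/measurable_EFinP/measurable_funM; first exact: measurable_indic.
  exact: (measurableT_comp (measurable_indic (@measurable_layer n)) (pair1_measurable t)).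
rewrite det_scalar ger0_norm ?exprn_ge0 ?ltW//; congr *%E.
apply: eq_vint => v; rewrite mul_mx_scalar; congr _%:E.
have Kr : K (radius t *: v) = K v.
  apply/propext; split => [Kv|]; last exact: cK.
  have := cK (radius t)^-1 _ _ Kv; rewrite invr_gt0 scalerA mulVf ?gt_eqF// scale1r.
  exact.
have Lr : (t <= expR (- dot (radius t *: v) (radius t *: v) / 2)) = (dot v v <= 1).
  have L0 : ln t < 0 by rewrite ln_lt0// t0.
  rewrite dotZ (sqr_sqrtr (ltW lt0)) -{1}(lnK (x := t)) ?posrE// ler_expR.
  rewrite (_ : - _ / 2 = ln t * dot v v); last by field.
  by rewrite -[X in X <= _]mulr1 ler_nM2l.
rewrite !indicE -natrM mulnb; congr ((_ : bool)%:R).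
apply/andP/idP => [[]|]; rewrite !inE Kr /layer/= t0 t1 Lr; first by move=> ? [].
by move=> [].
Qed.

(** The first factor does not depend on [K], so it cancels when two cones are compared. *)
Lemma gvol_layer n (K : set 'rV[R]_n) : measurable K -> scalable_set K ->
  (gvol K = (\int[mu]_t (\1_(`]0%R, 1%R[%classic : set R) t * radius t ^+ n)%:E) *
   vol (K `&` [set v | dot v v <= 1]%R))%E.
Proof.
move=> mK cK; rewrite -ge0_integralZr//; last 3 first.
- apply/measurable_EFinP/measurable_funM; first exact: measurable_indic.
  apply: measurable_funX; apply: measurableT_comp.
    by apply: continuous_measurable_fun; exact: sqrt_continuous.
  apply: measurableT_comp => //; apply: measurable_funM => //.
- by move=> t _; rewrite lee_fin mulr_ge0 ?exprn_ge0 ?sqrtr_ge0// indicE.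
- by rewrite vol_vint vint_ge0// => v; rewrite lee_fin indicE.
transitivity (vint (fun v => \int[mu]_t (\1_K v * \1_(@layer n) (t, v))%:E))%E.
  apply: eq_vint => v; under eq_integral do rewrite EFinM.
  rewrite ge0_integralZl//; first by rewrite integral_layer -EFinM.
  apply/measurable_EFinP.
  exact: (measurableT_comp (measurable_indic (@measurable_layer n)) (pair2_measurable v)).
rewrite -(vint_exchange (f := fun t v => (\1_K v * \1_(@layer n) (t, v))%:E))//.
  by apply: eq_integral => t _; exact: vint_layer.
apply/measurable_EFinP/measurable_funM.
  exact: (measurableT_comp (measurable_indic mK) measurable_snd).
exact: (measurableT_comp (measurable_indic (@measurable_layer n))
  (measurable_fun_pair measurable_fst measurable_snd)).
Qed.

(** The layer formula for [K] and for the whole space has the same constant [C]. Since the Gaussian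
    mass of the whole space is known, finite and positive, [C] and the volume of the ball are finite
    and nonzero, without being computed. *)
Lemma vol_cone_ratio n (K : set 'rV[R]_n) : measurable K -> scalable_set K ->
  fine (vol (K `&` [set v | dot v v <= 1])) / fine (vol [set v : 'rV[R]_n | dot v v <= 1]) =
  fine (gvol K) / Num.sqrt (2 * pi) ^+ n.
Proof.
move=> mK cK.
have := @gvol_layer n setT measurableT (fun c v _ _ => I).
have := gvol_layer mK cK; rewrite setTI gvolT.
set C := (\int[mu]_t _)%E; set x := vol _; set y := vol _ => gK gT.
have s0 : 0 < Num.sqrt (2 * pi) ^+ n :> R by rewrite exprn_gt0// sqrtr_gt0 mulr_gt0// pi_gt0.
have C0 : (0 <= C)%E.
  by apply: integral_ge0 => t _; rewrite lee_fin mulr_ge0 ?exprn_ge0 ?sqrtr_ge0// indicE.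
have x0 : (0 <= x)%E by rewrite /x vol_vint vint_ge0// => v; rewrite lee_fin indicE.
have y0 : (0 <= y)%E by rewrite /y vol_vint vint_ge0// => v; rewrite lee_fin indicE.
have xy : (x <= y)%E.
  rewrite /x /y !vol_vint; apply: le_vint => [v||| v].
  - by rewrite lee_fin indicE.
  - by apply/measurable_EFinP/measurable_indic/measurableI => //; exact: (@measurable_unit_ball n).
  - by apply/measurable_EFinP; exact: (measurable_indic (@measurable_unit_ball n)).
  rewrite lee_fin !indicE ler_nat; case: (boolP (v \in _)) => // vA.
  by rewrite mem_set//; move: vA; rewrite inE => -[].
(* The product of the nonnegative [C] and [y] is a positive real. An infinite factor is excluded: it
   would give [0] next to [0] and infinity otherwise. *)
have yC : y \is a fin_num /\ C \is a fin_num.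
  case: C y {gK xy} C0 y0 gT => [c| |] [z| |]//= C0 y0; rewrite ?mulyy//.
  - move: C0; rewrite lee_fin le_eqVlt => /orP[/eqP<-|c0].
      by rewrite mul0e => -[] /eqP; rewrite gt_eqF.
    by rewrite gt0_muley// lte_fin.
  - move: y0; rewrite lee_fin le_eqVlt => /orP[/eqP<-|c0].
      by rewrite mule0 => -[] /eqP; rewrite gt_eqF.
    by rewrite gt0_mulye// lte_fin.
case: yC => yf Cf.
have xf : x \is a fin_num by rewrite ge0_fin_numE// (le_lt_trans xy)// ltey_eq yf.
move: gK gT; rewrite -(fineK xf) -(fineK yf) -(fineK Cf) -!EFinM => -> [] gTE /=.
have : fine C != 0 /\ fine y != 0.
  apply/andP; rewrite -negb_or -mulf_eq0 -gTE; exact: lt0r_neq0.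
by move=> [c1 y1]; rewrite gTE; field; rewrite y1 c1.
Qed.

End GaussianVolume.

(** * Linear hulls and maps that are linear on a hull *)

Section LinearHull.
Context {R : realType} {V : lmodType R}.
Implicit Types A : set V.

Lemma sub_lin_hull A : A `<=` lin_hull A.
Proof.
move=> y Ay; exists 1%N, (fun=> 1), (fun=> y); split => //.
by rewrite big_ord1 scale1r.
Qed.

Lemma lin_hull0 A : lin_hull A 0.
Proof. by exists 0%N, (fun=> 0), (fun=> 0); split; [case|rewrite big_ord0]. Qed.

Lemma lin_hullP A c u v : lin_hull A u -> lin_hull A v -> lin_hull A (c *: u + v).
Proof.
move=> [m [a [p [Ap ->]]]] [n [b [q [Aq ->]]]].
exists (m + n)%N, (fun i => match fintype.split i with inl j => c * a j | inr j => b j end),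
  (fun i => match fintype.split i with inl j => p j | inr j => q j end); split.
  by move=> i; case: fintype.split.
rewrite big_split_ord/= scaler_sumr; congr (_ + _); apply: eq_bigr => i _.
  by rewrite (unsplitK (inl i)) scalerA.
by rewrite (unsplitK (inr i)).
Qed.

Lemma lin_hull_sum A n (c : 'I_n -> R) (p : 'I_n -> V) :
  (forall i, lin_hull A (p i)) -> lin_hull A (\sum_i c i *: p i).
Proof.
elim: n c p => [|n IH] c p Ap; first by rewrite big_ord0; exact: lin_hull0.
by rewrite big_ord_recl; apply: lin_hullP => //; exact: IH.
Qed.

End LinearHull.

Section LinearOn.
Context {R : realType} {V W : lmodType R} (K : set V) (f : V -> W).
Hypothesis flin : forall (c : R) u v, lin_hull K u -> lin_hull K v ->
  f (c *: u + v) = c *: f u + f v.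

Lemma linear_on0 : f 0 = 0.
Proof.
have := flin (-1) (lin_hull0 K) (lin_hull0 K).
by rewrite scaler0 addr0 scaleN1r addNr.
Qed.

Lemma linear_on_sum n (c : 'I_n -> R) (p : 'I_n -> V) :
  (forall i, lin_hull K (p i)) -> f (\sum_i c i *: p i) = \sum_i c i *: f (p i).
Proof.
elim: n c p => [|n IH] c p Kp; first by rewrite !big_ord0 linear_on0.
by rewrite !big_ord_recl flin// ?IH//; exact: lin_hull_sum.
Qed.

(** Once the image of [K] is known, this yields the clause of [isometric] about linear hulls. *)
Lemma image_lin_hull : f @` lin_hull K = lin_hull (f @` K).
Proof.
apply/seteqP; split => [_ [_ [n [c [p [Kp ->]]]] <-]|y [n [c [p [Kp ->]]]]].
  exists n, c, (f \o p); split; first by move=> i; exists (p i).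
  by rewrite linear_on_sum// => i; exact: sub_lin_hull.
have [q /all_and2 [Kq qp]] := choice (fun i =>
  let: ex_intro2 x Kx fx := Kp i in ex_intro _ x (conj Kx fx)).
exists (\sum_i c i *: q i); first by apply: lin_hull_sum => i; exact: sub_lin_hull.
rewrite linear_on_sum; first by apply: eq_bigr => i _; rewrite qp.
by move=> i; exact: sub_lin_hull.
Qed.

End LinearOn.

(** * Transport of solid angles along isometries *)

Section SolidAngle.
Context {R : realType}.

(** The sizes [q] and [n] are equal only a posteriori: orthonormal rows give [q <= n], the left
    inverse gives [n <= q]. Then [O] is orthogonal, of determinant [1] or [-1]. *)
Lemma vol_isometry q n (O : 'M[R]_(q, n)) (C : 'M[R]_(n, q)) (A : set 'rV[R]_n) :
  O *m O^T = 1%:M -> C *m O = 1%:M -> measurable A ->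
  vol [set c : 'rV_q | A (c *m O)] = vol A.
Proof.
move=> OO CO mA; have qn : q = n.
  apply/eqP; rewrite eqn_leq; apply/andP; split.
    have := mulmx1_min OO; by [].
  by have := mulmx1_min CO.
subst q; rewrite !vol_vint.
rewrite -[RHS](change_of_variables_unitmx (M := O)); first last.
- exact/measurable_EFinP/measurable_indic.
- by move=> v; rewrite lee_fin indicE.
- by have [] := mulmx1_unit OO.
have d1 : `|\det O| = 1.
  have : (\det O) ^+ 2 = 1 by rewrite expr2 -{2}det_tr -det_mulmx OO det1.
  by move/eqP; rewrite sqrf_eq1 => /orP[] /eqP ->; rewrite ?normrN1 ?normr1.
by rewrite d1 mul1e; apply: eq_vint => v; rewrite !indicE.
Qed.

Lemma dot_mulmx n (u v : 'rV[R]_n) : dot u v = (u *m v^T) 0 0.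
Proof. by rewrite mxE; apply: eq_bigr => i _; rewrite mxE. Qed.

Lemma dotDl n (c : R) (u v w : 'rV[R]_n) : dot (c *: u + v) w = c * dot u w + dot v w.
Proof. by rewrite !dot_mulmx mulmxDl -scalemxAl !mxE. Qed.

Lemma dotC n (u v : 'rV[R]_n) : dot u v = dot v u.
Proof. by apply: eq_bigr => i _; rewrite mulrC. Qed.

Lemma dot_eq0 n (u : 'rV[R]_n) : dot u u = 0 -> u = 0.
Proof.
rewrite dot_sum => /eqP; rewrite psumr_eq0; last by move=> i _; exact: sqr_ge0.
move=> /allP u0; apply/rowP => i; rewrite mxE; apply/eqP.
by have := u0 i (mem_index_enum _); rewrite sqrf_eq0.
Qed.

Lemma dot_evec n (v : 'rV[R]_n) i : dot v (evec i) = v 0 i.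
Proof.
rewrite /dot (bigD1 i)//= big1 ?addr0; first by rewrite mxE !eqxx mulr1.
by move=> j ji; rewrite mxE eqxx/= (negbTE ji) mulr0.
Qed.

Lemma row_sum_evec n (v : 'rV[R]_n) : v = \sum_i v 0 i *: evec i.
Proof. exact: row_sum_delta. Qed.

Variables (V : lmodType R) (g : V -> V -> R).
Hypothesis g_eq0 : forall u, g u u = 0 -> u = 0.

(** In the coordinates of the chosen basis [E] of the hull, [f] is multiplication by an orthogonal
    matrix, which preserves volume. So the ratio of volumes can be taken in the standard coordinates
    of [K'], where it is Gaussian. *)
Lemma solid_angle_isometric (K : set V) n (K' : set 'rV[R]_n) :
  isometric g K dot K' -> lin_hull K' = setT ->
  measurable K' -> scalable_set K' ->
  solid_angle g K = fine (gvol K') / Num.sqrt (2 * pi) ^+ n.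
Proof.
move=> [f [flin fiso fL fK]] LK' mK' cK'.
have sK := @sub_lin_hull _ _ K.
(* Definiteness of [g] makes [f] injective on the hull: [f u = f v] forces
   [g (u - v) (u - v) = 0]. *)
have finj u v : lin_hull K u -> lin_hull K v -> f u = f v -> u = v.
  move=> Ku Kv fuv; apply/eqP; rewrite -subr_eq0; apply/eqP/g_eq0.
  have Kuv : lin_hull K (u - v) by rewrite addrC -scaleN1r; exact: lin_hullP.
  rewrite -fiso// addrC -scaleN1r flin// fuv scaleN1r addNr.
  by rewrite /dot big1// => i _; rewrite mxE mul0r.
pose E := xget [::] [set E | orthonormal_basis g (lin_hull K) E].
(* [xget] returns a basis, and not its default, as soon as one exists; the preimages under [f] of
   the standard basis vectors form one. *)
have [Eorth EL] : orthonormal_basis g (lin_hull K) E.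
  have /choice[u /all_and2 [Ku fu]] : forall i : 'I_n, exists u, lin_hull K u /\ f u = evec i.
    move=> i; have : (f @` lin_hull K) (evec i) by rewrite fL LK'.
    by move=> [u Ku fu]; exists u.
  apply: (@xgetPex _ [::] [set E | orthonormal_basis g (lin_hull K) E]).
  exists (mkseq (fun i => if insub i is Some j then u j else 0) n); split.
    move=> i j; rewrite size_mkseq => ni nj; rewrite !nth_mkseq// !insubT.
    by rewrite -fiso// !fu dot_evec mxE eqxx/= eq_sym.
  apply/seteqP; split => [y Ky|y [m [c [p [Ep ->]]]]]; last first.
    apply: lin_hull_sum => i; have /mapP[j] := Ep i.
    rewrite mem_iota => /andP[_ nj] ->; rewrite insubT; exact: Ku.
  exists n, (fun i => f y 0 i), u; split.
    move=> i; apply/mapP; exists (i : nat); first by rewrite mem_iota ltn_ord.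
    by rewrite valK.
  apply: finj => //; first exact: lin_hull_sum.
  by rewrite (linear_on_sum flin)// {1}(row_sum_evec (f y)); apply: eq_bigr => i _; rewrite fu.
have KE i : (i < size E)%N -> lin_hull K E`_i.
  by move=> Ei; rewrite EL; apply: sub_lin_hull; exact: mem_nth.
pose O := \matrix_(i < size E, j < n) f E`_i 0 j.
have OE (c : 'rV_(size E)) : f (\sum_(i < size E) c 0 i *: E`_i) = c *m O.
  rewrite (linear_on_sum flin) => [|i]; last exact: KE.
  rewrite mulmx_sum_row; apply: eq_bigr => i _; congr (_ *: _).
  by apply/rowP => j; rewrite !mxE.
have OO : O *m O^T = 1%:M.
  apply/matrixP => i j; transitivity (g E`_i E`_j); last by rewrite Eorth// mxE.
  rewrite -fiso; [|exact: KE..].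
  by rewrite mxE; apply: eq_bigr => l _; rewrite !mxE.
(* The rows of [O] span: each standard basis vector is the image of a combination of elements of
   [E]. *)
have [C CO] : exists C : 'M[R]_(n, size E), C *m O = 1%:M.
  have /choice[c cO] : forall i : 'I_n, exists c : 'rV_(size E), c *m O = evec i.
    move=> i; have : (f @` lin_hull K) (evec i) by rewrite fL LK'.
    move=> [u]; rewrite EL => -[m [c [p [Ep ->]]]] <-.
    have Eq (j : 'I_m) : (index (p j) E < size E)%N by rewrite index_mem; exact: Ep.
    exists (\sum_(j < m) c j *: delta_mx 0 (Ordinal (Eq j))).
    rewrite mulmx_suml (linear_on_sum flin) => [|j]; last first.
      by rewrite EL; apply: sub_lin_hull; exact: Ep.
    apply: eq_bigr => j _; rewrite -scalemxAl -rowE; congr (_ *: _).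
    by apply/rowP => l; rewrite !mxE/= nth_index//; exact: Ep.
  exists (\matrix_i c i); apply/row_matrixP => i.
  by rewrite row_mul rowK cO row1.
have volE (A : set V) (A' : set 'rV[R]_n) : measurable A' ->
    (forall u, lin_hull K u -> A u = A' (f u)) ->
    vol_in g (lin_hull K) (A `&` unit_ball g) = vol (A' `&` [set v | dot v v <= 1]).
  move=> mA AA; rewrite -(@vol_isometry _ _ O C)//; last first.
    by apply: measurableI => //; exact: measurable_unit_ball.
  congr (vol _); apply/seteqP.
  rewrite -/E.
  have Kc (c : 'rV_(size E)) : lin_hull K (\sum_(i < size E) c 0 i *: E`_i).
    by apply: lin_hull_sum => i; exact: KE.
  by split => c /=; rewrite /unit_ball/= AA// -OE fiso.
rewrite /solid_angle (volE K K')//; last first.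
  move=> u Ku; rewrite -fK; apply/propext; split => [|[v Kv fuv]]; first by exists u.
  by rewrite -(finj v u)//; exact: sK.
rewrite (volE (lin_hull K) setT)//; last first.
  by move=> u Ku; apply/propext; split.
by rewrite setTI vol_cone_ratio.
Qed.

End SolidAngle.

(** * Gaussian integrals on the half-line *)

Section HalfLine.
Context {R : realType}.
Notation mu := (@lebesgue_measure R).
Notation w := (@gauss_weight R).
Notation D := (`[0%R, +oo[%classic : set R).

Lemma is_derive_gauss_weight (x : R) : is_derive x 1 w (- x * w x).
Proof.
have h : is_derive x 1 (fun t : R => - (t ^+ 2) / 2) (- x).
  apply: is_derive_eq; rewrite /GRing.scale/=. 
  by field.
have := @is_derive1_comp R expR _ x _ _ (is_derive_expR _) h.
by rewrite /comp /gauss_weight mulrC.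
Qed.

Lemma is_derive_sin_scale (z x : R) :
  is_derive x 1 (fun t => sin (z * t)) (z * cos (z * x)).
Proof.
have h : is_derive x 1 (fun t : R => z * t) z.
  by apply: is_derive_eq; rewrite /GRing.scale/= mulr1.
have := @is_derive1_comp R sin _ x _ _ (is_derive_sin _) h.
by rewrite mulrC.
Qed.

Lemma is_derive_cos_scale (z x : R) :
  is_derive x 1 (fun t => cos (z * t)) (- z * sin (z * x)).
Proof.
have h : is_derive x 1 (fun t : R => z * t) z.
  by apply: is_derive_eq; rewrite /GRing.scale/= mulr1.
have := @is_derive1_comp R cos _ x _ _ (is_derive_cos _) h.
by rewrite !mulNr mulrC.
Qed.

Lemma continuous_is_derive (F f : R -> R) :
  (forall x : R, is_derive x 1 F (f x)) -> continuous F.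
Proof.
by move=> dF x; apply: differentiable_continuous; apply/derivable1_diffP.
Qed.

Lemma continuous_gauss_weight : continuous w.
Proof. exact: continuous_is_derive is_derive_gauss_weight. Qed.

Lemma integrable_FTC2 (F f : R -> R) (a b : R) : a < b ->
  (forall x : R, is_derive x 1 F (f x)) -> continuous f ->
  (\int[mu]_(x in `[a, b]) (f x)%:E = (F b - F a)%:E)%E.
Proof.
move=> ab dF cf; have cF := continuous_is_derive dF.
rewrite (@continuous_FTC2 _ f F)//.
- exact: continuous_subspaceT.
- split; first by move=> x _; have [] := dF x.
    by apply: cvg_at_right_filter; exact: cF.
  by apply: cvg_at_left_filter; exact: cF.
- by move=> x _; rewrite derive1E; have [] := dF x.
Qed.

(** The integrand may change sign, so the half-line is exhausted by [[0, n + 1]] and the limit is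
    taken by dominated convergence, with [|f|] as the bound. The shift by one keeps every interval
    nondegenerate. *)
Lemma Rintegral_FTC2y (F f : R -> R) (l : R) :
  (forall x : R, is_derive x 1 F (f x)) -> continuous f ->
  mu.-integrable D (EFin \o f) -> F x @[x --> +oo] --> l ->
  \int[mu]_(x in D) f x = l - F 0.
Proof.
move=> dF cf intf Fl.
have mD : measurable D by [].
have key : (fun n => \int[mu]_(x in D) ((EFin \o f) \_ `[0%R, n.+1%:R]) x)%E @ \oo -->
    (\int[mu]_(x in D) (EFin \o f) x)%E.
  apply: (@dominated_cvg _ _ _ mu D mD _ _ (fun x => `|(f x)%:E|)%E) => //.
  - move=> n; apply/measurable_restrict => //.
    apply: measurable_funS measurableT _ _ => //.
    by apply/measurable_EFinP; exact: continuous_measurable_fun.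
  - move=> x; rewrite /= in_itv/= andbT => x0.
    apply: cvg_near_cst; near=> n.
    rewrite patchE mem_set//= in_itv/= x0/=.
    rewrite (le_trans (ltW (archi_boundP x0)))// ler_nat leqW//.
    by near: n; exists (Num.bound x).
  - exact: integrable_abse.
  - move=> n x _; rewrite patchE; case: ifP => //= _.
    by rewrite normr0 lee_fin.
have -> : \int[mu]_(x in D) f x = fine (\int[mu]_(x in D) (EFin \o f) x)%E by [].
have lim2 : (fun n => \int[mu]_(x in D) ((EFin \o f) \_ `[0%R, n.+1%:R]) x)%E @ \oo -->
    (l - F 0)%:E.
  rewrite (_ : (fun n => _) = (fun n => (F n.+1%:R - F 0)%:E)); last first.
    apply/funext => n; rewrite -integral_mkcondr setIidr; last first.
      by move=> x /=; rewrite !in_itv/= => /andP[->].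
    by rewrite (@integrable_FTC2 F).
  apply: cvg_EFin; first by near=> n.
  apply: cvgB; last exact: cvg_cst.
  have : (fun n => F n%:R) @ \oo --> l.
    exact: (cvg_comp _ _ cvgr_idn Fl).
  by rewrite -cvg_shiftS.
by rewrite (cvg_unique _ key lim2).
Unshelve. all: by end_near. Qed.

Definition half_integrable (f : R -> R) := mu.-integrable D (EFin \o f).

Lemma half_integrable_le (f h : R -> R) : measurable_fun setT f ->
  half_integrable h -> (forall x, 0 <= x -> `|f x| <= h x) -> half_integrable f.
Proof.
move=> mf ih fh; apply: le_integrable ih => //.
  by apply: measurable_funTS; apply/measurable_EFinP.
move=> x; rewrite /= in_itv/= andbT => x0.
by rewrite lee_fin (le_trans (fh _ x0))// ler_norm.
Qed.

Lemma half_integrable_gauss : half_integrable w.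
Proof.
apply: (@integrableS _ _ _ mu setT) => //.
apply/integrableP; split.
  by apply/measurable_EFinP; exact: measurable_gauss_weight.
under eq_integral do rewrite gee0_abs ?lee_fin ?gauss_weight_ge0//.
by rewrite integral_gauss_weight ltry.
Qed.

Lemma gauss_weightN x : w (- x) = w x.
Proof. by rewrite /gauss_weight sqrrN. Qed.

(** Folding the line at the origin serves integrands given by different formulas on the two sides of
    it. *)
Lemma ge0_integral_half (f : R -> \bar R) :
  (forall x, (0 <= f x)%E) -> measurable_fun setT f ->
  (\int[mu]_x f x = \int[mu]_(x in D) (f x + f (- x)%R))%E.
Proof.
move=> f0 mf.
have mf' : measurable_fun setT (fun x : R => f (- x)).
  exact: (measurableT_comp mf (@oppr_measurable _ _)).
rewrite ge0_integralD//; last 2 first.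
- exact: measurable_funTS.
- exact: measurable_funTS.
have -> : (\int[mu]_(x in D) f (- x)%R = \int[mu]_(x in `]-oo, 0%R[) f x)%E.
  rewrite -integral_itv_obnd_cbnd; last exact: measurable_funTS.
  rewrite [LHS]integral_mkcond [RHS]integral_mkcond -[RHS](@ge0_integral_affine _ (-1) 0).
  - rewrite normrN1 mul1e; apply: eq_integral => x _.
    by rewrite !patchE !mem_setE !in_itv/= andbT addr0 mulN1r oppr_lt0.
  - by rewrite oppr_eq0 oner_eq0.
  - by move=> t; rewrite patchE; case: ifP.
  - apply: (measurable_restrictT _ (measurable_itv _)).1.
    exact: measurable_funTS.
rewrite -ge0_integral_setU//; last 2 first.
- exact: measurable_funTS.
- by apply/disj_setPS => x [] /=; rewrite !in_itv/= andbT => /le_lt_trans h /h; rewrite ltxx.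
congr (integral _ _ _); apply/seteqP; split => x // _ /=; rewrite !in_itv/= andbT.
by have [] := leP 0 x; [left|right].
Qed.

Lemma half_integral_gauss : \int[mu]_(x in D) w x = Num.sqrt (2 * pi) / 2.
Proof.
have := integral_gauss_weight (R := R).
rewrite ge0_integral_half; last 2 first.
- by move=> x; rewrite lee_fin gauss_weight_ge0.
- by apply/measurable_EFinP; exact: measurable_gauss_weight.
under eq_integral do rewrite gauss_weightN.
rewrite ge0_integralD//; last 4 first.
- by move=> x _; rewrite lee_fin gauss_weight_ge0.
- by apply: measurable_funTS; apply/measurable_EFinP; exact: measurable_gauss_weight.
- by move=> x _; rewrite lee_fin gauss_weight_ge0.
- by apply: measurable_funTS; apply/measurable_EFinP; exact: measurable_gauss_weight.
rewrite /Rintegral -(fineK (integrable_fin_num _ half_integrable_gauss))//.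
rewrite -EFinD => -[] <- /=; lra.
Qed.

Lemma cvgy_gauss : w x @[x --> +oo] --> (0 : R).
Proof.
apply: (@squeeze_cvgr _ _ _ _ (fun=> 0) (fun x => expR (- x))).
- near=> x; rewrite gauss_weight_ge0/= ler_expR.
  have x2 : 2 <= x by near: x; exact: nbhs_pinfty_ge.
  nra.
- exact: cvg_cst.
- exact: cvgr_expR.
Unshelve. all: by end_near. Qed.

Lemma cvgy_bounded_gauss (f : R -> R) : (forall x, `|f x| <= 1) ->
  f x * w x @[x --> +oo] --> (0 : R).
Proof.
move=> f1; apply: norm_cvg0; apply: (@squeeze_cvgr _ _ _ _ (fun=> 0) w).
- near=> x; rewrite normr_ge0/= normrM (ger0_norm (gauss_weight_ge0 _)).
  by rewrite -[leRHS]mul1r ler_wpM2r// gauss_weight_ge0.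
- exact: cvg_cst.
- exact: cvgy_gauss.
Unshelve. all: by end_near. Qed.

Lemma half_integral_xgauss : (\int[mu]_(x in D) (x * w x)%:E = 1)%E.
Proof.
have dF (x : R) : is_derive x 1 (fun x => - w x) (x * w x).
  by apply: is_derive_eq (is_deriveN (is_derive_gauss_weight x)) _; rewrite mulNr opprK.
rewrite (@ge0_continuous_FTC2y _ _ (fun x => - w x) 0 0).
- by rewrite /gauss_weight expr0n/= oppr0 mul0r expR0 -EFinB sub0r opprK.
- by move=> x x0; rewrite mulr_ge0// gauss_weight_ge0.
- apply: continuous_subspaceT => x; apply: cvgM; first exact: cvg_id.
  exact: continuous_gauss_weight.
- by rewrite -oppr0; apply: cvgN; exact: cvgy_gauss.
- by move=> x _; have [] := dF x.
- by apply: cvg_at_right_filter; exact: (continuous_is_derive dF).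
- by move=> x _; rewrite derive1E; have [] := dF x.
Qed.

Lemma half_integrable_xgauss : half_integrable (fun x => x * w x).
Proof.
apply/integrableP; split.
  apply: measurable_funTS; apply/measurable_EFinP; apply: measurable_funM => //.
  exact: measurable_gauss_weight.
under eq_integral => x.
  rewrite inE/= in_itv/= andbT => x0.
  rewrite /= ger0_norm ?mulr_ge0 ?gauss_weight_ge0//.
  over.
by rewrite half_integral_xgauss ltry.
Qed.

(** The bound [G] on the derivative is uniform in the parameter, so the radius [1] of the
    neighbourhood used for domination is arbitrary. *)
Lemma is_derive_half_integral (f df : R -> R -> R) (G : R -> R) :
  (forall z, half_integrable (f z)) ->
  (forall z x : R, is_derive z 1 (f ^~ x) (df z x)) ->
  (forall x, 0 <= G x) -> half_integrable G ->
  (forall z x, 0 <= x -> `|df z x| <= G x) ->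
  forall z : R, is_derive z 1 (fun z => \int[mu]_(x in D) f z x) (\int[mu]_(x in D) df z x).
Proof.
move=> intf dF G0 intG dfG z.
have mD : measurable D by [].
have zI : `]z - 1, z + 1[%classic z by rewrite /= in_itv/=; apply/andP; split; lra.
have dE u x : partial1of2 f u x = df u x by rewrite partial1of2E; have [] := dF u x.
have derf u y : `]z - 1, z + 1[%classic u -> D y -> derivable (f ^~ y) u 1.
  by move=> _ _; have [] := dF u y.
have Gub u y : `]z - 1, z + 1[%classic u -> D y -> `|partial1of2 f u y| <= G y.
  by move=> _; rewrite /= in_itv/= andbT dE; exact: dfG.
have intf' u : `]z - 1, z + 1[%classic u -> mu.-integrable D (EFin \o f u).
  by move=> _; exact: intf.
split.
  exact: (@derivable_under_integral R _ (measurableTypeR R) mu f D mD _ _ _ zI intf' derf _ G0 intG Gub).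
have := @differentiation_under_integral R _ (measurableTypeR R) mu f D mD _ _ _ zI
  intf' derf _ G0 intG Gub.
rewrite derive1E => ->; apply: eq_Rintegral => x _; exact: dE.
Qed.

End HalfLine.

(** * The half-line Fourier transform of the Gaussian *)

Section GaussianTransforms.
Context {R : realType}.
Notation mu := (@lebesgue_measure R).
Notation w := (@gauss_weight R).
Notation D := (`[0%R, +oo[%classic : set R).

Lemma is_derive_sin_scalel (z x : R) :
  is_derive z 1 (fun t => sin (t * x)) (x * cos (z * x)).
Proof.
have h : is_derive z 1 (fun t : R => t * x) x.
  by apply: is_derive_eq; rewrite /GRing.scale/= mulr1 mulr0 add0r.
have := @is_derive1_comp R sin _ z _ _ (is_derive_sin _) h.
by rewrite mulrC.
Qed.

Lemma is_derive_cos_scalel (z x : R) :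
  is_derive z 1 (fun t => cos (t * x)) (- x * sin (z * x)).
Proof.
have h : is_derive z 1 (fun t : R => t * x) x.
  by apply: is_derive_eq; rewrite /GRing.scale/= mulr1 mulr0 add0r.
have := @is_derive1_comp R cos _ z _ _ (is_derive_cos _) h.
by rewrite !mulNr mulrC.
Qed.

Lemma is_deriveMR (f g : R -> R) (x df dg : R) :
  is_derive x 1 f df -> is_derive x 1 g dg ->
  is_derive x 1 (fun t => f t * g t) (df * g x + f x * dg).
Proof.
move=> hf hg; apply: is_derive_eq (is_deriveM hf hg) _.
by rewrite /GRing.scale/= addrC [df * _]mulrC.
Qed.

Lemma is_deriveMc (f : R -> R) (c x df : R) :
  is_derive x 1 f df -> is_derive x 1 (fun t => f t * c) (df * c).
Proof.
move=> hf; have := is_deriveMR hf (is_derive_cst c x 1).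
by rewrite mulr0 addr0.
Qed.

Lemma measurable_sin_scale z : measurable_fun setT (fun x : R => sin (z * x)).
Proof.
apply: continuous_measurable_fun.
exact: (continuous_is_derive (is_derive_sin_scale z)).
Qed.

Lemma measurable_cos_scale z : measurable_fun setT (fun x : R => cos (z * x)).
Proof.
apply: continuous_measurable_fun.
exact: (continuous_is_derive (is_derive_cos_scale z)).
Qed.

Lemma half_integrable_bounded_gauss (f : R -> R) : measurable_fun setT f ->
  (forall x, `|f x| <= 1) -> half_integrable (fun x => f x * w x).
Proof.
move=> mf f1; apply: (half_integrable_le _ half_integrable_gauss).
  by apply: measurable_funM => //; exact: measurable_gauss_weight.
move=> x _; rewrite normrM (ger0_norm (gauss_weight_ge0 _)).
by rewrite -[leRHS]mul1r ler_wpM2r// gauss_weight_ge0.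
Qed.

Lemma half_integrable_bounded_xgauss (f : R -> R) : measurable_fun setT f ->
  (forall x, `|f x| <= 1) -> half_integrable (fun x => x * f x * w x).
Proof.
move=> mf f1; apply: (half_integrable_le _ half_integrable_xgauss).
  by do 2?apply: measurable_funM => //; exact: measurable_gauss_weight.
move=> x x0; rewrite !normrM (ger0_norm (gauss_weight_ge0 _)) (ger0_norm x0).
rewrite ler_wpM2r ?gauss_weight_ge0//.
by rewrite -[leRHS]mulr1 ler_wpM2l.
Qed.

(** The absolute value makes this dominating function nonnegative on the whole line, as
    differentiation under the integral asks. *)
Lemma half_integrable_abs_xgauss : half_integrable (fun x => `|x| * w x).
Proof.
apply: (half_integrable_le _ half_integrable_xgauss).
  by apply: measurable_funM; [exact: normr_measurable|exact: measurable_gauss_weight].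
by move=> x x0; rewrite normrM normr_id (ger0_norm (gauss_weight_ge0 _)) ger0_norm.
Qed.

(** [half_cos z] and [dawson z] are the real and imaginary parts of the integral of
    [e^(izx) e^(-x^2/2)] over [x >= 0]. The second is [sqrt 2] times the Dawson function at
    [z / sqrt 2]. *)
Definition half_cos z := \int[mu]_(x in D) (cos (z * x) * w x).
Definition dawson z := \int[mu]_(x in D) (sin (z * x) * w x).

Lemma RintegralD_half (f g : R -> R) : half_integrable f -> half_integrable g ->
  \int[mu]_(x in D) (f x + g x) = \int[mu]_(x in D) f x + \int[mu]_(x in D) g x.
Proof. by move=> fi gi; rewrite (@RintegralD _ (measurableTypeR R)). Qed.

Lemma RintegralZ_half (f : R -> R) c : half_integrable f ->
  \int[mu]_(x in D) (c * f x) = c * \int[mu]_(x in D) f x.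
Proof. by move=> fi; rewrite (@RintegralZl _ (measurableTypeR R)). Qed.

Lemma half_integrableD (f g : R -> R) : half_integrable f -> half_integrable g ->
  half_integrable (fun x => f x + g x).
Proof.
move=> fi gi.
exact: (@integrableD _ (measurableTypeR R) R mu D (measurable_itv _) _ _ fi gi).
Qed.

Lemma half_integrableZ (f : R -> R) c : half_integrable f ->
  half_integrable (fun x => c * f x).
Proof.
move=> fi; exact: (@integrableZl _ (measurableTypeR R) R mu D (measurable_itv _) c _ fi).
Qed.

Lemma is_derive_half_cos (z : R) :
  is_derive z 1 half_cos (- \int[mu]_(x in D) (x * sin (z * x) * w x)).
Proof.
apply: is_derive_eq (is_derive_half_integral (f := fun z x => cos (z * x) * w x)
  (df := fun z x => - x * sin (z * x) * w x) (G := fun x => `|x| * w x) _ _ _ _ _ z) _.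
- move=> u; apply: half_integrable_bounded_gauss; first exact: measurable_cos_scale.
  by move=> x; exact: cos_max.
- by move=> u x; apply: is_deriveMc; exact: is_derive_cos_scalel.
- by move=> x; rewrite mulr_ge0// gauss_weight_ge0.
- exact: half_integrable_abs_xgauss.
- move=> u x x0; rewrite !normrM normrN (ger0_norm (gauss_weight_ge0 _)).
  rewrite ler_wpM2r ?gauss_weight_ge0//.
  by rewrite -[leRHS]mulr1 ler_wpM2l// sin_max.
rewrite -mulN1r -RintegralZ_half; last first.
  apply: half_integrable_bounded_xgauss; first exact: measurable_sin_scale.
  by move=> x; exact: sin_max.
by apply: eq_Rintegral => x _; ring.
Qed.

Lemma is_derive_dawson_aux (z : R) :
  is_derive z 1 dawson (\int[mu]_(x in D) (x * cos (z * x) * w x)).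
Proof.
apply: (is_derive_half_integral (f := fun z x => sin (z * x) * w x)
  (df := fun z x => x * cos (z * x) * w x) (G := fun x => `|x| * w x)).
- move=> u; apply: half_integrable_bounded_gauss; first exact: measurable_sin_scale.
  by move=> x; exact: sin_max.
- by move=> u x; apply: is_deriveMc; exact: is_derive_sin_scalel.
- by move=> x; rewrite mulr_ge0// gauss_weight_ge0.
- exact: half_integrable_abs_xgauss.
- move=> u x x0; rewrite !normrM (ger0_norm (gauss_weight_ge0 _)).
  rewrite ler_wpM2r ?gauss_weight_ge0//.
  by rewrite -[leRHS]mulr1 ler_wpM2l// cos_max.
Qed.

(** Integration by parts: [sin (z x) * w x] vanishes both at [0] and at infinity. *)
Lemma half_integral_xsin (z : R) :
  \int[mu]_(x in D) (x * sin (z * x) * w x) = z * half_cos z.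
Proof.
have iC : half_integrable (fun x => cos (z * x) * w x).
  apply: half_integrable_bounded_gauss; first exact: measurable_cos_scale.
  by move=> x; exact: cos_max.
have iS : half_integrable (fun x => x * sin (z * x) * w x).
  apply: half_integrable_bounded_xgauss; first exact: measurable_sin_scale.
  by move=> x; exact: sin_max.
have dF (x : R) : is_derive x 1 (fun x => sin (z * x) * w x)
    (z * (cos (z * x) * w x) + -1 * (x * sin (z * x) * w x)).
  apply: is_derive_eq (is_deriveMR (is_derive_sin_scale z x) (is_derive_gauss_weight x)) _.
  by ring.
have cont : continuous (fun x => z * (cos (z * x) * w x) + -1 * (x * sin (z * x) * w x)).
  have cw := continuous_gauss_weight.
  have cs : continuous (fun x : R => sin (z * x)) := continuous_is_derive (is_derive_sin_scale z).
  have cc : continuous (fun x : R => cos (z * x)) := continuous_is_derive (is_derive_cos_scale z).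
  move=> x; apply: cvgD; apply: cvgM; try exact: cvg_cst.
    by apply: cvgM; [exact: cc|exact: cw].
  apply: cvgM; last exact: cw.
  by apply: cvgM; [exact: cvg_id|exact: cs].
have := Rintegral_FTC2y dF cont (half_integrableD (half_integrableZ _ iC) (half_integrableZ _ iS))
  (cvgy_bounded_gauss (fun x => sin_max (z * x))).
rewrite RintegralD_half; [|exact: half_integrableZ..].
rewrite !RintegralZ_half// mulr0 sin0 mul0r subr0 mulN1r => /eqP.
by rewrite subr_eq0 => /eqP.
Qed.

(** Integration by parts again; now [cos (z x) * w x] equals [1] at the origin, whence the
    inhomogeneous term. *)
Lemma half_integral_xcos (z : R) :
  \int[mu]_(x in D) (x * cos (z * x) * w x) = 1 - z * dawson z.
Proof.
have iC : half_integrable (fun x => sin (z * x) * w x).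
  apply: half_integrable_bounded_gauss; first exact: measurable_sin_scale.
  by move=> x; exact: sin_max.
have iS : half_integrable (fun x => x * cos (z * x) * w x).
  apply: half_integrable_bounded_xgauss; first exact: measurable_cos_scale.
  by move=> x; exact: cos_max.
have dF (x : R) : is_derive x 1 (fun x => cos (z * x) * w x)
    (- z * (sin (z * x) * w x) + -1 * (x * cos (z * x) * w x)).
  apply: is_derive_eq (is_deriveMR (is_derive_cos_scale z x) (is_derive_gauss_weight x)) _.
  by ring.
have cont : continuous (fun x => - z * (sin (z * x) * w x) + -1 * (x * cos (z * x) * w x)).
  have cw := continuous_gauss_weight.
  have cs : continuous (fun x : R => sin (z * x)) := continuous_is_derive (is_derive_sin_scale z).
  have cc : continuous (fun x : R => cos (z * x)) := continuous_is_derive (is_derive_cos_scale z).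
  move=> x; apply: cvgD; apply: cvgM; try exact: cvg_cst.
    by apply: cvgM; [exact: cs|exact: cw].
  apply: cvgM; last exact: cw.
  by apply: cvgM; [exact: cvg_id|exact: cc].
have := Rintegral_FTC2y dF cont (half_integrableD (half_integrableZ _ iC) (half_integrableZ _ iS))
  (cvgy_bounded_gauss (fun x => cos_max (z * x))).
rewrite RintegralD_half; [|exact: half_integrableZ..].
rewrite !RintegralZ_half// mulr0 cos0 mul1r /gauss_weight expr0n/= oppr0 mul0r expR0.
rewrite -/(dawson z); lra.
Qed.

(** The reciprocal of [w], used as integrating factor for the differential equations of [half_cos]
    and [dawson]. *)
Definition egauss (z : R) : R := expR (z ^+ 2 / 2).

Lemma is_derive_egauss (x : R) : is_derive x 1 egauss (x * egauss x).
Proof.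
have h : is_derive x 1 (fun t : R => (t ^+ 2) / 2) x.
  apply: is_derive_eq; rewrite /GRing.scale/=.
  by field.
have := @is_derive1_comp R expR _ x _ _ (is_derive_expR _) h.
by rewrite /comp mulrC.
Qed.

Lemma egaussK z : w z * egauss z = 1.
Proof. by rewrite /gauss_weight /egauss mulNr expRN mulVf// gt_eqF// expR_gt0. Qed.

(* Both sides solve y' = - z y; [half_cos]' = - z [half_cos] comes from integrating
   by parts. *)
Lemma half_cosE (z : R) : half_cos z = Num.sqrt (2 * pi) / 2 * w z.
Proof.
have d (x : R) : is_derive x 1 (fun x => egauss x * half_cos x) 0.
  apply: is_derive_eq (is_deriveMR (is_derive_egauss x) (is_derive_half_cos x)) _.
  by rewrite half_integral_xsin; ring.
have := is_derive_0_is_cst z 0 d.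
have -> : half_cos 0 = Num.sqrt (2 * pi) / 2.
  by rewrite -half_integral_gauss; apply: eq_Rintegral => x _; rewrite mul0r cos0 mul1r.
rewrite /egauss expr0n/= mul0r expR0 mul1r -/(egauss z) => <-.
by rewrite mulrC mulrA egaussK mul1r.
Qed.

Lemma is_derive_dawson (z : R) : is_derive z 1 dawson (1 - z * dawson z).
Proof. by rewrite -half_integral_xcos; exact: is_derive_dawson_aux. Qed.

(** By [y' = 1 - z y], the product is a primitive of [egauss]. This is how [Phi] on the imaginary
    axis, an integral of [e^(t^2/2)], comes to be expressed by [dawson]. *)
Lemma is_derive_egauss_dawson (z : R) :
  is_derive z 1 (fun z => egauss z * dawson z) (egauss z).
Proof.
apply: is_derive_eq (is_deriveMR (is_derive_egauss z) (is_derive_dawson z)) _.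
by ring.
Qed.

Lemma dawsonN z : dawson (- z) = - dawson z.
Proof.
rewrite /dawson -[RHS]mulN1r -RintegralZ_half.
  by apply: eq_Rintegral => x _; rewrite mulNr sinN mulNr mulN1r.
apply: half_integrable_bounded_gauss; first exact: measurable_sin_scale.
by move=> x; exact: sin_max.
Qed.

(** Along the segment from [0] to [iy] the exponent [- (t i y)^2 / 2] is real and positive, so the
    integrand is [i] times the real function [y * egauss (t * y)]. *)
Lemma Phi_im (y : R) : Phi ('i%C * y%:C) =
  (2^-1 +i* ((Num.sqrt (2 * pi))^-1 * (egauss y * dawson y)))%C.
Proof.
have E t : 'i%C * y%:C * Cexp (- (t%:C * ('i%C * y%:C)) ^+ 2 / 2) =
    (0 +i* (y * egauss (t * y)))%C.
  have -> : - (t%:C * ('i%C * y%:C)) ^+ 2 / 2 = ((t * y) ^+ 2 / 2)%:C :> R[i].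
    rewrite mulrCA -rmorphM/= exprMn sqr_i -rmorphXn/= mulN1r opprK.
    by rewrite [RHS]rmorphM/= fmorphV/= rmorph_nat.
  rewrite /Cexp/= cos0 sin0 -/(egauss (t * y)).
  by apply/eqP; rewrite eq_complex/=; apply/andP; split; apply/eqP; ring.
rewrite /Phi /Cintegral.
have -> : \int[mu]_(t in `[0, 1]) complex.Re
    ('i%C * y%:C * Cexp (- (t%:C * ('i%C * y%:C)) ^+ 2 / 2)) = 0.
  by under eq_Rintegral do rewrite E/=; rewrite Rintegral_cst// mul0r.
have -> : \int[mu]_(t in `[0, 1]) complex.Im
    ('i%C * y%:C * Cexp (- (t%:C * ('i%C * y%:C)) ^+ 2 / 2)) = egauss y * dawson y.
  under eq_Rintegral do rewrite E/=.
  have dF (t : R) : is_derive t 1 (fun t => egauss (t * y) * dawson (t * y)) (y * egauss (t * y)).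
    have h : is_derive t 1 (fun t : R => t * y) y.
      by apply: is_derive_eq; rewrite /GRing.scale/= mulr1 mulr0 add0r.
    have := @is_derive1_comp R (fun z => egauss z * dawson z) _ t _ _ (is_derive_egauss_dawson _) h.
    by rewrite mulrC.
  have cf : continuous (fun t : R => y * egauss (t * y)).
    move=> t; apply: cvgM; first exact: cvg_cst.
    apply: (continuous_comp (f := fun t : R => t * y)).
      by apply: cvgM; [exact: cvg_id|exact: cvg_cst].
    exact: (continuous_is_derive is_derive_egauss).
  rewrite /Rintegral (integrable_FTC2 _ dF cf)//= mul1r mul0r.
  suff -> : dawson 0 = 0 by rewrite mulr0 subr0.
  by rewrite /dawson; under eq_Rintegral do rewrite mul0r sin0 mul0r; rewrite Rintegral_cst// mul0r.
have -> : 2^-1 = (2^-1)%:C :> R[i] by rewrite fmorphV/= rmorph_nat.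
by apply/eqP; rewrite eq_complex/=; apply/andP; split; apply/eqP; ring.
Qed.

(** The bridge between Fourier transforms and [Phi]: the factor [e^(-y^2/2)] cancels [egauss] in the
    imaginary part, and turns the real part [1/2] into a multiple of [half_cos y]. *)
Lemma expR_Phi_im (y : R) : (expR (- (y ^+ 2 / 2)))%:C * Phi ('i%C * y%:C) =
  ((Num.sqrt (2 * pi))^-1)%:C * (half_cos y +i* dawson y)%C.
Proof.
rewrite Phi_im half_cosE -mulNr -/(gauss_weight y).
have s0 : Num.sqrt (2 * pi) != 0 :> R by rewrite gt_eqF// sqrtr_gt0 mulr_gt0// pi_gt0.
have := egaussK y; set W := w y => we.
apply/eqP; rewrite eq_complex/=; apply/andP; split; apply/eqP.
  by rewrite !mul0r !subr0; field.
rewrite !mul0r !addr0 mulrCA; congr (_ * _).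
by rewrite mulrA we mul1r.
Qed.

End GaussianTransforms.

(** * Real values of [Phi] and Fubini on the quadrant *)

Section HalfLineFubini.
Context {R : realType}.
Notation mu := (@lebesgue_measure R).
Notation w := (@gauss_weight R).
Notation D := (`[0%R, +oo[%classic : set R).

(** The signed integral of [w] from [0] to [a], along the same parametrised segment as in [Phi]; it
    is meaningful for negative [a]. *)
Definition phi_int (a : R) := \int[mu]_(t in `[0, 1]) (a * w (t * a)).

Lemma phi_intN a : phi_int (- a) = - phi_int a.
Proof.
have ci : mu.-integrable `[0, 1]%classic (EFin \o (fun t => a * w (t * a))).
  apply: continuous_compact_integrable; first exact: segment_compact.
  apply: continuous_subspaceT => t.
  apply: cvgM; first exact: cvg_cst.
  apply: (continuous_comp (f := fun t : R => t * a)).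
    by apply: cvgM; [exact: cvg_id|exact: cvg_cst].
  exact: continuous_gauss_weight.
rewrite /phi_int -[RHS]mulN1r -(@RintegralZl _ (measurableTypeR R))//.
by apply: eq_Rintegral => t _; rewrite mulrN gauss_weightN mulNr mulN1r.
Qed.

Lemma Phi_re (y : R) : Phi y%:C = (2^-1 + (Num.sqrt (2 * pi))^-1 * phi_int y)%:C.
Proof.
have E t : y%:C * Cexp (- (t%:C * y%:C) ^+ 2 / 2) = (y * w (t * y))%:C.
  have -> : - (t%:C * y%:C) ^+ 2 / 2 = (- ((t * y) ^+ 2) / 2)%:C :> R[i].
    by rewrite -rmorphM/= -rmorphXn/= [RHS]rmorphM/= fmorphV/= rmorph_nat rmorphN.
  rewrite /Cexp/= cos0 sin0.
  by apply/eqP; rewrite eq_complex/=; apply/andP; split; apply/eqP; rewrite /gauss_weight; ring.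
rewrite /Phi /Cintegral.
have -> : \int[mu]_(t in `[0, 1]) complex.Re
    (y%:C * Cexp (- (t%:C * y%:C) ^+ 2 / 2)) = phi_int y.
  by under eq_Rintegral do rewrite E/=.
have -> : \int[mu]_(t in `[0, 1]) complex.Im
    (y%:C * Cexp (- (t%:C * y%:C) ^+ 2 / 2)) = 0.
  by under eq_Rintegral do rewrite E/=; rewrite Rintegral_cst// mul0r.
have -> : 2^-1 = (2^-1)%:C :> R[i] by rewrite fmorphV/= rmorph_nat.
by apply/eqP; rewrite eq_complex/=; apply/andP; split; apply/eqP; ring.
Qed.

Lemma integral_gauss_itv (a : R) : 0 <= a ->
  (\int[mu]_(x in `[0%R, a]) (w x)%:E = (phi_int a)%:E)%E.
Proof.
rewrite le_eqVlt => /orP[/eqP<-|a0].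
  rewrite set_itv1 integral_set1 /phi_int.
  by under eq_Rintegral do rewrite mul0r; rewrite Rintegral_cst// mul0r.
have mw : measurable_fun setT (fun x : R => (w x)%:E).
  by apply/measurable_EFinP; exact: measurable_gauss_weight.
rewrite integral_mkcond -(@ge0_integral_affine _ a 0).
- have -> : (\int[mu]_t ((fun x => (w x)%:E) \_ `[0%R, a]) (a * t + 0)%R =
             \int[mu]_(t in `[0%R, 1%R]) (w (t * a))%:E)%E.
    rewrite [RHS]integral_mkcond; apply: eq_integral => t _.
    rewrite !patchE !mem_setE !in_itv/= addr0 mulrC.
    by rewrite pmulr_lge0// ger_pMl.
  have ci : mu.-integrable `[0, 1]%classic (EFin \o (fun t => w (t * a))).
    apply: continuous_compact_integrable; first exact: segment_compact.
    apply: continuous_subspaceT => t.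
    apply: (continuous_comp (f := fun t : R => t * a)).
      by apply: cvgM; [exact: cvg_id|exact: cvg_cst].
    exact: continuous_gauss_weight.
  rewrite gtr0_norm// /phi_int (@RintegralZl _ (measurableTypeR R))// EFinM /Rintegral fineK//.
  exact: integrable_fin_num.
- by rewrite gt_eqF.
- by move=> t; rewrite patchE; case: ifP => // _; rewrite lee_fin gauss_weight_ge0.
- by apply: (measurable_restrictT _ (measurable_itv _)).1; exact: measurable_funTS.
Qed.

Lemma half_integrableP (f : R -> R) : half_integrable f ->
  (\int[mu]_(x in D) (f x)%:E = (\int[mu]_(x in D) f x)%:E)%E.
Proof. by move=> fi; rewrite /Rintegral fineK//; exact: integrable_fin_num. Qed.

Section HalfFubini.
Variables (f : R -> R -> R) (h k : R -> R).
Hypothesis mf : measurable_fun setT (fun p : R * R => f p.1 p.2).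
Hypothesis ih : half_integrable h.
Hypothesis ik : half_integrable k.
Hypothesis h0 : forall x, 0 <= x -> 0 <= h x.
Hypothesis k0 : forall x, 0 <= x -> 0 <= k x.
Hypothesis fhk : forall x y, 0 <= x -> 0 <= y -> `|f x y| <= h x * k y.

(** Extension by zero from the quadrant to the plane, where Fubini for the product measure
    applies. *)
Let F (p : measurableTypeR R * measurableTypeR R) : \bar R :=
  (\1_D p.1 * (\1_D p.2 * f p.1 p.2))%:E.

Let mF : measurable_fun setT F.
Proof.
have mD : measurable_fun setT (\1_D : R -> R) by exact: measurable_indic.
apply/measurable_EFinP; apply: measurable_funM.
  exact: (measurableT_comp mD measurable_fst).
apply: measurable_funM => //.
exact: (measurableT_comp mD measurable_snd).
Qed.

Lemma half_integrable_section1 x : 0 <= x -> half_integrable (f x).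
Proof.
move=> x0; apply: half_integrable_le (half_integrableZ (h x) ik) _ => [|y y0].
  exact: (measurable_fun2 mf (measurable_cst x) (@measurable_id _ _ _)).
exact: fhk.
Qed.

Lemma half_integrable_section2 y : 0 <= y -> half_integrable (f ^~ y).
Proof.
move=> y0; apply: half_integrable_le (half_integrableZ (k y) ih) _ => [|x x0].
  exact: (measurable_fun2 mf (@measurable_id _ _ _) (measurable_cst y)).
by rewrite mulrC; exact: fhk.
Qed.

Let F1 x : (\int[mu]_y F (x, y) = (\1_D x * \int[mu]_(y in D) f x y)%:E)%E.
Proof.
have [x0|x0] := boolP (x \in D); last first.
  rewrite indicE (negbTE x0) mul0r (_ : (fun y => _) = cst 0%E) ?integral0//.
  by apply/funext => y; rewrite /F/= indicE (negbTE x0) mul0r.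
rewrite indicE x0 mul1r -half_integrableP; last first.
  by apply: half_integrable_section1; move: x0; rewrite inE/= in_itv/= andbT.
rewrite [RHS]integral_mkcond; apply: eq_integral => y _.
by rewrite /F/= indicE x0 mul1r patchE indicE; case: ifP; rewrite ?mul1r ?mul0r.
Qed.

Let F2 y : (\int[mu]_x F (x, y) = (\1_D y * \int[mu]_(x in D) f x y)%:E)%E.
Proof.
have [y0|y0] := boolP (y \in D); last first.
  rewrite indicE (negbTE y0) mul0r (_ : (fun x => _) = cst 0%E) ?integral0//.
  by apply/funext => x; rewrite /F/= [\1_D y]indicE (negbTE y0) mul0r mulr0.
rewrite indicE y0 mul1r -half_integrableP; last first.
  by apply: half_integrable_section2; move: y0; rewrite inE/= in_itv/= andbT.
rewrite [RHS]integral_mkcond; apply: eq_integral => x _.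
by rewrite /F/= !indicE y0 mul1r patchE; case: ifP; rewrite ?mul1r ?mul0r.
Qed.

(** By Tonelli it is enough to bound iterated integrals of [|F|]; the product bound makes the inner
    one at most [h x] times the integral of [k]. *)
Let iF : (mu \x mu)%E.-integrable setT F.
Proof.
apply/integrable12ltyP => //.
have H x : (\int[mu]_y `|F (x, y)| <= ((EFin \o h) \_ D) x * (\int[mu]_(y in D) k y)%:E)%E.
  rewrite patchE; case: ifPn => x0; last first.
    rewrite mul0e (_ : (fun y => _) = cst 0%E) ?integral0//.
    by apply/funext => y; rewrite /F/= indicE (negbTE x0) mul0r normr0.
  have hx0 : 0 <= x by move: x0; rewrite inE/= in_itv/= andbT.
  rewrite -EFinM -RintegralZ_half// -half_integrableP; last exact: half_integrableZ.
  rewrite [leRHS]integral_mkcond; apply: ge0_le_integral => //.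
  - exact: (measurableT_comp (measurableT_comp (@abse_measurable R setT) mF) (pair1_measurable x)).
  - apply: (measurable_restrictT _ (measurable_itv _)).1.
    by have /integrableP[] := half_integrableZ (h x) ik.
  - move=> y _; rewrite /F/= patchE !indicE x0 mul1r; case: ifPn => y0.
      by rewrite mul1r lee_fin fhk//; move: y0; rewrite inE/= in_itv/= andbT.
    by rewrite mul0r normr0.
apply: (@le_lt_trans _ _ (\int[mu]_x (((EFin \o h) \_ D) x * (\int[mu]_(y in D) k y)%:E))%E).
  apply: ge0_le_integral => //.
  - by move=> x _; apply: integral_ge0.
  - apply: (measurable_fun_fubini_tonelli_F (fun p => `|F p|%E)) => //.
    exact: (measurableT_comp (@abse_measurable R setT) mF).
  - apply: emeasurable_funM => //.
    apply: (measurable_restrictT _ (measurable_itv _)).1.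
    by have /integrableP[] := ih.
rewrite ge0_integralZr//.
- by rewrite -integral_mkcond half_integrableP// -EFinM ltry.
- apply: (measurable_restrictT _ (measurable_itv _)).1.
  by have /integrableP[] := ih.
- move=> x _; rewrite patchE; case: ifPn => // x0.
  by rewrite /= lee_fin h0//; move: x0; rewrite inE/= in_itv/= andbT.
- by rewrite lee_fin Rintegral_ge0// => y; rewrite /= in_itv/= andbT; exact: k0.
Qed.

Lemma half_integrable_fubini : half_integrable (fun x => \int[mu]_(y in D) f x y).
Proof.
have := integrable_fubini_F iF.
rewrite /fubini_F; under [X in _.-integrable _ X]eq_fun do rewrite F1.
move=> H; apply/integrable_mkcond => //.
apply: eq_integrable H => // x _; rewrite patchE indicE.
by case: ifPn => x0 /=; rewrite ?mul1r ?mul0r.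
Qed.

Lemma half_fubini : \int[mu]_(x in D) (\int[mu]_(y in D) f x y) =
  \int[mu]_(y in D) (\int[mu]_(x in D) f x y).
Proof.
have := Fubini iF.
under eq_integral do rewrite F1; under [X in _ = X -> _]eq_integral do rewrite F2.
rewrite /Rintegral [in X in _ -> fine X = _]integral_mkcond.
rewrite [in X in _ -> _ = fine X]integral_mkcond => H.
congr fine; move: H; congr (_ = _); apply: eq_integral => x _; rewrite patchE indicE.
  by case: ifPn => x0 /=; rewrite ?mul1r ?mul0r.
by case: ifPn => x0 /=; rewrite ?mul1r ?mul0r.
Qed.

End HalfFubini.

End HalfLineFubini.

(** * The Fourier representation of Gaussian tails *)

Section FourierHalf.
Context {R : realType}.
Notation mu := (@lebesgue_measure R).
Notation w := (@gauss_weight R).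
Notation D := (`[0%R, +oo[%classic : set R).

Lemma norm_sin_le (y : R) : 0 <= y -> `|sin y| <= y.
Proof.
rewrite le_eqVlt => /orP[/eqP<-|y0]; first by rewrite sin0 normr0.
have [c _] := @MVT R sin cos 0 y y0 (fun x _ => is_derive_sin x)
  (continuous_subspaceT (@continuous_sin R)).
rewrite sin0 !subr0 => ->; rewrite normrM (gtr0_norm y0).
by rewrite -[leRHS]mul1r ler_wpM2r ?cos_max// ltW.
Qed.

Definition fourier_kernel (u v : R -> R) (s t : R) :=
  w t / t * (sin (t * s) * u t + cos (t * s) * v t).

(* The integrand is [w t / t] times the imaginary part of [e^(its) (u t + i v t)]. *)
Definition fourier_half (u v : R -> R) (s : R) :=
  \int[mu]_(t in D) fourier_kernel u v s t.

(* The bound [B * t] on [v] makes [v t / t] integrable near [0]. *)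
Definition tame (u v : R -> R) := [/\ measurable_fun setT u, measurable_fun setT v &
  exists2 B, 0 <= B & forall t, 0 <= t -> [/\ `|u t| <= B, `|v t| <= B & `|v t| <= B * t]].

Lemma measurable_inv : measurable_fun setT (fun t : R => t^-1).
Proof.
rewrite -(setvU [set (0 : R)]); apply/measurable_funU => //; first exact: measurableC.
split; last exact: measurable_fun_set1.
apply: open_continuous_measurable_fun; first by rewrite openC; exact: closed_eq.
by move=> x; rewrite inE/= => /eqP x0; exact: inv_continuous.
Qed.

Lemma gauss_weight0 : w 0 = 1.
Proof. by rewrite /gauss_weight expr0n/= oppr0 mul0r expR0. Qed.

(** With [y = s + a x], the bounds [|sin (t y)| <= t y] and [|v t| <= B t] give [B (y + 1) t], whose
    [t] cancels the singularity. The larger [B (1 + x) (s + a + 1)] separates [x] from [t], the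
    product form that Fubini needs. *)
Lemma tame_fubini_bound (u v : R -> R) B s a x t :
  0 <= B -> 0 <= s -> 0 <= a -> 0 <= x -> 0 <= t ->
  `|u t| <= B -> `|v t| <= B * t ->
  `|w x * fourier_kernel u v (s + a * x) t| <=
  (w x + x * w x) * (B * (s + a + 1) * w t).
Proof.
move=> B0 s0 a0 x0 t0 uB vB.
rewrite /fourier_kernel !normrM !(ger0_norm (gauss_weight_ge0 _)).
rewrite [leRHS](_ : _ = w x * (w t * (B * ((1 + x) * (s + a + 1))))); last by ring.
rewrite ler_wpM2l ?gauss_weight_ge0// -mulrA ler_wpM2l ?gauss_weight_ge0//.
(* By the convention [0^-1 = 0] the kernel vanishes at the origin. *)
have [->|tn0] := eqVneq t 0.
  by rewrite invr0 normr0 mul0r mulr_ge0// mulr_ge0// addr_ge0// addr_ge0.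
have {t0 tn0}t0 : 0 < t by rewrite lt_neqAle eq_sym tn0.
rewrite gtr0_norm ?invr_gt0// mulrC ler_pdivrMr//.
set y := s + a * x.
have y0 : 0 <= y by rewrite addr_ge0// mulr_ge0.
apply: (@le_trans _ _ (t * y * B + 1 * (B * t))).
  apply: le_trans (ler_normD _ _) _; rewrite !normrM.
  apply: lerD; apply: ler_pM => //; last exact: cos_max.
  by apply: norm_sin_le; rewrite mulr_ge0// ltW.
rewrite (_ : _ + _ = B * (y + 1) * t); last by ring.
rewrite ler_wpM2r ?(ltW t0)// ler_wpM2l// /y.
nra.
Qed.

Lemma measurable_fourier_kernel (u v : R -> R) : measurable_fun setT u ->
  measurable_fun setT v ->
  measurable_fun setT (fun p : R * R => fourier_kernel u v p.1 p.2).
Proof.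
move=> mu mv.
have mtr : measurable_fun setT (fun p : R * R => p.2 * p.1).
  by apply: measurable_funM; [exact: measurable_snd|exact: measurable_fst].
have ms : measurable_fun setT (sin : R -> R).
  by apply: continuous_measurable_fun; exact: continuous_sin.
have mc : measurable_fun setT (cos : R -> R).
  by apply: continuous_measurable_fun; exact: continuous_cos.
apply: measurable_funM.
  apply: measurable_funM.
    exact: (measurableT_comp measurable_gauss_weight measurable_snd).
  exact: (measurableT_comp measurable_inv measurable_snd).
apply: measurable_funD; apply: measurable_funM.
- exact: (measurableT_comp ms mtr).
- exact: (measurableT_comp mu measurable_snd).
- exact: (measurableT_comp mc mtr).
- exact: (measurableT_comp mv measurable_snd).
Qed.

Section FourierStep.
Variables (u v : R -> R) (s a : R).
Hypothesis uv : tame u v.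
Hypothesis s0 : 0 <= s.
Hypothesis a0 : 0 <= a.

Let f x t := w x * fourier_kernel u v (s + a * x) t.

Let mf : measurable_fun setT (fun p : R * R => f p.1 p.2).
Proof.
have [muu mvv _] := uv.
apply: measurable_funM.
  exact: (measurableT_comp measurable_gauss_weight measurable_fst).
apply: (measurable_fun2 (measurable_fourier_kernel muu mvv) _ measurable_snd).
apply: measurable_funD => //; apply: measurable_funM => //.
Qed.

Let ih : half_integrable (fun x => w x + x * w x).
Proof. exact: half_integrableD half_integrable_gauss half_integrable_xgauss. Qed.

Let h0 x : 0 <= x -> 0 <= w x + x * w x.
Proof. by move=> x0; rewrite addr_ge0 ?mulr_ge0 ?gauss_weight_ge0. Qed.

(* Averaging [e^(i t (s + a x))] over the Gaussian half-line [x >= 0] multiplies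
   [u + i v] by [half_cos (a t) + i dawson (a t)]. *)
Lemma fourier_half_translate :
  half_integrable (fun x => w x * fourier_half u v (s + a * x)) /\
  \int[mu]_(x in D) (w x * fourier_half u v (s + a * x)) =
  fourier_half (fun t => u t * half_cos (a * t) - v t * dawson (a * t))
               (fun t => u t * dawson (a * t) + v t * half_cos (a * t)) s.
Proof.
have [muu mvv [B B0 uvB]] := uv.
pose k t := B * (s + a + 1) * w t.
have ik : half_integrable k by exact: half_integrableZ half_integrable_gauss.
have c0 : 0 <= B * (s + a + 1) by rewrite mulr_ge0// !addr_ge0.
have k0 t : 0 <= t -> 0 <= k t by move=> _; rewrite mulr_ge0 ?gauss_weight_ge0.
have fhk x t : 0 <= x -> 0 <= t -> `|f x t| <= (w x + x * w x) * k t.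
  by move=> x0 t0; have [uB _ vB] := uvB t t0; exact: tame_fubini_bound.
have iJ x : 0 <= x -> half_integrable (fourier_kernel u v (s + a * x)).
  move=> x0; have := half_integrable_section1 mf ik fhk x0.
  move=> /(half_integrableZ (w x)^-1); rewrite /f.
  under eq_fun do rewrite mulrA mulVf ?mul1r ?gt_eqF ?expR_gt0//.
  by [].
have E x : 0 <= x -> w x * fourier_half u v (s + a * x) = \int[mu]_(t in D) f x t.
  by move=> x0; rewrite /fourier_half -RintegralZ_half//; exact: iJ.
split.
  have := half_integrable_fubini mf ih ik h0 k0 fhk.
  apply: eq_integrable => // x; rewrite inE/= in_itv/= andbT => x0.
  by rewrite /= E.
transitivity (\int[mu]_(x in D) (\int[mu]_(t in D) f x t)).
  by apply: eq_Rintegral => x; rewrite inE/= in_itv/= andbT; exact: E.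
rewrite (half_fubini mf ih ik h0 k0 fhk); apply: eq_Rintegral => t _.
have iC : half_integrable (fun x => cos (a * t * x) * w x).
  apply: half_integrable_bounded_gauss; first exact: measurable_cos_scale.
  by move=> x; exact: cos_max.
have iS : half_integrable (fun x => sin (a * t * x) * w x).
  apply: half_integrable_bounded_gauss; first exact: measurable_sin_scale.
  by move=> x; exact: sin_max.
rewrite /fourier_kernel.
(* The addition formulas split [e^(i t (s + a x))] into a factor free of [x] and one whose Gaussian
   average is [half_cos + i dawson] at [a t]. *)
transitivity (\int[mu]_(x in D)
  (w t / t * (sin (t * s) * u t + cos (t * s) * v t) * (cos (a * t * x) * w x) +
   w t / t * (cos (t * s) * u t - sin (t * s) * v t) * (sin (a * t * x) * w x))).
  apply: eq_Rintegral => x _; rewrite /f /fourier_kernel.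
  have -> : t * (s + a * x) = t * s + a * t * x by ring.
  by rewrite sinD cosD; ring.
rewrite RintegralD_half; [|exact: half_integrableZ..].
rewrite !RintegralZ_half// -/(half_cos _) -/(dawson _).
by ring.
Qed.

End FourierStep.

Lemma half_integrable_fourier_kernel (u v : R -> R) (s : R) : tame u v -> 0 <= s ->
  half_integrable (fourier_kernel u v s).
Proof.
move=> [muu mvv [B B0 uvB]] s0.
apply: (half_integrable_le _ (half_integrableZ (B * (s + 1)) half_integrable_gauss)).
  exact: (measurable_fun2 (measurable_fourier_kernel muu mvv) (measurable_cst s) (@measurable_id _ _ _)).
move=> t t0; have [uB _ vB] := uvB t t0.
(* The case [a = x = 0] of the Fubini bound. *)
have := tame_fubini_bound B0 s0 (lexx 0) (lexx 0) t0 uB vB.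
by rewrite !mul0r !addr0 normrM gauss_weight0 normr1 !mul1r.
Qed.

Lemma open_half_integrable (f : R -> R) : half_integrable f ->
  mu.-integrable `]0%R, +oo[%classic (EFin \o f).
Proof.
by apply: (@integrableS _ (measurableTypeR R)) => //; apply: subset_itvr; rewrite bnd_simp.
Qed.

Lemma Rintegral_open_half (f : R -> R) : half_integrable f ->
  \int[mu]_(x in `]0, +oo[) f x = \int[mu]_(x in D) f x.
Proof. by move=> fi; apply: Rintegral_itv_obnd_cbnd; exact: open_half_integrable. Qed.

Lemma fourier_half_linear (u v u' v' : R -> R) c s : tame u v -> tame u' v' -> 0 <= s ->
  fourier_half (fun t => c * (u t + u' t)) (fun t => c * (v t + v' t)) s =
  c * (fourier_half u v s + fourier_half u' v' s).
Proof.
move=> uv uv' s0; have i1 := half_integrable_fourier_kernel uv s0.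
have i2 := half_integrable_fourier_kernel uv' s0.
rewrite /fourier_half -RintegralD_half// -RintegralZ_half; last exact: half_integrableD.
by apply: eq_Rintegral => t _; rewrite /fourier_kernel; ring.
Qed.

Lemma norm_half_integral_le (f : R -> R) : measurable_fun setT f -> (forall x, `|f x| <= 1) ->
  `|\int[mu]_(x in D) (f x * w x)| <= Num.sqrt (2 * pi) / 2.
Proof.
move=> mf f1; have fi := half_integrable_bounded_gauss mf f1.
apply: (le_trans (@le_normr_Rintegral _ (measurableTypeR R) _ mu D _ (measurable_itv _) fi)).
rewrite -half_integral_gauss.
apply: (@le_Rintegral _ (measurableTypeR R) _ mu D) => //.
- exact: (@integrable_norm _ (measurableTypeR R)).
- exact: half_integrable_gauss.
move=> x _; rewrite normrM (ger0_norm (gauss_weight_ge0 _)).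
by rewrite -[leRHS]mul1r ler_wpM2r// gauss_weight_ge0.
Qed.

(** Both functions are bounded by half the Gaussian mass. Near the origin [|sin y| <= y] and the
    first moment [1] of the half-line Gaussian give [|dawson (a t)| <= a t]; the sum of the two
    constants serves all three bounds. *)
Lemma tame_gauss a : 0 <= a -> tame (fun t => half_cos (a * t)) (fun t => dawson (a * t)).
Proof.
move=> a0; have ma : measurable_fun setT (fun t : R => a * t) by exact: measurable_funM.
split.
- apply: (measurableT_comp (f := half_cos)) => //.
  by apply: continuous_measurable_fun; exact: continuous_is_derive is_derive_half_cos.
- apply: (measurableT_comp (f := dawson)) => //.
  by apply: continuous_measurable_fun; exact: continuous_is_derive is_derive_dawson.
have K0 : 0 <= Num.sqrt (2 * pi) / 2 :> R by rewrite divr_ge0// sqrtr_ge0.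
exists (Num.sqrt (2 * pi) / 2 + a); first by rewrite addr_ge0.
move=> t t0; split.
- rewrite (le_trans (norm_half_integral_le (measurable_cos_scale _) _)) ?lerDl//.
  by move=> x; exact: cos_max.
- rewrite (le_trans (norm_half_integral_le (measurable_sin_scale _) _)) ?lerDl//.
  by move=> x; exact: sin_max.
have fi : half_integrable (fun x => sin (a * t * x) * w x).
  apply: half_integrable_bounded_gauss; first exact: measurable_sin_scale.
  by move=> x; exact: sin_max.
apply: (le_trans (@le_normr_Rintegral _ (measurableTypeR R) _ mu D _ (measurable_itv _) fi)).
apply: (@le_trans _ _ (\int[mu]_(x in D) (a * t * (x * w x)))).
  apply: (@le_Rintegral _ (measurableTypeR R) _ mu D) => //.
  - exact: (@integrable_norm _ (measurableTypeR R)).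
  - exact: half_integrableZ half_integrable_xgauss.
  move=> x; rewrite /= in_itv/= andbT => x0.
  rewrite normrM (ger0_norm (gauss_weight_ge0 _)) mulrA ler_wpM2r ?gauss_weight_ge0//.
  by rewrite norm_sin_le// !mulr_ge0.
rewrite RintegralZ_half; last exact: half_integrable_xgauss.
rewrite {1}/Rintegral half_integral_xgauss/= mulr1 ler_wpM2r// lerDr//.
Qed.

Lemma tameD (u v u' v' : R -> R) : tame u v -> tame u' v' ->
  tame (fun t => u t + u' t) (fun t => v t + v' t).
Proof.
move=> [mu1 mv1 [B B0 b]] [mu2 mv2 [B' B0' b']]; split; [exact: measurable_funD..|].
exists (B + B'); first exact: addr_ge0.
move=> t t0; have [b1 b2 b3] := b t t0; have [b1' b2' b3'] := b' t t0.
by split; rewrite ?mulrDl (le_trans (ler_normD _ _))// lerD.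
Qed.

(** These are the real and imaginary parts of the product [(u + i v) (u' + i v')]; each term of the
    imaginary part keeps one factor that is [O(t)]. *)
Lemma tameM (u v u' v' : R -> R) : tame u v -> tame u' v' ->
  tame (fun t => u t * u' t - v t * v' t) (fun t => u t * v' t + v t * u' t).
Proof.
move=> [mu1 mv1 [B B0 b]] [mu2 mv2 [B' B0' b']]; split.
- by apply: measurable_funB; exact: measurable_funM.
- by apply: measurable_funD; exact: measurable_funM.
exists (B * B' + B * B'); first by rewrite addr_ge0// mulr_ge0.
move=> t t0; have [b1 b2 b3] := b t t0; have [b1' b2' b3'] := b' t t0.
split.
- by rewrite (le_trans (ler_normB _ _))// !normrM lerD// ler_pM.
- by rewrite (le_trans (ler_normD _ _))// !normrM lerD// ler_pM.
rewrite (le_trans (ler_normD _ _))// !normrM mulrDl lerD//.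
  by rewrite -mulrA ler_pM.
by rewrite mulrAC ler_pM.
Qed.

Lemma tameZ (u v : R -> R) c : tame u v -> tame (fun t => c * u t) (fun t => c * v t).
Proof.
move=> [mu1 mv1 [B B0 b]]; split; [exact: measurable_funM..|].
exists (`|c| * B); first exact: mulr_ge0.
by move=> t t0; have [b1 b2 b3] := b t t0; rewrite !normrM -mulrA !ler_wpM2l.
Qed.

Lemma tame1 : tame (fun=> 1) (fun=> 0).
Proof.
split => //; exists 1 => // t t0.
by rewrite normr1 normr0 mul1r lexx ler01.
Qed.

Lemma half_integral_indic01 (g : R -> R) :
  \int[mu]_(u in D) (\1_(`[0, 1]%classic : set R) u * g u) = \int[mu]_(u in `[0, 1]) g u.
Proof.
rewrite Rintegral_mkcond [RHS]Rintegral_mkcond; apply: eq_Rintegral => u _.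
rewrite !patchE indicE; case: ifPn => uD; case: ifPn => u01; rewrite ?mul1r ?mul0r//.
by move: uD u01; rewrite !mem_setE !in_itv/= andbT => /negbTE ->.
Qed.

(** Writing [sin (t s) / t] as the integral of [s cos (s u t)] over [0 <= u <= 1] removes the
    singularity. After Fubini the inner integral is [half_cos (s u)], again a Gaussian, and the
    outer one becomes [phi_int s]. *)
Lemma fourier_half1 (s : R) : 0 <= s ->
  fourier_half (fun=> 1) (fun=> 0) s = Num.sqrt (2 * pi) / 2 * phi_int s.
Proof.
move=> s0.
pose f t u := w t * (\1_(`[0, 1]%classic : set R) u * (s * cos (s * u * t))).
have mI : measurable_fun setT (\1_(`[0, 1]%classic) : R -> R) by exact: measurable_indic.
have mf : measurable_fun setT (fun p : R * R => f p.1 p.2).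
  apply: measurable_funM.
    exact: (measurableT_comp measurable_gauss_weight measurable_fst).
  apply: measurable_funM; first exact: (measurableT_comp mI measurable_snd).
  apply: measurable_funM => //.
  have mc : measurable_fun setT (cos : R -> R).
    by apply: continuous_measurable_fun; exact: continuous_cos.
  apply: (measurableT_comp mc); apply: measurable_funM; last exact: measurable_fst.
  by apply: measurable_funM => //; exact: measurable_snd.
pose k u := s * \1_(`[0, 1]%classic : set R) u.
have ik : half_integrable k.
  apply: half_integrableZ; apply/integrableP; split.
    by apply: measurable_funTS; apply/measurable_EFinP.
  have -> : (\int[mu]_(x in D) `|(EFin \o (\1_(`[0%R, 1%R]%classic : set R) : R -> R)) x| =
             \int[mu]_(x in D) (\1_(`[0%R, 1%R]%classic : set R) x)%:E)%E.
    by apply: eq_integral => x _; rewrite /= ger0_norm// indicE.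
  rewrite integral_indic// setIidl; last by move=> x /=; rewrite !in_itv/= andbT => /andP[].
  by rewrite /= lebesgue_measure_itv/= lte01 oppr0 adde0 ltry.
have k0 u : 0 <= u -> 0 <= k u by rewrite /k indicE mulr_ge0.
have w0 t : 0 <= t -> 0 <= w t by rewrite gauss_weight_ge0.
have fhk t u : 0 <= t -> 0 <= u -> `|f t u| <= w t * k u.
  move=> _ _; rewrite /f /k !normrM (ger0_norm (gauss_weight_ge0 _)).
  rewrite ler_wpM2l ?gauss_weight_ge0// mulrC [`|\1__ _|]ger0_norm ?indicE//.
  by rewrite ler_wpM2r// (ger0_norm s0) -[leRHS]mulr1 ler_wpM2l// cos_max.
have iF := half_integrable_fubini mf half_integrable_gauss ik w0 k0 fhk.
transitivity (\int[mu]_(t in D) \int[mu]_(u in D) f t u).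
  (* On the open half-line [t] may be divided out. *)
  rewrite /fourier_half -[LHS]Rintegral_open_half; last first.
    exact: half_integrable_fourier_kernel tame1 s0.
  rewrite -[RHS]Rintegral_open_half//.
  apply: eq_Rintegral => t; rewrite inE/= in_itv/= andbT => t0.
  have tn0 : t != 0 by rewrite gt_eqF.
  rewrite /f RintegralZ_half; last first.
    have := half_integrable_section1 mf ik fhk (ltW t0).
    move=> /(half_integrableZ (w t)^-1); rewrite /f.
    under eq_fun do rewrite mulrA mulVf ?mul1r ?gt_eqF ?expR_gt0//.
    by [].
  rewrite half_integral_indic01 /fourier_kernel mulr1 mulr0 addr0 -mulrA; congr (_ * _).
  have dF (u : R) : is_derive u 1 (fun u => sin (t * s * u) * t^-1) (s * cos (s * u * t)).
    apply: is_derive_eq (is_deriveMc t^-1 (is_derive_sin_scale (t * s) u)) _.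
    by rewrite (_ : t * s * u = s * u * t); [field|ring].
  have cf : continuous (fun u : R => s * cos (s * u * t)).
    have cc : continuous (fun u : R => cos (s * u * t)).
      rewrite (_ : (fun u => _) = (fun u => cos (t * s * u))); last first.
        by apply/funext => y; congr cos; ring.
      exact: (continuous_is_derive (is_derive_cos_scale (t * s))).
    by move=> u; apply: cvgM; [exact: cvg_cst|exact: cc].
  rewrite /Rintegral (integrable_FTC2 _ dF cf)//= mulr1 mulr0 sin0 mul0r subr0.
  by rewrite mulrC.
rewrite (half_fubini mf half_integrable_gauss ik w0 k0 fhk).
transitivity (\int[mu]_(u in D) (\1_(`[0, 1]%classic : set R) u *
    (Num.sqrt (2 * pi) / 2 * (s * w (u * s))))).
  apply: eq_Rintegral => u _.
  transitivity (\int[mu]_(t in D) (\1_(`[0, 1]%classic : set R) u * s * (cos (s * u * t) * w t))).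
    by apply: eq_Rintegral => t _; rewrite /f; ring.
  rewrite RintegralZ_half; last first.
    apply: half_integrable_bounded_gauss; first exact: measurable_cos_scale.
    by move=> x; exact: cos_max.
  by rewrite -/(half_cos _) half_cosE (mulrC s u); ring.
rewrite half_integral_indic01 /phi_int (@RintegralZl _ (measurableTypeR R))//.
apply: continuous_compact_integrable; first exact: segment_compact.
apply: continuous_subspaceT => t.
apply: cvgM; first exact: cvg_cst.
apply: (continuous_comp (f := fun t : R => t * s)).
  by apply: cvgM; [exact: cvg_id|exact: cvg_cst].
exact: continuous_gauss_weight.
Qed.

End FourierHalf.

(** * Gaussian measure of cross and cube cones *)

Section CrossGaussianVolume.
Context {R : realType}.
Notation mu := (@lebesgue_measure R).
Notation w := (@gauss_weight R).
Notation D := (`[0%R, +oo[%classic : set R).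
Notation K := (Num.sqrt (2 * pi : R)).

Lemma pi_neq0 : (pi : R) != 0.
Proof. exact: lt0r_neq0 (pi_gt0 R). Qed.

Lemma sqrt2pi_gt0 : 0 < K.
Proof. by rewrite sqrtr_gt0 mulr_gt0// pi_gt0. Qed.

Lemma sqrt2pi_neq0 : K != 0.
Proof. exact: lt0r_neq0 sqrt2pi_gt0. Qed.

Lemma sqr_sqrt2pi : K ^+ 2 = 2 * pi.
Proof. by rewrite sqr_sqrtr// mulr_ge0// pi_ge0. Qed.

(** An asymmetric absolute value, the support function of the interval [[-q, p]] for [p, q >= 0]. *)
Definition psi (p q v : R) : R := Num.max (p * v) (- (q * v)).

Lemma psi_pos p q v : 0 <= p -> 0 <= q -> 0 <= v -> psi p q v = p * v.
Proof.
by move=> p0 q0 v0; apply/max_idPl; rewrite (@le_trans _ _ 0)// ?oppr_le0 mulr_ge0.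
Qed.

Lemma psi_neg p q v : 0 <= p -> 0 <= q -> 0 <= v -> psi p q (- v) = q * v.
Proof.
move=> p0 q0 v0; rewrite /psi !mulrN opprK; apply/max_idPr.
by rewrite (@le_trans _ _ 0)// ?oppr_le0 mulr_ge0.
Qed.

Lemma measurable_psi p q : measurable_fun setT (psi p q).
Proof.
apply: measurable_maxr; first exact: measurable_funM.
by apply: measurableT_comp => //; exact: measurable_funM.
Qed.

Definition gauss_tail (s : R) : \bar R := (\int[mu]_t (w t * (s <= t)%R%:R)%:E)%E.

Lemma gauss_tail_ge0 s : (0 <= gauss_tail s)%E.
Proof. by apply: integral_ge0 => t _; rewrite lee_fin mulr_ge0 ?gauss_weight_ge0. Qed.

Lemma measurable_bool d (T : measurableType d) (f : T -> bool) :
  measurable_fun setT f -> measurable_fun setT (fun x => (f x)%:R : R).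
Proof.
move=> mf; rewrite (_ : (fun x => _) = (\1_(f @^-1` [set true]) : T -> R)).
  by apply: measurable_indic; rewrite -[X in measurable X]setTI; exact: mf.
apply/funext => x; rewrite indicE; congr ((_ : bool)%:R).
by apply/idP/idP; rewrite inE/= => /eqP; rewrite ?eqb_id.
Qed.

Lemma measurable_le_bool d (T : measurableType d) (f g : T -> R) :
  measurable_fun setT f -> measurable_fun setT g ->
  measurable_fun setT (fun x => (f x <= g x)%R%:R : R).
Proof. by move=> mf mg; apply: measurable_bool; exact: measurable_fun_ler. Qed.

Lemma measurable_gauss_tail : measurable_fun setT gauss_tail.
Proof.
apply: (@measurable_fun_fubini_tonelli_F _ _ (measurableTypeR R) (measurableTypeR R) R mu
  (fun p => (w p.2 * (p.1 <= p.2)%R%:R)%:E)).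
  apply/measurable_EFinP; apply: measurable_funM.
    exact: (measurableT_comp measurable_gauss_weight measurable_snd).
  exact: (measurable_le_bool measurable_fst measurable_snd).
by move=> p; rewrite lee_fin mulr_ge0 ?gauss_weight_ge0.
Qed.

Lemma gauss_tailE s : 0 <= s -> gauss_tail s = (K / 2 - phi_int s)%:E.
Proof.
move=> s0.
have mw : measurable_fun setT (fun x : R => (w x)%:E).
  by apply/measurable_EFinP; exact: measurable_gauss_weight.
have -> : gauss_tail s = (\int[mu]_(t in `[s, +oo[) (w t)%:E)%E.
  rewrite [RHS]integral_mkcond; apply: eq_integral => t _.
  rewrite patchE mem_setE in_itv/= andbT; case: ifP => _; first by rewrite mulr1.
  by rewrite mulr0.
have : (\int[mu]_(x in D) (w x)%:E = (K / 2)%:E)%E.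
  by rewrite -half_integral_gauss; exact: half_integrableP half_integrable_gauss.
have -> : D = `[0, s[%classic `|` `[s, +oo[%classic.
  apply/seteqP; split => x; rewrite /= !in_itv/= !andbT.
    by move=> x0; have [sx|xs] := leP s x; [right|left; rewrite x0].
  by case=> [/andP[]//|]; exact: le_trans.
rewrite ge0_integral_setU//=; last 3 first.
- exact: measurable_funTS.
- by move=> x _; rewrite lee_fin gauss_weight_ge0.
- by apply/disj_setPS => x [] /=; rewrite !in_itv/= andbT => /andP[_ /lt_le_trans h] /h; rewrite ltxx.
rewrite integral_itv_bndo_bndc; last exact: measurable_funTS.
rewrite integral_gauss_itv// => h.
by rewrite EFinB -h addeAC subee// add0e.
Qed.

(** Up to normalisation, the probability that [xi_0] is at least [s] plus the sum of the
    [psi (p i) (q i) xi_i]. The offset [s] lets the induction absorb one coordinate at a time. *)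
Definition cross_gauss n (p q : 'I_n -> R) (s : R) : \bar R :=
  vint (fun v : 'rV[R]_n => gauss_tail (s + \sum_i psi (p i) (q i) (v 0 i)) *
    (\prod_i w (v 0 i))%:E)%E.

Lemma measurable_sum_psi n (p q : 'I_n -> R) :
  measurable_fun setT (fun v : 'rV[R]_n => \sum_i psi (p i) (q i) (v 0 i)).
Proof.
apply: measurable_sum => i.
exact: (measurableT_comp (measurable_psi _ _) (measurable_coord i)).
Qed.

Lemma measurable_prod_gauss n : measurable_fun setT (fun v : 'rV[R]_n => \prod_i w (v 0 i)).
Proof.
apply: measurable_prod => i _.
exact: (measurableT_comp measurable_gauss_weight (measurable_coord i)).
Qed.

Lemma prod_gauss_ge0 n (v : 'rV[R]_n) : 0 <= \prod_i w (v 0 i).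
Proof. by apply: prodr_ge0 => i _; exact: gauss_weight_ge0. Qed.

(** The cross cone by inequalities instead of generators; for [n = 0] the sum is empty and a
    half-line remains. *)
Definition cross_set n (p q : 'I_n -> R) : set 'rV[R]_n.+1 :=
  [set v | \sum_i psi (p i) (q i) (v 0 (lift 0 i)) <= v 0 0].

(** Coordinate [0] is outermost in [gvol]; Tonelli moves it innermost, where its integral is a
    Gaussian tail. *)
Lemma gvol_cross_set n (p q : 'I_n -> R) : gvol (cross_set p q) = cross_gauss p q 0.
Proof.
rewrite /gvol /=.
pose f t (v : 'rV[R]_n) := ((w t * (\sum_i psi (p i) (q i) (v 0 i) <= t)%R%:R) *
   \prod_i w (v 0 i))%:E.
transitivity (\int[mu]_t vint (f t))%E.
  apply: eq_integral => t _; apply: eq_vint => v.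
  rewrite expR_dot big_ord_recl cons_row0 /f mulrA; congr _%:E.
  congr (_ * _); last by apply: eq_bigr => i _; rewrite cons_rowS.
  rewrite mulrC; congr (_ * _); rewrite indicE; congr ((_ : bool)%:R).
  have E : \sum_i psi (p i) (q i) (cons_row t v 0 (lift 0 i)) =
           \sum_i psi (p i) (q i) (v 0 i).
    by apply: eq_bigr => i _; rewrite cons_rowS.
  by apply/idP/idP; rewrite inE /cross_set/= cons_row0 E.
rewrite vint_exchange; last 2 first.
- by move=> t v; rewrite lee_fin !mulr_ge0 ?gauss_weight_ge0 ?prod_gauss_ge0.
- apply/measurable_EFinP; apply: measurable_funM; first apply: measurable_funM.
  + exact: (measurableT_comp measurable_gauss_weight measurable_fst).
  + apply: measurable_le_bool; last exact: measurable_fst.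
    exact: (measurableT_comp (measurable_sum_psi p q) measurable_snd).
  + exact: (measurableT_comp (@measurable_prod_gauss n) measurable_snd).
apply: eq_vint => v; rewrite add0r /gauss_tail /f.
under eq_integral do rewrite EFinM.
rewrite ge0_integralZr//.
- apply/measurable_EFinP; apply: measurable_funM; first exact: measurable_gauss_weight.
  exact: measurable_le_bool.
- by move=> t _; rewrite lee_fin mulr_ge0 ?gauss_weight_ge0.
- by rewrite lee_fin prod_gauss_ge0.
Qed.

(** The characteristic function of [psi p q xi] for a standard normal [xi]: the half-lines [xi >= 0]
    and [xi <= 0] contribute the terms in [p] and in [q]. Hence [cross_char] is that of the sum of
    independent such variables. *)
Definition chi (p q t : R) : R[i] :=
  (K^-1)%:C * ((half_cos (p * t) + half_cos (q * t)) +i* (dawson (p * t) + dawson (q * t)))%C.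

Definition cross_char n (p q : 'I_n -> R) (t : R) : R[i] := \prod_i chi (p i) (q i) t.

Lemma ReM (x y : R[i]) : complex.Re (x * y) =
  complex.Re x * complex.Re y - complex.Im x * complex.Im y.
Proof. by case: x y => [a b] [c d]. Qed.

Lemma ImM (x y : R[i]) : complex.Im (x * y) =
  complex.Re x * complex.Im y + complex.Im x * complex.Re y.
Proof. by case: x y => [a b] [c d]. Qed.

Lemma chiE p q t : chi p q t =
  ((K^-1 * (half_cos (p * t) + half_cos (q * t))) +i*
   (K^-1 * (dawson (p * t) + dawson (q * t))))%C.
Proof. by rewrite /chi; apply/eqP; rewrite eq_complex/= !mul0r subr0 addr0 !eqxx. Qed.

Lemma tame_cross_char n (p q : 'I_n -> R) :
  (forall i, 0 <= p i) -> (forall i, 0 <= q i) ->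
  tame (fun t => complex.Re (cross_char p q t)) (fun t => complex.Im (cross_char p q t)).
Proof.
elim: n p q => [|n IH] p q p0 q0.
  rewrite (_ : (fun t => complex.Re _) = (fun=> 1)); last first.
    by apply/funext => t; rewrite /cross_char big_ord0.
  rewrite (_ : (fun t => complex.Im _) = (fun=> 0)); last first.
    by apply/funext => t; rewrite /cross_char big_ord0.
  exact: tame1.
have := tameM (tameZ K^-1 (tameD (tame_gauss (p0 ord0)) (tame_gauss (q0 ord0))))
  (IH (fun i => p (lift 0 i)) (fun i => q (lift 0 i)) (fun i => p0 _) (fun i => q0 _)).
congr tame; apply/funext => t; rewrite /cross_char big_ord_recl chiE.
  by rewrite ReM.
by rewrite ImM.
Qed.

(** Induction on the number of coordinates. The first coordinate is folded at the origin, where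
    [psi] becomes linear on each side; [fourier_half_translate] for slopes [p] and [q] then
    multiplies the remaining characteristic function by one more factor [chi]. *)
Lemma cross_gaussE n (p q : 'I_n -> R) (s : R) :
  (forall i, 0 <= p i) -> (forall i, 0 <= q i) -> 0 <= s ->
  cross_gauss p q s = (K ^+ n.+1 * (2^-1 - pi^-1 *
    fourier_half (fun t => complex.Re (cross_char p q t))
                 (fun t => complex.Im (cross_char p q t)) s))%:E.
Proof.
elim: n p q s => [|n IH] p q s p0 q0 s0.
  rewrite /cross_gauss /= !big_ord0 addr0 mule1 gauss_tailE//.
  rewrite (_ : (fun t => complex.Re _) = (fun=> 1)); last first.
    by apply/funext => t; rewrite /cross_char big_ord0.
  rewrite (_ : (fun t => complex.Im _) = (fun=> 0)); last first.
    by apply/funext => t; rewrite /cross_char big_ord0.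
  rewrite fourier_half1// expr1; congr _%:E.
  (* The constant [1 / pi] is what [K ^ 2 = 2 pi] requires here. *)
  rewrite [RHS](_ : _ = K / 2 - K ^+ 2 / (2 * pi) * phi_int s).
    by rewrite sqr_sqrt2pi divff; [rewrite mul1r|rewrite mulf_neq0// gt_eqF// pi_gt0].
  by move: (K) pi_neq0 => k; move: (pi : R) => P P0; field; rewrite P0.
pose p' i := p (lift 0 i); pose q' i := q (lift 0 i).
pose u' t := complex.Re (cross_char p' q' t); pose v' t := complex.Im (cross_char p' q' t).
have p'0 i : 0 <= p' i by exact: p0.
have q'0 i : 0 <= q' i by exact: q0.
have uv' : tame u' v' by exact: tame_cross_char.
have mW : measurable_fun setT (fun x : R => cross_gauss p' q' x).
  apply: (@measurable_vint R _ R n (fun x (v : 'rV[R]_n) =>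
    gauss_tail (x + \sum_i psi (p' i) (q' i) (v 0 i)) * (\prod_i w (v 0 i))%:E)%E).
    by move=> x v; rewrite mule_ge0 ?gauss_tail_ge0// lee_fin prod_gauss_ge0.
  apply: emeasurable_funM.
    apply: (measurableT_comp measurable_gauss_tail).
    apply: measurable_funD; first exact: measurable_fst.
    exact: (measurableT_comp (measurable_sum_psi p' q') measurable_snd).
  apply/measurable_EFinP.
  exact: (measurableT_comp (@measurable_prod_gauss n) measurable_snd).
have W0 x : (0 <= cross_gauss p' q' x)%E.
  by apply: vint_ge0 => v; rewrite mule_ge0 ?gauss_tail_ge0// lee_fin prod_gauss_ge0.
transitivity (\int[mu]_t ((w t)%:E * cross_gauss p' q' (s + psi (p ord0) (q ord0) t)%R))%E.
  apply: eq_integral => t _; rewrite -vintZl ?gauss_weight_ge0//; last 2 first.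
  - by move=> v; rewrite mule_ge0 ?gauss_tail_ge0// lee_fin prod_gauss_ge0.
  - apply: emeasurable_funM.
      apply: (measurableT_comp measurable_gauss_tail).
      by apply: measurable_funD => //; exact: measurable_sum_psi.
    by apply/measurable_EFinP; exact: measurable_prod_gauss.
  apply: eq_vint => v; rewrite !big_ord_recl !cons_row0 EFinM muleCA; congr *%E.
  rewrite addrA; congr *%E; [congr (gauss_tail (_ + _))|congr _%:E];
    by apply: eq_bigr => i _; rewrite cons_rowS.
rewrite ge0_integral_half; last 2 first.
- by move=> t; rewrite mule_ge0// lee_fin gauss_weight_ge0.
- apply: emeasurable_funM.
    by apply/measurable_EFinP; exact: measurable_gauss_weight.
  apply: (measurableT_comp mW); apply: measurable_funD => //.
  exact: measurable_psi.
have [i1 e1] := fourier_half_translate uv' s0 (p0 ord0).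
have [i2 e2] := fourier_half_translate uv' s0 (q0 ord0).
pose F1 t := w t * fourier_half u' v' (s + p ord0 * t).
pose F2 t := w t * fourier_half u' v' (s + q ord0 * t).
(* The shifted offsets are nonnegative, so the induction hypothesis applies on both half-lines; the
   two constants [1/2] add up to the term [w t]. *)
transitivity (\int[mu]_(t in D) (K ^+ n.+1 * (w t + (- pi^-1) * (F1 t + F2 t)))%:E)%E.
  apply: eq_integral => t; rewrite inE/= in_itv/= andbT => t0.
  rewrite gauss_weightN psi_pos// psi_neg// !IH//; last 2 first.
  - by rewrite addr_ge0// mulr_ge0.
  - by rewrite addr_ge0// mulr_ge0.
  rewrite -!EFinM -EFinD; congr _%:E; rewrite -/u' -/v' /F1 /F2.
  by move: (K) pi_neq0 => k; move: (pi : R) => P P0; field; rewrite P0.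
have iF : half_integrable (fun t => F1 t + F2 t) by exact: half_integrableD.
have iF' : half_integrable (fun t => w t + (- pi^-1) * (F1 t + F2 t)).
  by apply: half_integrableD; [exact: half_integrable_gauss|exact: half_integrableZ].
rewrite half_integrableP; last exact: half_integrableZ.
rewrite RintegralZ_half// RintegralD_half; [|exact: half_integrable_gauss|exact: half_integrableZ].
rewrite RintegralZ_half// RintegralD_half// e1 e2 half_integral_gauss.
congr _%:E.
have tp := tameM uv' (tame_gauss (p0 ord0)).
have tq := tameM uv' (tame_gauss (q0 ord0)).
have := fourier_half_linear K^-1 tp tq s0.
set J1 := fourier_half _ _ s; set J2 := fourier_half _ _ s.
set J3 := fourier_half _ _ s; set J4 := fourier_half _ _ s.
(* The transforms for slopes [p] and [q] add up to [chi] times the characteristic function of the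
   other coordinates, split into real and imaginary parts. *)
have -> : J4 = J1.
  rewrite /J4 /J1; congr fourier_half; apply/funext => t; rewrite /cross_char big_ord_recl chiE.
    by rewrite ReM/= -/(cross_char _ _ _) /u' /v'; ring.
  by rewrite ImM/= -/(cross_char _ _ _) /u' /v'; ring.
move=> ->; rewrite [K ^+ n.+2]exprS; move: (K ^+ n.+1) => kn.
by move: (K) sqrt2pi_neq0 pi_neq0 => k; move: (pi : R) => P k0 P0; field; rewrite k0 P0.
Qed.

End CrossGaussianVolume.

(** * Normalised masses, lineality spaces and cube cones *)

Section CubeGaussianVolume.
Context {R : realType}.
Notation mu := (@lebesgue_measure R).
Notation w := (@gauss_weight R).
Notation D := (`[0%R, +oo[%classic : set R).
Notation K := (Num.sqrt (2 * pi : R)).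

Lemma gvol_cross_ratio n (p q : 'I_n -> R) :
  (forall i, 0 <= p i) -> (forall i, 0 <= q i) ->
  fine (gvol (cross_set p q)) / K ^+ n.+1 = 2^-1 - pi^-1 *
    \int[mu]_(t in `]0, +oo[) (w t / t * complex.Im (cross_char p q t)).
Proof.
move=> p0 q0; rewrite gvol_cross_set cross_gaussE//= mulrAC divff ?mul1r; last first.
  by rewrite expf_neq0// sqrt2pi_neq0.
congr (_ - _ * _); rewrite /fourier_half -Rintegral_open_half; last first.
  by apply: half_integrable_fourier_kernel => //; exact: tame_cross_char.
by apply: eq_Rintegral => t _; rewrite /fourier_kernel mulr0 sin0 cos0 mul0r add0r mul1r.
Qed.

Lemma measurable_rsubmx p n :
  measurable_fun setT (fun v : 'rV[R]_(p + n) => rsubmx v).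
Proof.
apply: measurable_rowP => i; under eq_fun do rewrite mxE.
exact: measurable_coord.
Qed.

(** Each free coordinate integrates to [K]. The identity is proved in the extended reals, and [fine]
    sends an infinite mass to [0] on both sides. *)
Lemma gvol_lineality p n (A : set 'rV[R]_n) : measurable A ->
  fine (gvol [set v : 'rV[R]_(p + n) | A (rsubmx v)]) = K ^+ p * fine (gvol A).
Proof.
move=> mA.
have mf : measurable_fun setT (fun v : 'rV[R]_n => (\1_A v * expR (- dot v v / 2))%:E).
  apply/measurable_EFinP; apply: measurable_funM; first exact: measurable_indic.
  apply: measurableT_comp => //; apply: measurable_funM => //.
  by apply: measurableT_comp => //; exact: measurable_dot.
suff -> : gvol [set v : 'rV[R]_(p + n) | A (rsubmx v)] = ((K ^+ p)%:E * gvol A)%E.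
  have Kp0 : 0 < K ^+ p by rewrite exprn_gt0// sqrt2pi_gt0.
  case: (gvol A) => [x| |]; first by rewrite -EFinM.
    by rewrite gt0_muley ?lte_fin//= mulr0.
  by rewrite gt0_muleNy ?lte_fin//= mulr0.
elim: p => [|p IH].
  rewrite mul1e /gvol; apply: eq_vint => v; congr (_ * _)%:E; rewrite !indicE; congr ((_ : bool)%:R).
  have E : rsubmx (v : 'rV[R]_(0 + n)) = v.
    by apply/rowP => i; rewrite mxE; congr (v _ _); exact: val_inj.
  by apply/idP/idP; rewrite !inE/= E.
rewrite /gvol /=.
transitivity (\int[mu]_t ((w t)%:E * ((K ^+ p)%:E * gvol A)))%E.
  apply: eq_integral => t _; rewrite -IH /gvol -vintZl ?gauss_weight_ge0//; last first.
    apply/measurable_EFinP; apply: measurable_funM.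
      apply: measurable_indic; rewrite -[X in measurable X]setTI.
      by apply: measurable_rsubmx.
    apply: measurableT_comp => //; apply: measurable_funM => //.
    by apply: measurableT_comp => //; exact: measurable_dot.
  apply: eq_vint => v; rewrite -EFinM mulrCA; congr (_ * _)%:E.
    have E : rsubmx (cons_row t v : 'rV[R]_(p.+1 + n)) = rsubmx v.
      apply/rowP => i; rewrite [LHS]mxE [RHS]mxE -(cons_rowS t v (rshift p i)).
      have ij : (rshift p.+1 i : 'I_(p + n).+1) = lift 0 (rshift p i) by exact: val_inj.
      exact: (congr1 (cons_row t v 0) ij).
    by rewrite !indicE; congr ((_ : bool)%:R); apply/idP/idP; rewrite !inE/= E.
  by rewrite !expR_dot big_ord_recl cons_row0; congr (_ * _); apply: eq_bigr => i _; rewrite cons_rowS.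
rewrite ge0_integralZr//.
- by rewrite integral_gauss_weight exprS EFinM muleA.
- by apply/measurable_EFinP; exact: measurable_gauss_weight.
- by move=> t _; rewrite lee_fin gauss_weight_ge0.
- by rewrite mule_ge0 ?lee_fin ?exprn_ge0 ?sqrtr_ge0// vint_ge0.
Qed.

Lemma prod_bool (I : finType) (b : I -> bool) :
  \prod_i (b i)%:R = [forall i, b i]%:R :> R.
Proof.
case: (boolP [forall i, b i]) => [/forallP bi|/forallPn[i /negbTE bi]].
  by rewrite big1// => i _; rewrite bi.
by rewrite (bigD1 i)//= bi mul0r.
Qed.

(** The cube cone by its facet inequalities: at height [t = v 0 0] its slice is the product of the
    intervals [[- q i * t, p i * t]], empty for [t < 0]. *)
Definition cube_set n (p q : 'I_n -> R) : set 'rV[R]_n.+1 :=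
  [set v | 0 <= v 0 0 /\ forall i, - (q i * v 0 0) <= v 0 (lift 0 i) <= p i * v 0 0].

Lemma integral_gauss_box (a b : R) : 0 <= a -> 0 <= b ->
  (\int[mu]_x (w x * (- b <= x <= a)%R%:R)%:E = (phi_int a + phi_int b)%:E)%E.
Proof.
move=> a0 b0.
have mI (c : R) : measurable_fun setT (fun x : R => (w x * (x <= c)%R%:R)%:E).
  apply/measurable_EFinP; apply: measurable_funM; first exact: measurable_gauss_weight.
  exact: measurable_le_bool.
have I c : 0 <= c -> (\int[mu]_(x in D) (w x * (x <= c)%R%:R)%:E = (phi_int c)%:E)%E.
  move=> c0; rewrite -integral_gauss_itv// integral_mkcond [RHS]integral_mkcond.
  apply: eq_integral => x _; rewrite !patchE !mem_setE !in_itv/= andbT.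
  case: (0 <= x) => //=; case: (x <= c); by rewrite ?mulr1 ?mulr0.
rewrite ge0_integral_half; last 2 first.
- by move=> x; rewrite lee_fin mulr_ge0 ?gauss_weight_ge0.
- apply/measurable_EFinP; apply: measurable_funM; first exact: measurable_gauss_weight.
  by apply: measurable_bool; apply: measurable_and; exact: measurable_fun_ler.
transitivity (\int[mu]_(x in D) ((w x * (x <= a)%R%:R)%:E + (w x * (x <= b)%R%:R)%:E))%E.
  apply: eq_integral => x; rewrite inE/= in_itv/= andbT => x0.
  have -> : - b <= x by lra.
  have -> : - x <= a by lra.
  by rewrite gauss_weightN lerN2 andbT.
rewrite ge0_integralD//; last 4 first.
all: rewrite ?I//.
all: try by move=> x _; rewrite lee_fin mulr_ge0 ?gauss_weight_ge0.
all: by apply: measurable_funTS; exact: mI.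
Qed.

Lemma gvol_cube_set n (p q : 'I_n -> R) :
  (forall i, 0 <= p i) -> (forall i, 0 <= q i) ->
  fine (gvol (cube_set p q)) =
  \int[mu]_(t in D) (w t * \prod_i (phi_int (p i * t) + phi_int (q i * t))).
Proof.
move=> p0 q0; rewrite /Rintegral; congr fine; rewrite /gvol/= [RHS]integral_mkcond.
apply: eq_integral => t _; rewrite patchE mem_setE in_itv/= andbT; case: ifPn => t0; last first.
  rewrite (_ : (fun v => _) = (fun v => 0%:E * 0%:E)%E); last first.
    apply/funext => v; rewrite mule0 indicE memNset ?mul0r//.
    by rewrite /cube_set/= cons_row0 (negbTE t0) => -[].
  by rewrite (@vintZl _ _ (cst 0%:E))// mul0e.
pose h (i : 'I_n) x := w x * (- (q i * t) <= x <= p i * t)%R%:R.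
have mh i : measurable_fun setT (h i).
  apply: measurable_funM; first exact: measurable_gauss_weight.
  by apply: measurable_bool; apply: measurable_and; exact: measurable_fun_ler.
have h0 i x : 0 <= h i x by rewrite mulr_ge0 ?gauss_weight_ge0.
transitivity (vint (fun v : 'rV[R]_n => (w t)%:E * (\prod_i h i (v 0 i))%:E))%E.
  apply: eq_vint => v; rewrite expR_dot big_ord_recl cons_row0 -EFinM mulrCA; congr (_ * _)%:E.
  rewrite /h big_split/= mulrC; congr (_ * _); first by apply: eq_bigr => i _; rewrite cons_rowS.
  rewrite prod_bool indicE; congr ((_ : bool)%:R).
  apply/idP/forallP => [|vb]; rewrite inE /cube_set/= cons_row0.
    by move=> [_ vb] i; have := vb i; rewrite cons_rowS.
  by split => // i; rewrite cons_rowS.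
rewrite vintZl ?gauss_weight_ge0//; last 2 first.
- by move=> v; rewrite lee_fin prodr_ge0.
- apply/measurable_EFinP; apply: measurable_prod => i _.
  exact: (measurableT_comp (mh i) (measurable_coord i)).
rewrite vint_prod// EFinM; congr *%E.
rewrite -prodEFin; apply: eq_bigr => i _.
by rewrite integral_gauss_box// mulr_ge0.
Qed.

End CubeGaussianVolume.

(** * Angles of the model cones in terms of [Phi] *)

Section ConeAngles.
Context {R : realType}.
Notation mu := (@lebesgue_measure R).
Notation w := (@gauss_weight R).
Notation D := (`[0%R, +oo[%classic : set R).
Notation K := (Num.sqrt (2 * pi : R)).

Lemma phi_int_ge0 (a : R) : 0 <= a -> 0 <= phi_int a.
Proof. by move=> a0; apply: Rintegral_ge0 => t _; rewrite mulr_ge0 ?gauss_weight_ge0. Qed.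

(** On the half-line [phi_int] is [K / 2] minus a Gaussian tail, and the tail is measurable by
    Tonelli. *)
Lemma measurable_phi_int (a : R) : 0 <= a -> measurable_fun D (fun t => phi_int (a * t)).
Proof.
move=> a0; apply: (eq_measurable_fun (fun t => K / 2 - fine (gauss_tail (a * t)))).
  move=> t; rewrite inE/= in_itv/= andbT => t0.
  by rewrite gauss_tailE ?mulr_ge0//= opprB addrC subrK.
apply: measurable_funTS; apply: measurable_funB => //.
apply: (measurableT_comp (f := fine \o gauss_tail)).
  exact: (measurableT_comp (@fine_measurable R setT measurableT) measurable_gauss_tail).
exact: measurable_funM.
Qed.

Lemma gvol_cube_ratio n (p q : 'I_n -> R) :
  (forall i, 0 <= p i) -> (forall i, 0 <= q i) ->
  fine (gvol (cube_set p q)) / K ^+ n.+1 = K^-1 *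
  \int[mu]_(t in D) ((\prod_i (K^-1 * (phi_int (p i * t) + phi_int (q i * t)))) * w t).
Proof.
move=> p0 q0; rewrite gvol_cube_set// mulrC exprS invfM -mulrA; congr (_ * _).
pose F t := w t * \prod_i (phi_int (p i * t) + phi_int (q i * t)).
have F0 x : D x -> (0 <= (F x)%:E)%E.
  rewrite /= in_itv/= andbT => x0; rewrite lee_fin mulr_ge0 ?gauss_weight_ge0//.
  by apply: prodr_ge0 => i _; rewrite addr_ge0 ?phi_int_ge0 ?mulr_ge0.
have mF : measurable_fun D (fun x => (F x)%:E).
  apply/measurable_EFinP; apply: measurable_funM.
    by apply: measurable_funTS; exact: measurable_gauss_weight.
  by apply: measurable_prod => i _; apply: measurable_funD; exact: measurable_phi_int.
have K1 : 0 <= (K ^+ n)^-1 by rewrite invr_ge0 exprn_ge0// ltW// sqrt2pi_gt0.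
(* The factor is moved inside the integral in the extended reals; an infinite integral would be sent
   to [0] on both sides. *)
transitivity (fine ((K ^+ n)^-1%:E * \int[mu]_(x in D) (F x)%:E)%E).
  have [->|Kn] := eqVneq ((K ^+ n)^-1) 0; first by rewrite mul0r mul0e.
  rewrite /Rintegral -/F; case: (\int[mu]_(x in D) (F x)%:E)%E => [x| |] //=.
    by rewrite gt0_muley ?mulr0// lte_fin lt_neqAle eq_sym Kn.
  by rewrite gt0_muleNy ?mulr0// lte_fin lt_neqAle eq_sym Kn.
rewrite -ge0_integralZl_EFin// /Rintegral; congr fine; apply: eq_integral => t _.
rewrite -EFinM; congr _%:E; rewrite /F big_split/= prodr_const card_ord exprVn; ring.
Qed.

Lemma Rintegral0_const (A : set (measurableTypeR R)) : \int[mu]_(x in A) (0 : R) = 0.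
Proof. by rewrite /Rintegral integral0. Qed.

Lemma cube_angle_Phi n (p q : 'I_n -> R) :
  (forall i, 0 <= p i) -> (forall i, 0 <= q i) ->
  (fine (gvol (cube_set p q)) / K ^+ n.+1)%:C = (K^-1)%:C *
  Cintegral `[0, +oo[ (fun y : R =>
    (\prod_i (Phi (p i * y)%:C - Phi (- (q i * y))%:C)) * (expR (- y ^+ 2 / 2))%:C).
Proof.
move=> p0 q0; rewrite gvol_cube_ratio// rmorphM/=; congr (_ * _).
pose F t := (\prod_i (K^-1 * (phi_int (p i * t) + phi_int (q i * t)))) * w t.
have E (y : R) : (\prod_i (Phi (p i * y)%:C - Phi (- (q i * y))%:C)) * (expR (- y ^+ 2 / 2))%:C =
    (F y)%:C.
  rewrite /F rmorphM/= rmorph_prod; congr (_ * _); apply: eq_bigr => i _.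
  by rewrite !Phi_re phi_intN -rmorphB/=; congr (_%:C); ring.
rewrite /Cintegral.
under [X in _ = (X +i* _)%C]eq_Rintegral do rewrite E/=.
under [X in _ = (_ +i* X)%C]eq_Rintegral do rewrite E/=.
by rewrite Rintegral0_const.
Qed.

Lemma chi_Phi (p q t : R) : chi p q t =
  (expR (- ((p * t) ^+ 2 / 2)))%:C * Phi ('i%C * (p * t)%:C) +
  (expR (- ((q * t) ^+ 2 / 2)))%:C * Phi ('i%C * (q * t)%:C).
Proof. by rewrite !expR_Phi_im -mulrDr. Qed.

(** Since [half_cos] is even and [dawson] is odd, [Phi (- iy)] is conjugate to [Phi (iy)]. The
    second product in the internal angle is thus the conjugate of the first. *)
Lemma conj_chi_Phi (p q t : R) : ((chi p q t)^*)%C =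
  (expR (- ((p * t) ^+ 2 / 2)))%:C * Phi (- ('i%C * (p * t)%:C)) +
  (expR (- ((q * t) ^+ 2 / 2)))%:C * Phi (- ('i%C * (q * t)%:C)).
Proof.
have E (y : R) : (expR (- (y ^+ 2 / 2)))%:C * Phi (- ('i%C * y%:C)) =
    (K^-1)%:C * (half_cos y -i* dawson y)%C.
  have -> : - ('i%C * y%:C) = 'i%C * (- y)%:C by rewrite rmorphN mulrN.
  rewrite -[in expR _](sqrrN y) expR_Phi_im dawsonN.
  by rewrite /half_cos; congr (_ * (_ +i* _)%C); apply: eq_Rintegral => x _; rewrite mulNr cosN.
rewrite !E -mulrDr /chi; apply/eqP; rewrite eq_complex/=; apply/andP; split; apply/eqP; ring.
Qed.

(** A complex number minus its conjugate is [2i] times its imaginary part, and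
    [2i * i / (2 pi) = - 1 / pi]. *)
Lemma cross_angle_Phi n (p q : 'I_n -> R) :
  (forall i, 0 <= p i) -> (forall i, 0 <= q i) ->
  (fine (gvol (cross_set p q)) / K ^+ n.+1)%:C = 2^-1 + 'i%C / (2 * pi)%:C *
  Cintegral `]0, +oo[ (fun t : R => (expR (- t ^+ 2 / 2) / t)%:C *
    (\prod_i ((expR (- ((p i * t) ^+ 2 / 2)))%:C * Phi ('i%C * (p i * t)%:C) +
              (expR (- ((q i * t) ^+ 2 / 2)))%:C * Phi ('i%C * (q i * t)%:C)) -
     \prod_i ((expR (- ((p i * t) ^+ 2 / 2)))%:C * Phi (- ('i%C * (p i * t)%:C)) +
              (expR (- ((q i * t) ^+ 2 / 2)))%:C * Phi (- ('i%C * (q i * t)%:C))))).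
Proof.
move=> p0 q0; rewrite gvol_cross_ratio//.
pose F t := w t / t * complex.Im (cross_char p q t).
have intF : mu.-integrable `]0%R, +oo[%classic (EFin \o F).
  apply: open_half_integrable.
  have := half_integrable_fourier_kernel (tame_cross_char p0 q0) (lexx 0).
  apply: eq_integrable => // t _; rewrite /F /= /fourier_kernel.
  by rewrite mulr0 sin0 cos0 mul0r add0r mul1r.
have E (t : R) : (expR (- t ^+ 2 / 2) / t)%:C *
    (\prod_i ((expR (- ((p i * t) ^+ 2 / 2)))%:C * Phi ('i%C * (p i * t)%:C) +
              (expR (- ((q i * t) ^+ 2 / 2)))%:C * Phi ('i%C * (q i * t)%:C)) -
     \prod_i ((expR (- ((p i * t) ^+ 2 / 2)))%:C * Phi (- ('i%C * (p i * t)%:C)) +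
              (expR (- ((q i * t) ^+ 2 / 2)))%:C * Phi (- ('i%C * (q i * t)%:C)))) =
    (0 +i* (2 * F t))%C.
  under eq_bigr do rewrite -chi_Phi.
  under [X in _ - X]eq_bigr do rewrite -conj_chi_Phi.
  rewrite -rmorph_prod -/(cross_char p q t) -/(w t) /F.
  by case: (cross_char p q t) => a b; apply/eqP; rewrite eq_complex/=; apply/andP; split; apply/eqP; ring.
rewrite /Cintegral.
under [X in _ = _ + _ * (X +i* _)%C]eq_Rintegral do rewrite E/=.
under [X in _ = _ + _ * (_ +i* X)%C]eq_Rintegral do rewrite E/=.
rewrite (@RintegralZl _ (measurableTypeR R))// -/(F _).
set J := Rintegral _ _ _.
have -> : 2^-1 = (2^-1)%:C :> R[i] by rewrite fmorphV/= rmorph_nat.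
rewrite Rintegral0_const -fmorphV/=.
apply/eqP; rewrite eq_complex/=; apply/andP; split; apply/eqP.
  clearbody J; have : (pi : R) != 0 by exact: pi_neq0.
  move: (pi : R) => P P0.
  by field; rewrite P0.
by ring.
Qed.

End ConeAngles.

(** * Tangent and normal cones of the crosspolytope *)

Section PositiveHull.
Context {R : realType} {V : lmodType R}.
Implicit Types A : set V.

Lemma sub_pos_hull A : A `<=` pos_hull A.
Proof.
move=> y Ay; exists 1%N, (fun=> 1), (fun=> y); split => //.
by rewrite big_ord1 scale1r.
Qed.

Lemma pos_hull0 A : pos_hull A 0.
Proof. by exists 0%N, (fun=> 0), (fun=> 0); split; [case| |rewrite big_ord0]. Qed.

Lemma pos_hullD A u v : pos_hull A u -> pos_hull A v -> pos_hull A (u + v).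
Proof.
move=> [m [a [p [Ap a0 ->]]]] [n [b [q [Aq b0 ->]]]].
exists (m + n)%N, (fun i => match fintype.split i with inl j => a j | inr j => b j end),
  (fun i => match fintype.split i with inl j => p j | inr j => q j end); split.
- by move=> i; case: fintype.split.
- by move=> i; case: fintype.split.
rewrite big_split_ord/=; congr (_ + _); apply: eq_bigr => i _.
  by rewrite (unsplitK (inl i)).
by rewrite (unsplitK (inr i)).
Qed.

Lemma pos_hullZ A c u : 0 <= c -> pos_hull A u -> pos_hull A (c *: u).
Proof.
move=> c0 [m [a [p [Ap a0 ->]]]]; exists m, (fun i => c * a i), p; split => //.
  by move=> i; rewrite mulr_ge0.
by rewrite scaler_sumr; apply: eq_bigr => i _; rewrite scalerA.
Qed.

Lemma pos_hull_sum A (I : finType) (F : I -> V) :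
  (forall i, pos_hull A (F i)) -> pos_hull A (\sum_i F i).
Proof.
move=> AF; apply: (big_ind (pos_hull A)) => //; first exact: pos_hull0.
by move=> u v; exact: pos_hullD.
Qed.

Lemma pos_hull_sub A C : A `<=` C -> C 0 -> (forall u v, C u -> C v -> C (u + v)) ->
  (forall c u, 0 <= c -> C u -> C (c *: u)) -> pos_hull A `<=` C.
Proof.
move=> AC C0 CD CZ _ [m [a [p [Ap a0 ->]]]].
by apply: (big_ind C) => // i _; apply: CZ => //; exact: AC.
Qed.

Lemma lin_hull_full A : (forall v, exists a b, [/\ A a, A b & v = a - b]) ->
  lin_hull A = setT.
Proof.
move=> H; apply/seteqP; split => // v _; have [a [b [Aa Ab ->]]] := H v.
rewrite addrC -scaleN1r; apply: lin_hullP; exact: sub_lin_hull.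
Qed.

End PositiveHull.

Section Cones.
Context {R : realType} {n : nat}.
Implicit Types p q : 'I_n -> R.

Lemma psiD (a b x y : R) : psi a b (x + y) <= psi a b x + psi a b y.
Proof.
rewrite /psi ge_max; apply/andP; split.
  by rewrite mulrDr lerD// le_max lexx.
by rewrite mulrDr opprD lerD// le_max lexx orbT.
Qed.

Lemma psiZ (a b c x : R) : 0 <= c -> psi a b (c * x) = c * psi a b x.
Proof. by move=> c0; rewrite /psi maxr_pMr// mulrN (mulrCA c a) (mulrCA c b). Qed.

Lemma psi0 (a b : R) : psi a b 0 = 0.
Proof. by rewrite /psi !mulr0 oppr0 maxxx. Qed.

Lemma cross_set0 p q : cross_set p q 0.
Proof. by rewrite /cross_set/= big1 ?mxE// => i _; rewrite mxE psi0. Qed.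

Lemma cross_setD p q u v : cross_set p q u -> cross_set p q v -> cross_set p q (u + v).
Proof.
rewrite /cross_set/= mxE => hu hv; apply: le_trans (lerD hu hv).
by rewrite -big_split/=; apply: ler_sum => i _; rewrite mxE psiD.
Qed.

Lemma cross_setZ p q c u : 0 <= c -> cross_set p q u -> cross_set p q (c *: u).
Proof.
rewrite /cross_set/= mxE => c0 hu; apply: (@le_trans _ _ (c * \sum_i psi (p i) (q i) (u 0 (lift 0 i)))).
  by rewrite mulr_sumr; apply: ler_sum => i _; rewrite mxE psiZ.
by rewrite ler_wpM2l.
Qed.

Lemma evec00 : (evec 0 : 'rV[R]_n.+1) 0 0 = 1.
Proof. by rewrite mxE. Qed.

Lemma evec0S i : (evec 0 : 'rV[R]_n.+1) 0 (lift 0 i) = 0.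
Proof. by rewrite mxE. Qed.

Lemma evecS0 i : (evec (lift 0 i) : 'rV[R]_n.+1) 0 0 = 0.
Proof. by rewrite mxE. Qed.

Lemma evecSS i j : (evec (lift 0 i) : 'rV[R]_n.+1) 0 (lift 0 j) = (i == j)%:R.
Proof. by rewrite mxE/= (inj_eq lift_inj) eq_sym. Qed.

Lemma row_expand (v : 'rV[R]_n.+1) :
  v = v 0 0 *: evec 0 + \sum_i v 0 (lift 0 i) *: evec (lift 0 i).
Proof. by rewrite {1}(row_sum_evec v) big_ord_recl. Qed.

Lemma cross_set_gen p q (c : R) i : 0 < p i -> 0 < q i ->
  (c * p i <= 1) -> (- c * q i <= 1) -> cross_set p q (evec 0 + c *: evec (lift 0 i)).
Proof.
move=> pi0 qi0 cp cq; rewrite /cross_set/=.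
rewrite (bigD1 i)//= big1 => [|j ji].
  rewrite addr0 !mxE/= !eqxx mulr1 add0r mulr0 addr0 /psi ge_max mulrC cp/=.
  by rewrite mulrC -mulNr.
by rewrite !mxE/= (inj_eq lift_inj) (negbTE ji) mulr0 addr0 psi0.
Qed.

(** A vector satisfying the inequality is the slack [v 0 0 - sum psi] times [e_0], plus one vector
    [psi e_0 + v_i e_i] for each [i]. The latter is a nonnegative multiple of the generator on the
    side given by the sign of [v_i]. *)
Lemma cross_coneE p q : (forall i, 0 < p i) -> (forall i, 0 < q i) ->
  cross_cone p q = cross_set p q.
Proof.
move=> p0 q0; rewrite /cross_cone; case: eqVneq => [n0|nn0].
  apply/seteqP; split => v /=; rewrite /cross_set/= big1//.
    by move=> i; move: (ltn_ord i); rewrite {2}n0.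
  by move=> i; move: (ltn_ord i); rewrite {2}n0.
apply/seteqP; split.
  apply: pos_hull_sub; first last.
  - exact: cross_setZ.
  - exact: cross_setD.
  - exact: cross_set0.
  move=> _ [] [i _ <-].
    apply: cross_set_gen => //; first by rewrite mulVf// gt_eqF.
    by rewrite mulNr (le_trans _ ler01)// oppr_le0 mulr_ge0// ?invr_ge0 ltW.
  rewrite -scaleNr; apply: cross_set_gen => //.
    by rewrite mulNr (le_trans _ ler01)// oppr_le0 mulr_ge0// ?invr_ge0 ltW.
  by rewrite opprK mulVf// gt_eqF.
set G := (X in pos_hull X).
have Gp i : pos_hull G (evec 0 + (p i)^-1 *: evec (lift 0 i)).
  by apply: sub_pos_hull; left; exists i.
have Gq i : pos_hull G (evec 0 - (q i)^-1 *: evec (lift 0 i)).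
  by apply: sub_pos_hull; right; exists i.
(* The combination [p_i (e_0 + e_i / p_i) + q_i (e_0 - e_i / q_i)] equals [(p_i + q_i) e_0]. This
   takes an index [i], hence [n > 0]. *)
have G0 : pos_hull G (evec 0).
  have i : 'I_n by case: (n) nn0 => // m _; exact: ord0.
  have := pos_hullZ (ltW (p0 i)) (Gp i); have := pos_hullZ (ltW (q0 i)) (Gq i).
  move=> h1 h2; have := pos_hullD h2 h1.
  rewrite !scalerDr scalerN !scalerA !mulfV ?gt_eqF// !scale1r addrACA subrr addr0.
  rewrite -scalerDl => /(pos_hullZ (c := (p i + q i)^-1)).
  have pq : 0 < p i + q i by rewrite addr_gt0.
  by rewrite scalerA mulVf ?gt_eqF// scale1r; apply; rewrite invr_ge0 ltW.
move=> v /= vC.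
rewrite (row_expand v) (_ : _ + _ = (v 0 0 - \sum_i psi (p i) (q i) (v 0 (lift 0 i))) *: evec 0 +
   \sum_i (psi (p i) (q i) (v 0 (lift 0 i)) *: evec 0 + v 0 (lift 0 i) *: evec (lift 0 i))).
  apply: pos_hullD; first by apply: pos_hullZ => //; rewrite subr_ge0.
  apply: pos_hull_sum => i; set t := v 0 _.
  have [t0|t0] := leP 0 t.
    rewrite (psi_pos (ltW (p0 i)) (ltW (q0 i)) t0).
    rewrite (_ : _ + _ = (p i * t) *: (evec 0 + (p i)^-1 *: evec (lift 0 i))).
      by apply: pos_hullZ => //; rewrite mulr_ge0// ltW.
    by rewrite scalerDr scalerA mulrAC mulfV ?mul1r ?gt_eqF.
  have nt0 : 0 <= - t by rewrite oppr_ge0 ltW.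
  rewrite -[t]opprK (psi_neg (ltW (p0 i)) (ltW (q0 i)) nt0).
  rewrite (_ : _ + _ = (q i * - t) *: (evec 0 - (q i)^-1 *: evec (lift 0 i))).
    by apply: pos_hullZ => //; rewrite mulr_ge0// ltW.
  by rewrite scalerDr scalerN scalerA mulrAC mulfV ?gt_eqF// mul1r opprK scaleNr opprK.
by rewrite big_split/= -scaler_suml addrA -scalerDl subrK.
Qed.

(** For the harder inclusion, a vector at positive height is rescaled to height [1], where it lies
    in a box and is a convex combination of the vertices; at height [0] the slice is just the
    origin. *)
Lemma cube_coneE p q : (forall i, 0 < p i) -> (forall i, 0 < q i) ->
  cube_cone p q = cube_set p q.
Proof.
move=> p0 q0; apply/seteqP; split.
  apply: pos_hull_sub.
  - move=> _ [eps ->]; split => [|i].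
      rewrite mxE evec00 summxE big1 ?addr0// => i _; by rewrite mxE evecS0 mulr0.
    rewrite !mxE summxE summxE big1 => [|j _]; last by rewrite mxE evecS0 mulr0.
    rewrite (bigD1 i)//= big1 => [|j ji]; last first.
      by rewrite mxE evecSS (negbTE ji) mulr0.
    rewrite !mxE/= !eqxx !mulr1 add0r !addr0 mulr1.
    have := p0 i; have := q0 i; case: (eps i) => q1 p1; apply/andP; split; lra.
  - by split => [|i]; rewrite ?mxE// !mulr0 oppr0 lexx.
  - move=> u v [u0 uC] [v0 vC]; split => [|i]; first by rewrite mxE addr_ge0.
    rewrite !mxE; have /andP[u1 u2] := uC i; have /andP[v1 v2] := vC i.
    by apply/andP; split; lra.
  move=> c u c0 [u0 uC]; split => [|i]; first by rewrite mxE mulr_ge0.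
  rewrite !mxE; have /andP[u1 u2] := uC i; apply/andP; split.
    by rewrite mulrCA -mulrN ler_wpM2l.
  by rewrite mulrCA ler_wpM2l.
rewrite /cube_cone; set G := (X in pos_hull X).
(* The list [s] contains the coordinates that may lie strictly inside their interval; each induction
   step sends one of them to its two endpoints. *)
have vert (s : seq 'I_n) (y : 'I_n -> R) : (forall i, - q i <= y i <= p i) ->
    (forall i, i \notin s -> y i = p i \/ y i = - q i) ->
    pos_hull G (evec 0 + \sum_i y i *: evec (lift 0 i)).
  elim: s y => [|i s IH] y yB yV.
    apply: sub_pos_hull; exists (fun i => y i == p i); congr (_ + _).
    apply: eq_bigr => i _; congr (_ *: _).
    by case: eqP => // ypi; case: (yV i).
  pose y1 j := if j == i then p i else y j.
  pose y2 j := if j == i then - q i else y j.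
  have h1 : pos_hull G (evec 0 + \sum_i y1 i *: evec (lift 0 i)).
    apply: IH => j; rewrite /y1; case: eqP => [->|/eqP ji] //.
    - by rewrite lexx andbT; have := p0 i; have := q0 i; lra.
    - by left.
    - by move=> js; apply: yV; rewrite inE negb_or ji.
  have h2 : pos_hull G (evec 0 + \sum_i y2 i *: evec (lift 0 i)).
    apply: IH => j; rewrite /y2; case: eqP => [->|/eqP ji] //.
    - by rewrite lexx/=; have := p0 i; have := q0 i; lra.
    - by right.
    - by move=> js; apply: yV; rewrite inE negb_or ji.
  have pq : 0 < p i + q i by rewrite addr_gt0.
  (* The barycentric coordinate of [y i] in [[- q i, p i]]: [l p_i - (1 - l) q_i = y_i]. *)
  pose l := (y i + q i) / (p i + q i).
  have /andP[yi1 yi2] := yB i.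
  have l0 : 0 <= l by rewrite divr_ge0 ?(ltW pq)//; lra.
  have l1 : 0 <= 1 - l by rewrite subr_ge0 ler_pdivrMr// mul1r; lra.
  have := pos_hullD (pos_hullZ l0 h1) (pos_hullZ l1 h2).
  congr (pos_hull G _); rewrite !scalerDr addrACA -scalerDl (addrC l) subrK scale1r.
  congr (_ + _); rewrite !scaler_sumr -big_split/=; apply: eq_bigr => j _.
  rewrite !scalerA -scalerDl; congr (_ *: _); rewrite /y1 /y2.
  by case: eqP => [->|_]; rewrite /l; field; rewrite gt_eqF.
move=> v [v0 vC]; have [v00|vn0] := eqVneq (v 0 0) 0.
  have -> : v = 0.
    apply/rowP => i; rewrite mxE; case: (unliftP 0 i) => [j ->|->]//.
    by have := vC j; rewrite v00 !mulr0 oppr0 -eq_le => /eqP <-.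
  exact: pos_hull0.
have {vn0}v_gt0 : 0 < v 0 0 by rewrite lt_neqAle eq_sym vn0.
rewrite (row_expand v) (_ : _ + _ = v 0 0 *: (evec 0 +
    \sum_i (v 0 (lift 0 i) / v 0 0) *: evec (lift 0 i))); last first.
  rewrite scalerDr scaler_sumr; congr (_ + _); apply: eq_bigr => i _.
  by rewrite scalerA mulrCA mulfV ?mulr1 ?gt_eqF.
apply: pos_hullZ => //; apply: (vert (enum 'I_n)) => i; last by rewrite mem_enum.
by rewrite ler_pdivlMr// ler_pdivrMr// mulNr.
Qed.

Lemma measurable_cross_set p q : measurable (cross_set p q).
Proof.
rewrite -[X in measurable X]setTI; apply: measurable_fun_le => //; last exact: measurable_coord.
by apply: measurable_sum => i; exact: (measurableT_comp (measurable_psi _ _) (measurable_coord _)).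
Qed.

Lemma measurable_cube_set p q : measurable (cube_set p q).
Proof.
have -> : cube_set p q = [set v | 0 <= v 0 0] `&`
    \bigcap_(i in [set: 'I_n]) ([set v | - (q i * v 0 0) <= v 0 (lift 0 i)] `&`
      [set v | v 0 (lift 0 i) <= p i * v 0 0]).
  apply/seteqP; split => v.
    by move=> [v0 vC]; split => // i _; have /andP[] := vC i.
  by move=> [v0 vC]; split => // i; have [] := vC i I; move=> /= -> ->.
have mle (f g : 'rV[R]_n.+1 -> R) : measurable_fun setT f -> measurable_fun setT g ->
    measurable [set v | f v <= g v].
  by move=> mf mg; rewrite -[X in measurable X]setTI; exact: measurable_fun_le.
have m0 := @measurable_coord R n.+1 0.
apply: measurableI; first exact: mle.
apply: fin_bigcap_measurable => // i _; apply: measurableI; apply: mle => //.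
- apply: measurableT_comp => //; exact: measurable_funM.
- exact: measurable_coord.
- exact: measurable_coord.
- exact: measurable_funM.
Qed.

Lemma scalable_cross_set p q : scalable_set (cross_set p q).
Proof. by move=> c v c0; apply: cross_setZ; exact: ltW. Qed.

Lemma scalable_cube_set p q : scalable_set (cube_set p q).
Proof.
move=> c v c0 [v0 vC]; split => [|i]; first by rewrite mxE mulr_ge0// ltW.
rewrite !mxE; have /andP[u1 u2] := vC i; apply/andP; split.
  by rewrite mulrCA -mulrN ler_wpM2l// ltW.
by rewrite mulrCA ler_wpM2l// ltW.
Qed.

(** The cone is full-dimensional: a large multiple of the axis vector [e_0] pushes any vector into
    it. *)
Lemma cross_set_diff p q (v : 'rV[R]_n.+1) : exists a b,
  [/\ cross_set p q a, cross_set p q b & v = a - b].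
Proof.
pose M := `|v 0 0| + `|\sum_i psi (p i) (q i) (v 0 (lift 0 i))|.
exists (v + M *: evec 0), (M *: evec 0); split; last by rewrite addrK.
  rewrite /cross_set/= (eq_bigr (fun i => psi (p i) (q i) (v 0 (lift 0 i)))) => [|i _]; last first.
    by rewrite !mxE/= mulr0 addr0.
  rewrite !mxE/= mulr1 /M addrA (le_trans (ler_norm _))// lerDr.
  by rewrite -[v 0 0]opprK addrC subr_ge0 opprK -normrN ler_norm.
apply: cross_setZ; first by rewrite addr_ge0.
by rewrite /cross_set/= big1 ?mxE//= => i _; rewrite mxE/= psi0.
Qed.

Lemma cube_set_diff p q (v : 'rV[R]_n.+1) : (forall i, 0 < p i) -> (forall i, 0 < q i) ->
  exists a b, [/\ cube_set p q a, cube_set p q b & v = a - b].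
Proof.
move=> p0 q0.
(* At any height [h >= r i] the [i]-th coordinate fits: [|v_i| <= p_i h] and [|v_i| <= q_i h]. *)
pose r i := `|v 0 (lift 0 i)| * ((p i)^-1 + (q i)^-1).
have r0 i : 0 <= r i.
  by rewrite mulr_ge0// addr_ge0// invr_ge0 ltW.
pose M := `|v 0 0| + \sum_i r i.
have M0 : 0 <= M by rewrite addr_ge0// sumr_ge0.
exists (v + M *: evec 0), (M *: evec 0); split; last by rewrite addrK.
  have E : (v + M *: evec 0) 0 0 = v 0 0 + M by rewrite !mxE/= mulr1.
  have v0 : 0 <= v 0 0 + `|v 0 0| by rewrite -[v 0 0]opprK addrC subr_ge0 opprK -normrN ler_norm.
  have ri i : r i <= v 0 0 + M.
    rewrite /M addrA (bigD1 i)//= addrCA lerDl addr_ge0//; exact: sumr_ge0.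
  split => [|i]; first by rewrite E /M addrA addr_ge0// sumr_ge0.
  rewrite E !mxE/= mulr0 addr0.
  have ip : 0 <= `|v 0 (lift 0 i)| / q i by rewrite divr_ge0// ltW.
  have iq : 0 <= `|v 0 (lift 0 i)| / p i by rewrite divr_ge0// ltW.
  have := ri i; rewrite /r mulrDr => rM.
  have pM : `|v 0 (lift 0 i)| <= p i * (v 0 0 + M).
    by rewrite mulrC -ler_pdivrMr//; lra.
  have qM : `|v 0 (lift 0 i)| <= q i * (v 0 0 + M).
    by rewrite mulrC -ler_pdivrMr//; lra.
  rewrite (le_trans (ler_norm _) pM) andbT lerNl (le_trans _ qM)//.
  by rewrite -normrN ler_norm.
split => [|i]; rewrite !mxE/= !mulr1 ?mulr0//.
by rewrite oppr_le0 !mulr_ge0// ltW.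
Qed.

End Cones.

Section TailSums.
Context {R : realType} {d k : nat} (hkd : (k <= d)%N).

Lemma big_tail (T : Type) (idx : T) (op : Monoid.com_law idx) (F : 'I_d -> T) :
  \big[op/idx]_(j < d | (k <= j)%N) F j = \big[op/idx]_(i < d - k) F (tail_ord hkd i).
Proof.
rewrite (reindex (cast_ord (subnKC hkd)))/=; last first.
  by apply: onW_bij; exists (cast_ord (esym (subnKC hkd))) => i; apply: val_inj.
rewrite big_mkcond big_split_ord/= big1 ?Monoid.mul1m => [|i _]; last first.
  by rewrite leqNgt ltn_ord.
by apply: eq_bigr => i _; rewrite leq_addr.
Qed.

Lemma sum_head_tail (F : 'I_d -> R) :
  \sum_i F i = \sum_(i < d | (i < k)%N) F i + \sum_(i < d - k) F (tail_ord hkd i).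
Proof.
rewrite (bigID (fun i : 'I_d => (i < k)%N))/=; congr (_ + _).
transitivity (\sum_(j < d | (k <= j)%N) F j); last exact: big_tail.
by apply: eq_bigl => i; rewrite -leqNgt.
Qed.

Lemma tail_ord_ge j : (k <= tail_ord hkd j)%N.
Proof. by rewrite /= leq_addr. Qed.

Lemma tail_ord_inj : injective (tail_ord hkd).
Proof. by move=> i j /(congr1 val) /= /addnI ij; exact: val_inj. Qed.

End TailSums.

(** * The tangent cone of the crosspolytope *)

Section Polytope.
Context {R : realType} {d : nat}.
Variables (taup taum : 'I_d -> R).
Hypothesis htaup : forall i, 0 < taup i.
Hypothesis htaum : forall i, 0 < taum i.

(** By homogenisation: [y] lies in the polytope iff [(1, y)] lies in the cross cone, coordinate [0]
    recording the sum of the coefficients. For [d = 0] the hull is empty, whereas the inequality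
    holds. *)
Lemma cross_polytopeE : (0 < d)%N ->
  cross_polytope taup taum = [set y | \sum_i psi (taup i) (taum i) (y 0 i) <= 1].
Proof.
move=> d0; pose lift1 (y : 'rV[R]_d) := cons_row 1 y.
have E (y : 'rV[R]_d) : cross_set taup taum (lift1 y) = (\sum_i psi (taup i) (taum i) (y 0 i) <= 1).
  rewrite /cross_set/= cons_row0; congr (is_true (_ <= _)).
  by apply: eq_bigr => i _; rewrite cons_rowS.
have lp i : lift1 ((taup i)^-1 *: evec i) = evec 0 + (taup i)^-1 *: evec (lift 0 i).
  apply/rowP => j; case: (unliftP 0 j) => [l ->|->].
    by rewrite cons_rowS !mxE/= (inj_eq lift_inj) add0r.
  by rewrite cons_row0 !mxE/= mulr0 addr0.
have lm i : lift1 (- ((taum i)^-1 *: evec i)) = evec 0 - (taum i)^-1 *: evec (lift 0 i).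
  apply/rowP => j; case: (unliftP 0 j) => [l ->|->].
    by rewrite cons_rowS !mxE/= (inj_eq lift_inj) add0r.
  by rewrite cons_row0 !mxE/= mulr0 oppr0 addr0.
have dn0 : (d == 0%N) = false by rewrite eqn0Ngt d0.
apply/seteqP; split => y /=; rewrite -E -cross_coneE// /cross_cone dn0.
  move=> [n [c [p [Ap c0 c1 ->]]]]; exists n, c, (fun i => lift1 (p i)); split => //.
    move=> i; have [[j _ <-]|[j _ <-]] := Ap i.
      by left; exists j => //; rewrite lp.
    by right; exists j => //; rewrite lm.
  apply/rowP => j; case: (unliftP 0 j) => [l ->|->].
    rewrite cons_rowS !summxE; apply: eq_bigr => i _; by rewrite mxE [RHS]mxE cons_rowS.
  rewrite cons_row0 summxE -c1; apply: eq_bigr => i _.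
  by rewrite mxE cons_row0 mulr1.
move=> [n [c [p [Ap c0 yE]]]].
have /choice[r rP] : forall i, exists r, lift1 r = p i /\
    ([set (taup i)^-1 *: evec i | i in [set: 'I_d]] `|`
     [set - ((taum i)^-1 *: evec i) | i in [set: 'I_d]]) r.
  move=> i; have [[j _ <-]|[j _ <-]] := Ap i.
    by exists ((taup j)^-1 *: evec j); split; [exact: lp|left; exists j].
  by exists (- ((taum j)^-1 *: evec j)); split; [exact: lm|right; exists j].
exists n, c, r; split => //.
- by move=> i; have [] := rP i.
- have := congr1 (fun v : 'rV_d.+1 => v 0 0) yE; rewrite cons_row0 summxE => ->.
  by apply: eq_bigr => i _; have [<- _] := rP i; rewrite mxE cons_row0 mulr1.
apply/rowP => l; have := congr1 (fun v : 'rV_d.+1 => v 0 (lift 0 l)) yE.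
rewrite cons_rowS !summxE => ->; apply: eq_bigr => i _.
by have [<- _] := rP i; rewrite mxE cons_rowS mxE.
Qed.

Lemma finite_pos_lower (I : finType) (f : I -> R) : (forall i, 0 < f i) ->
  exists2 e, 0 < e & forall i, e <= f i.
Proof.
(* The extra [1] in the minimum covers an empty index type. *)
move=> f0; exists (\big[Num.min/1]_i f i).
  by apply: (big_ind (fun x => 0 < x)) => // x y x0 y0; rewrite lt_min x0.
by move=> i; rewrite (bigD1 i)//= ge_min lexx.
Qed.

Variables (m : nat) (a : 'I_m -> 'rV[R]_d) (b : 'I_m -> R) (k : nat).
Hypothesis hP : cross_polytope taup taum = [set y | forall r, dot (a r) y <= b r].
Hypothesis hk : (0 < k)%N.
Hypothesis hkd : (k <= d)%N.

Notation F := (cross_face taup k).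

(** The mean of the [k] vertices of [F], in coordinates. It is a single test point for activity of
    an inequality on all of [F]. *)
Definition barycenter : 'rV[R]_d :=
  \row_i if (i < k)%N then (k%:R * taup i)^-1 else 0.

Lemma dotDr n (c : R) (u v w : 'rV[R]_n) : dot w (c *: u + v) = c * dot w u + dot w v.
Proof. by rewrite dotC dotDl !(dotC w). Qed.

Lemma dot_sumr n (I : finType) (P : pred I) (c : I -> R) (p : I -> 'rV[R]_n) w :
  dot w (\sum_(i | P i) c i *: p i) = \sum_(i | P i) c i * dot w (p i).
Proof.
apply: (big_ind2 (fun x y => dot w x = y)).
- by rewrite /dot big1// => i _; rewrite mxE mulr0.
- by move=> x1 x2 y1 y2 <- <-; rewrite -[x1]scale1r dotDr mul1r scale1r.
- move=> i _; rewrite -[X in dot w X]addr0 dotDr [dot w 0]big1 ?addr0// => j _.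
  by rewrite mxE mulr0.
Qed.

Lemma vertex_face (i : 'I_d) : (i < k)%N -> F ((taup i)^-1 *: evec i).
Proof.
move=> ik; exists 1%N, (fun=> 1), (fun=> (taup i)^-1 *: evec i); split => //.
- by move=> _; exists i.
- by rewrite big_ord1.
- by rewrite big_ord1 scale1r.
Qed.

Lemma sub_face : F `<=` cross_polytope taup taum.
Proof.
move=> _ [n [c [p [Ap c0 c1 ->]]]]; exists n, c, p; split => //.
by move=> i; have [j _ <-] := Ap i; left; exists j.
Qed.

Lemma card_head : \sum_(i < d | (i < k)%N) (1 : R) = k%:R.
Proof.
rewrite sumr_const; congr (_ *+ _).
by rewrite -[RHS](card_ord k) -sum1_card -sum1_card (big_ord_widen d (fun=> 1%N) hkd).
Qed.

Lemma barycenter_sum : barycenter =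
  \sum_(i < d | (i < k)%N) k%:R^-1 *: ((taup i)^-1 *: evec i).
Proof.
apply/rowP => j; rewrite mxE summxE; case: ifPn => jk.
  rewrite (bigD1 j)//= big1 => [|i /andP[_ ij]].
    by rewrite !mxE !eqxx mulr1 addr0 invfM.
  by rewrite !mxE/= eq_sym (negbTE ij) !mulr0.
rewrite big1// => i ik; rewrite !mxE/= (_ : j == i = false) ?mulr0//.
by apply: contraNF jk => /eqP ->.
Qed.

Let kn0 : k%:R != 0 :> R.
Proof. by rewrite pnatr_eq0 -lt0n. Qed.

Lemma dot_barycenter w : dot w barycenter =
  k%:R^-1 * \sum_(i < d | (i < k)%N) dot w ((taup i)^-1 *: evec i).
Proof. by rewrite barycenter_sum dot_sumr mulr_sumr. Qed.

(** The value at the barycenter is the mean of the values at the vertices, none of which exceeds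
    [b r]; it reaches [b r] only if each of them does. *)
Lemma active_barycenter r : active a b F r <-> dot (a r) barycenter = b r.
Proof.
have vP (i : 'I_d) : (i < k)%N -> dot (a r) ((taup i)^-1 *: evec i) <= b r.
  move=> ik; have := sub_face (vertex_face ik); rewrite hP; exact.
have bE : b r = k%:R^-1 * \sum_(i < d | (i < k)%N) b r.
  transitivity (k%:R^-1 * (\sum_(i < d | (i < k)%N) 1 * b r)).
    by rewrite -mulr_suml card_head mulrA mulVf// mul1r.
  by congr (_ * _); apply: eq_bigr => i _; rewrite mul1r.
split => [rA|].
  rewrite dot_barycenter [RHS]bE; congr (_ * _); apply: eq_bigr => i ik.
  by apply: rA; exact: vertex_face.
rewrite dot_barycenter [in RHS]bE => /(mulfI (invr_neq0 kn0)) /eqP.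
rewrite -subr_eq0 -sumrB => /eqP sum0.
have vb (i : 'I_d) : (i < k)%N -> dot (a r) ((taup i)^-1 *: evec i) = b r.
  move=> ik; apply/eqP; rewrite -subr_eq0 -oppr_eq0 opprB; apply/eqP.
  have : \sum_(i < d | (i < k)%N) (b r - dot (a r) ((taup i)^-1 *: evec i)) = 0.
    transitivity (- \sum_(i < d | (i < k)%N) (dot (a r) ((taup i)^-1 *: evec i) - b r)).
      by rewrite -sumrN; apply: eq_bigr => j _; rewrite opprB.
    by rewrite sum0 oppr0.
  move=> /psumr_eq0P -> // j jk; rewrite subr_ge0; exact: vP.
move=> _ [n [c [p [Ap c0 c1 ->]]]]; rewrite dot_sumr.
rewrite (eq_bigr (fun i => c i * b r)) => [|i _]; first by rewrite -mulr_suml c1 mul1r.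
by have [j jk <-] := Ap i; rewrite vb.
Qed.

Lemma barycenter_polytope r : dot (a r) barycenter <= b r.
Proof.
have := @sub_face barycenter; rewrite hP; apply.
exists k, (fun=> k%:R^-1), (fun i => (taup (widen_ord hkd i))^-1 *: evec (widen_ord hkd i)).
split.
- by move=> i; exists (widen_ord hkd i) => //=.
- by move=> i; rewrite invr_ge0.
- by rewrite sumr_const card_ord -[_ *+ k]mulr_natr mulVf.
- rewrite barycenter_sum.
  by rewrite (big_ord_narrow hkd).
Qed.

(** The given system is arbitrary, so the comparison goes through the set itself: [u] is tangent iff
    [barycenter + e u] stays in the polytope for some small [e > 0]. The system and the gauge
    inequality each translate this into a condition on [u]. *)
Lemma tangent_coneE : tangent_cone a b F =
  [set u | \sum_(i < d | (i < k)%N) taup i * u 0 i +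
           \sum_(i < d - k) psi (taup (tail_ord hkd i)) (taum (tail_ord hkd i)) (u 0 (tail_ord hkd i)) <= 0].
Proof.
have d0 : (0 < d)%N by exact: leq_trans hkd.
(* For small [e] the first [k] coordinates stay nonnegative, where [psi] is linear, so the gauge is
   exactly affine in [e], with value [1] at the barycenter. *)
have gauge (u : 'rV[R]_d) e : 0 < e ->
    (forall i : 'I_d, (i < k)%N -> e * `|u 0 i| <= (k%:R * taup i)^-1) ->
    \sum_i psi (taup i) (taum i) ((e *: u + barycenter) 0 i) =
    1 + e * (\sum_(i < d | (i < k)%N) taup i * u 0 i +
      \sum_(i < d - k) psi (taup (tail_ord hkd i)) (taum (tail_ord hkd i)) (u 0 (tail_ord hkd i))).
  move=> e0 eu; rewrite (sum_head_tail hkd) mulrDr addrA; congr (_ + _); last first.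
    rewrite mulr_sumr; apply: eq_bigr => i _; rewrite !mxE ltnNge tail_ord_ge/= addr0.
    by rewrite psiZ// ltW.
  have -> : 1 = \sum_(i < d | (i < k)%N) (k%:R^-1 : R).
    rewrite -[LHS](mulVf kn0) -card_head mulr_sumr; apply: eq_bigr => i _.
    by rewrite mulr1.
  rewrite mulr_sumr -big_split/=; apply: eq_bigr => i ik; rewrite !mxE ik.
  rewrite psi_pos ?(ltW (htaup _)) ?(ltW (htaum _))//.
    by field; rewrite kn0 gt_eqF.
  have := eu i ik; set z := (_ * _)^-1; move=> h.
  rewrite -[e * _]opprK addrC subr_ge0 (le_trans _ h)// -mulrN ler_pM2l//.
  by rewrite -normrN ler_norm.
have eps (u : 'rV[R]_d) : exists2 e0, 0 < e0 & forall e, 0 < e -> e <= e0 ->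
    forall i : 'I_d, (i < k)%N -> e * `|u 0 i| <= (k%:R * taup i)^-1.
  have [i|e0 e00 H] := @finite_pos_lower 'I_d (fun i => ((k%:R * taup i) * (1 + `|u 0 i|))^-1).
    by rewrite invr_gt0 mulr_gt0 ?mulr_gt0 ?ltr0n// ltr_pwDl.
  exists e0 => // e ep ee i ik.
  have p1 : 0 < 1 + `|u 0 i| by rewrite ltr_pwDl.
  have := le_trans ee (H i); rewrite invfM ler_pdivlMr// => h.
  apply: le_trans h; rewrite ler_pM2l// lerDr//.
apply/seteqP; split => u /=.
  move=> uT; have [e1 e10 H1] := eps u.
  (* For a row that is slack at the barycenter, the step that surely preserves it; [1 +] avoids
     division by zero. Active rows impose no bound on the step, and [1] is a placeholder. *)
  pose gap r := if dot (a r) barycenter == b r then 1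
    else (b r - dot (a r) barycenter) / (1 + `|dot (a r) u|).
  have p1 r : 0 < 1 + `|dot (a r) u| by rewrite ltr_pwDl.
  have [r|e2 e20 H2] := @finite_pos_lower 'I_m gap.
    rewrite /gap; case: eqP => // /eqP ab; rewrite divr_gt0// subr_gt0 lt_neqAle ab.
    exact: barycenter_polytope.
  pose e := Num.min e1 e2.
  have e0 : 0 < e by rewrite lt_min e10.
  have : cross_polytope taup taum (e *: u + barycenter).
    rewrite hP => r; rewrite dotDr.
    have := H2 r; rewrite /gap; case: eqP => [ab _|/eqP ab h].
      have : dot (a r) u <= 0 by apply: uT; apply/active_barycenter.
      by rewrite ab gerDr pmulr_rle0.
    rewrite -lerBrDr (le_trans (ler_norm _))// normrM gtr0_norm//.
    move: h; rewrite ler_pdivlMr// => h; apply: le_trans h.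
    apply: ler_pM => //; [exact: ltW|by rewrite ge_min lexx orbT|by rewrite lerDr].
  rewrite cross_polytopeE//= gauge//; last by apply: H1 => //; rewrite ge_min lexx.
  by rewrite -subr_ge0 opprD addNKr oppr_ge0 pmulr_rle0.
move=> h0 r; have [e e0 H] := eps u.
have : cross_polytope taup taum (e *: u + barycenter).
  by rewrite cross_polytopeE//= gauge//; [rewrite gerDl pmulr_rle0|exact: H].
rewrite hP => /(_ r) + /active_barycenter ra.
by rewrite dotDr ra gerDr pmulr_rle0.
Qed.

End Polytope.

(** * Extending orthonormal frames of a positive definite form *)

Section OrthonormalExtension.
Context {R : realType}.

(** Gram-Schmidt with respect to [G]: a nonzero vector orthogonal to the rows of [B] is normalised
    and stacked on top of [B] before the next step. *)
Lemma ortho_extend N m d (G : 'M[R]_d) (B : 'M[R]_(m, d)) :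
  (N + m = d)%N -> G^T = G ->
  (forall v : 'rV_d, v != 0 -> 0 < (v *m G *m v^T) 0 0) ->
  B *m G *m B^T = 1%:M ->
  exists C : 'M[R]_(N, d), C *m G *m C^T = 1%:M /\ C *m G *m B^T = 0.
Proof.
move=> + Gt Gpos; elim: N m B => [|N IH] m B Nm BGB.
  by exists 0; split; apply/matrixP => -[].
(* The matrix [G *m B^T] has rank at most [m < d], so its left kernel is nontrivial. *)
have [v vA v0] : exists2 v : 'rV_d, (v <= kermx (G *m B^T))%MS & v != 0.
  apply/rowV0Pn; rewrite kermx_eq0; apply/negP => /eqP rG.
  by have := rank_leq_col (G *m B^T); rewrite rG -Nm addSn ltnNge leq_addl.
have vB : v *m G *m B^T = 0 by rewrite -mulmxA; exact/sub_kermxP.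
have q0 := Gpos v v0; set q := (_ 0 0) in q0.
pose v1 := (Num.sqrt q)^-1 *: v.
have sq0 : Num.sqrt q != 0 by rewrite gt_eqF// sqrtr_gt0.
have v1v1 : v1 *m G *m v1^T = 1%:M.
  apply/rowP => i; rewrite ord1 /v1 linearZ/= -!scalemxAl -scalemxAr scalerA mxE -/q.
  by rewrite [RHS]mxE -expr2 exprVn sqr_sqrtr ?(ltW q0)// mulVf// gt_eqF.
have v1B : v1 *m G *m B^T = 0 by rewrite /v1 -!scalemxAl vB scaler0.
have Bv1 : B *m G *m v1^T = 0.
  by apply: trmx_inj; rewrite !trmx_mul trmxK Gt mulmxA v1B trmx0.
have [||C [CC CB]] := IH (1 + m)%N (col_mx v1 B); first by rewrite addnA addn1.
  rewrite tr_col_mx !mul_col_mx !mul_mx_row v1v1 v1B Bv1 BGB.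
  by rewrite scalar_mx_block /block_mx.
move: CB; rewrite tr_col_mx mul_mx_row => /eqP; rewrite row_mx_eq0 => /andP[/eqP Cv /eqP CB].
have vC : v1 *m G *m C^T = 0.
  by apply: trmx_inj; rewrite !trmx_mul trmxK Gt mulmxA Cv trmx0.
have H1 : col_mx v1 C *m G *m (col_mx v1 C)^T = 1%:M.
  by rewrite tr_col_mx !mul_col_mx !mul_mx_row v1v1 vC Cv CC scalar_mx_block.
have H2 : col_mx v1 C *m G *m B^T = 0 by rewrite !mul_col_mx v1B CB col_mx0.
by exists (col_mx v1 C).
Qed.

(** With [E] the full orthonormal frame, [M = G *m E^T] sends [u] to its coordinates in [E]. The
    prescribed frame [B] comes last, so that the right block shows the coordinates along it. *)
Lemma isometry_extend N m d (G : 'M[R]_d) (B : 'M[R]_(m, d)) :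
  (N + m = d)%N -> G^T = G ->
  (forall v : 'rV_d, v != 0 -> 0 < (v *m G *m v^T) 0 0) ->
  B *m G *m B^T = 1%:M ->
  exists M : 'M[R]_(d, N + m),
    [/\ forall u v : 'rV_d, dot (u *m M) (v *m M) = (u *m G *m v^T) 0 0,
        forall y : 'rV_(N + m), exists u : 'rV_d, u *m M = y &
        forall u : 'rV_d, rsubmx (u *m M) = u *m G *m B^T].
Proof.
move=> Nm Gt Gpos BGB; have [C [CC CB]] := ortho_extend Nm Gt Gpos BGB.
have BC : B *m G *m C^T = 0.
  by apply: trmx_inj; rewrite !trmx_mul trmxK Gt mulmxA CB trmx0.
subst d; pose E := col_mx C B.
have EE : E *m G *m E^T = 1%:M.
  by rewrite tr_col_mx !mul_col_mx !mul_mx_row CC CB BC BGB scalar_mx_block.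
have EE' : G *m E^T *m E = 1%:M by apply: mulmx1C; rewrite mulmxA.
exists (G *m E^T); split.
- move=> u v; rewrite dot_mulmx !trmx_mul trmxK Gt; congr (fun_of_matrix _ _ _).
  rewrite (_ : _ *m _ = u *m (G *m E^T *m E) *m (G *m v^T)); last by rewrite !mulmxA.
  by rewrite EE' mulmx1 mulmxA.
- by move=> y; exists (y *m E); rewrite -mulmxA (mulmxA E) EE mulmx1.
- by move=> u; rewrite tr_col_mx mul_mx_row mul_mx_row row_mxKr mulmxA.
Qed.

End OrthonormalExtension.

(** * The Klein metric at a point of the face *)

Section Klein.
Context {R : realType} {d : nat} (kappa : R) (x : 'rV[R]_d).
Hypothesis hxB : klein_ball d kappa x.

Definition klein_weight : R := 1 + kappa * dot x x.
Notation c := klein_weight.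

Lemma enorm_sqr n (u : 'rV[R]_n) : enorm u ^+ 2 = dot u u.
Proof. by rewrite sqr_sqrtr// dot_ge0. Qed.

Lemma klein_ball_lt : kappa < 0 -> kappa * dot x x > -1.
Proof.
move=> k0; have [|] := hxB; first by rewrite leNgt k0.
rewrite -enorm_sqr => h; have e0 : 0 <= enorm x by exact: sqrtr_ge0.
have s0 : 0 < Num.sqrt (- kappa) by rewrite sqrtr_gt0 oppr_gt0.
have : enorm x ^+ 2 < (1 / Num.sqrt (- kappa)) ^+ 2 by rewrite ltrXn2r// divr_ge0// ltW.
have kk : Num.sqrt (- kappa) ^+ 2 = - kappa by rewrite sqr_sqrtr// oppr_ge0 ltW.
rewrite expr_div_n kk expr1n ltr_pdivlMr ?oppr_gt0//.
by lra.
Qed.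

Lemma klein_weight_gt0 : 0 < c.
Proof.
rewrite /klein_weight; have [k0|k0] := leP 0 kappa.
  by rewrite ltr_pwDl// mulr_ge0// dot_ge0.
by have := klein_ball_lt k0; lra.
Qed.

Let c_neq0 : c != 0.
Proof. exact: lt0r_neq0 klein_weight_gt0. Qed.

Lemma klein_formE u v : klein_form kappa x u v =
  dot u v / c - kappa * dot x u * dot x v / c ^+ 2.
Proof. by rewrite /klein_form enorm_sqr. Qed.

Definition klein_gram : 'M[R]_d := c^-1%:M - (kappa / c ^+ 2) *: (x^T *m x).

Lemma klein_gramE u v : klein_form kappa x u v = (u *m klein_gram *m v^T) 0 0.
Proof.
have sub (A B : 'M[R]_1) : (A - B) 0 0 = A 0 0 - B 0 0 by rewrite !mxE.
have scl a (A : 'M[R]_1) : (a *: A) 0 0 = a * A 0 0 by rewrite mxE.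
have mul (A B : 'M[R]_1) : (A *m B) 0 0 = A 0 0 * B 0 0 by rewrite mxE big_ord1.
rewrite klein_formE /klein_gram mulmxBr mulmxBl mul_mx_scalar -scalemxAr -!scalemxAl.
rewrite (_ : u *m (x^T *m x) *m v^T = u *m x^T *m (x *m v^T)); last by rewrite !mulmxA.
by rewrite sub !scl mul -!dot_mulmx (dotC u x); field.
Qed.

Lemma klein_gram_sym : klein_gram^T = klein_gram.
Proof. by rewrite /klein_gram linearB linearZ/= tr_scalar_mx trmx_mul trmxK. Qed.

Lemma klein_formC u v : klein_form kappa x u v = klein_form kappa x v u.
Proof. by rewrite !klein_formE (dotC u v) (mulrAC kappa). Qed.

Lemma klein_formDl e u v z : klein_form kappa x (e *: u + v) z =
  e * klein_form kappa x u z + klein_form kappa x v z.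
Proof. by rewrite !klein_gramE !mulmxDl -!scalemxAl !mxE. Qed.

Lemma dot0r n (w : 'rV[R]_n) : dot w 0 = 0.
Proof. by rewrite /dot big1// => i _; rewrite [(0 : 'rV_n) _ _]mxE mulr0. Qed.

Lemma dot_quad n (a b : R) (u v : 'rV[R]_n) : dot (a *: u + b *: v) (a *: u + b *: v) =
  a ^+ 2 * dot u u + 2 * a * b * dot u v + b ^+ 2 * dot v v.
Proof.
by rewrite /dot !mulr_sumr -!big_split/=; apply: eq_bigr => i _; rewrite !mxE; ring.
Qed.

Lemma dot_cauchy (u v : 'rV[R]_d) : dot u v ^+ 2 <= dot u u * dot v v.
Proof.
have [u0|u0] := eqVneq (dot u u) 0.
  by rewrite (dot_eq0 u0) dotC !dot0r expr0n mul0r.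
have {}u0 : 0 < dot u u by rewrite lt_neqAle eq_sym u0 dot_ge0.
have := dot_ge0 (dot u u *: v + (- dot u v) *: u).
rewrite dot_quad (dotC v u).
rewrite (_ : _ + _ = dot u u * (dot u u * dot v v - dot u v ^+ 2)); last by ring.
by rewrite pmulr_rge0// subr_ge0.
Qed.

(** Over [c ^ 2] the numerator is [c |u|^2 - kappa <x, u>^2 = |u|^2 + kappa (|x|^2 |u|^2 - <x,
    u>^2)]. The second form is positive for [kappa >= 0] by Cauchy-Schwarz, the first for
    [kappa < 0] because [c > 0]. *)
Lemma klein_form_gt0 u : u != 0 -> 0 < klein_form kappa x u u.
Proof.
move=> u0; have c0 := klein_weight_gt0.
have uu : 0 < dot u u.
  rewrite lt_neqAle dot_ge0 andbT eq_sym; apply: contra u0 => /eqP /dot_eq0 ->.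
  exact: eqxx.
have -> : klein_form kappa x u u = (c * dot u u - kappa * dot x u ^+ 2) / c ^+ 2.
  by rewrite klein_formE; field.
rewrite divr_gt0 ?exprn_gt0//.
have := dot_cauchy x u; rewrite -subr_ge0 => CS; have sq := sqr_ge0 (dot x u).
have [k0|k0] := leP 0 kappa.
  have := mulr_ge0 k0 CS; rewrite /klein_weight; lra.
have := mulr_gt0 c0 uu; have : 0 <= - kappa * dot x u ^+ 2.
  by rewrite mulr_ge0// oppr_ge0 ltW.
by lra.
Qed.

Lemma klein_form_eq0 u : klein_form kappa x u u = 0 -> u = 0.
Proof. by move=> h; apply/eqP; apply: contra_eqT h => /klein_form_gt0; exact: lt0r_neq0. Qed.

Variables (taup : 'I_d -> R) (k : nat).
Hypothesis htaup : forall i, 0 < taup i.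
Hypothesis hk : (0 < k)%N.
Hypothesis hkd : (k <= d)%N.
Hypothesis hxF : cross_face taup k x.

Notation s := (s_ taup k kappa).
(** The vector [tau] whose hyperplane [<tau, y> = 1] contains [F]. *)
Definition head_normal : 'rV[R]_d := \row_i if (i < k)%N then taup i else 0.
Notation t := head_normal.

Lemma dot_head u : dot t u = \sum_(i < d | (i < k)%N) taup i * u 0 i.
Proof.
rewrite /dot [RHS]big_mkcond; apply: eq_bigr => i _; rewrite mxE.
by case: ifP => _; rewrite ?mul0r.
Qed.

Lemma dot_head_face : dot t x = 1.
Proof.
have [n [c' [p [Ap c0 <- ->]]]] := hxF; rewrite dot_sumr; apply: eq_bigr => i _.
have [j jk <-] := Ap i.
by rewrite -[_ *: evec j]addr0 dotDr dot_evec dot0r addr0 mxE jk mulVf ?mulr1// gt_eqF.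
Qed.

Lemma face_tail (j : 'I_d) : (k <= j)%N -> x 0 j = 0.
Proof.
move=> kj; have [n [c' [p [Ap c0 c1 ->]]]] := hxF; rewrite summxE big1// => i _.
have [l lk <-] := Ap i; rewrite !mxE/= (_ : j == l = false) ?mulr0//.
by apply: contraTF kj => /eqP ->; rewrite -ltnNge.
Qed.

Lemma dot_head_head : dot t t = \sum_(i < d | (i < k)%N) taup i ^+ 2.
Proof. by rewrite dot_head; apply: eq_bigr => i ik; rewrite mxE ik expr2. Qed.

(** For [kappa < 0], expanding [|tau + kappa x|^2 >= 0] with [<tau, x> = 1] gives
    [|tau|^2 >= - 2 kappa - kappa^2 |x|^2], and [kappa |x|^2 > -1] makes this larger than
    [- kappa]. *)
Lemma s_sqr_gt0 : 0 < kappa + \sum_(i < d | (i < k)%N) taup i ^+ 2.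
Proof.
have tt0 : 0 < \sum_(i < d | (i < k)%N) taup i ^+ 2.
  have d0 : (0 < d)%N by exact: leq_trans hkd.
  rewrite (bigD1 (Ordinal d0))//= ltr_pwDl ?exprn_gt0//.
  by apply: sumr_ge0 => i _; exact: sqr_ge0.
have [k0|k0] := leP 0 kappa; first by rewrite ltr_wpDl.
have := klein_ball_lt k0; have := dot_ge0 (1 *: t + kappa *: x).
rewrite dot_quad dot_head_face -dot_head_head.
nra.
Qed.

Lemma s_gt0 : 0 < s.
Proof. by rewrite sqrtr_gt0 s_sqr_gt0. Qed.

Lemma s_sqr : s ^+ 2 = kappa + dot t t.
Proof. by rewrite sqr_sqrtr ?dot_head_head// ltW// s_sqr_gt0. Qed.

Let s_neq0 : s != 0.
Proof. exact: lt0r_neq0 s_gt0. Qed.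

Notation sc := (Num.sqrt c).

Let sc_gt0 : 0 < sc.
Proof. by rewrite sqrtr_gt0 klein_weight_gt0. Qed.

Let sc_sqr : sc ^+ 2 = c.
Proof. by rewrite sqr_sqrtr// ltW// klein_weight_gt0. Qed.

(* The signs turn the tangent cone inequality into the one of [cross_set]. *)
Definition frame (i : 'I_(d - k).+1) : 'rV[R]_d :=
  if unlift 0 i is Some j then - sc *: evec (tail_ord hkd j)
  else - (sc / s) *: (kappa *: x + t).

(** The vector [kappa x + tau] represents [<tau, u> / c] for [g_x]: as [<x, kappa x + tau> = c], the
    terms in [<x, u>] cancel. *)
Lemma klein_form_normal u : klein_form kappa x (frame 0) u = - (dot t u / (sc * s)).
Proof.
rewrite /frame unlift_none -[_ *: _]addr0 klein_formDl klein_formDl.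
have z : klein_form kappa x 0 u = 0.
  by rewrite klein_gramE !mul0mx mxE.
rewrite z addr0 !klein_formE (dotC x t) dot_head_face.
rewrite (_ : kappa * _ + _ = dot t u / c); last first.
  have : c = 1 + kappa * dot x x by [].
  move: c_neq0; move: c => c' c'0 cE.
  have -> : kappa * dot x x = c' - 1 by rewrite cE addrC addKr.
  by field.
move: sc_sqr (lt0r_neq0 sc_gt0); move: sc => S <- S0.
by field; rewrite s_neq0 S0.
Qed.

(** The point [x] has no coordinate beyond [k], so the correction term of the Klein form
    vanishes. *)
Lemma klein_form_tail j u : klein_form kappa x (frame (lift 0 j)) u =
  - (u 0 (tail_ord hkd j) / sc).
Proof.
rewrite /frame liftK -[_ *: _]addr0 klein_formDl.
have z : klein_form kappa x 0 u = 0.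
  by rewrite klein_gramE !mul0mx mxE.
rewrite z addr0 klein_formE dot_evec face_tail ?tail_ord_ge// dotC dot_evec.
move: sc_sqr (lt0r_neq0 sc_gt0); move: sc => S <- S0.
by field; rewrite S0.
Qed.

(** The normalisation of [frame 0] is where [s] comes from: [<tau, kappa x + tau> = kappa + |tau|^2
    = s^2]. *)
Lemma frame_orthonormal i j : klein_form kappa x (frame i) (frame j) = (i == j)%:R.
Proof.
case: (unliftP 0 i) => [i' ->|->]; case: (unliftP 0 j) => [j' ->|->].
- rewrite klein_form_tail (inj_eq lift_inj) /frame liftK !mxE/=.
  rewrite (inj_eq (@tail_ord_inj d k hkd)).
  by case: eqP => _; rewrite ?mulr1 ?mulr0 ?mul0r ?oppr0// mulNr mulfV ?opprK ?gt_eqF.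
- rewrite klein_form_tail /frame unlift_none !mxE face_tail ?tail_ord_ge//.
  by rewrite ltnNge tail_ord_ge/= mulr0 addr0 mulr0 mul0r oppr0.
- rewrite klein_form_normal /frame liftK -[_ *: _]addr0 dotDr dot_evec dot0r mxE.
  by rewrite ltnNge tail_ord_ge/= mulr0 addr0 mul0r oppr0.
rewrite klein_form_normal /frame unlift_none -[_ *: _]addr0 dotDr dotDr dot_head_face dot0r.
by rewrite mulr1 addr0 -s_sqr eqxx mulr1n; field; rewrite s_neq0 gt_eqF.
Qed.

Lemma klein_isometry : exists M : 'M[R]_(d, k.-1 + (d - k).+1),
  [/\ forall u v : 'rV_d, dot (u *m M) (v *m M) = klein_form kappa x u v,
      forall y : 'rV_(k.-1 + (d - k).+1), exists u : 'rV_d, u *m M = y,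
      forall u : 'rV_d, rsubmx (u *m M) 0 0 = - (dot t u / (sc * s)) &
      forall (u : 'rV_d) j, rsubmx (u *m M) 0 (lift 0 j) = - (u 0 (tail_ord hkd j) / sc)].
Proof.
pose B := \matrix_(i < (d - k).+1) frame i.
have BE i u : (u *m klein_gram *m B^T) 0 i = klein_form kappa x (frame i) u.
  rewrite klein_formC klein_gramE !mxE; apply: eq_bigr => l _.
  by rewrite !mxE.
have BGB : B *m klein_gram *m B^T = 1%:M.
  apply/matrixP => i j; rewrite [RHS]mxE -frame_orthonormal klein_formC -BE.
  rewrite !mxE; apply: eq_bigr => l _; congr (_ * _).
  by rewrite !mxE; apply: eq_bigr => l' _; rewrite !mxE.
have Nm : (k.-1 + (d - k).+1 = d)%N by rewrite addnS -addSn prednK// subnKC.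
have Gpos (v : 'rV_d) : v != 0 -> 0 < (v *m klein_gram *m v^T) 0 0.
  by rewrite -klein_gramE; exact: klein_form_gt0.
have [M [M1 M2 M3]] := isometry_extend Nm klein_gram_sym Gpos BGB.
exists M; split => //.
- by move=> u v; rewrite M1 klein_gramE.
- by move=> u; rewrite M3 BE klein_form_normal.
- by move=> u j; rewrite M3 BE klein_form_tail.
Qed.

End Klein.

(** * Identification of the tangent and normal cones *)

Section ConesAtFace.
Context {R : realType}.

Lemma psiN (p q v : R) : psi p q (- v) = psi q p v.
Proof. by rewrite /psi !mulrN opprK maxC. Qed.

Lemma psi_div (p q v s c : R) : 0 < s -> 0 < c ->
  psi (p / s) (q / s) (v / c) = psi p q v / (c * s).
Proof.
move=> s0 c0; have cs : 0 <= (c * s)^-1 by rewrite invr_ge0 mulr_ge0// ltW.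
rewrite /psi [RHS]mulrC maxr_pMr// mulrN.
by congr (Num.max _ (- _)); field; rewrite !gt_eqF.
Qed.

Lemma dot_row_mx m n (u1 v1 : 'rV[R]_m) (u2 v2 : 'rV[R]_n) :
  dot (row_mx u1 u2) (row_mx v1 v2) = dot u1 v1 + dot u2 v2.
Proof.
rewrite /dot big_split_ord/=.
by congr (_ + _); apply: eq_bigr => i _; rewrite ?row_mxEl ?row_mxEr.
Qed.

Lemma dot_cons n (u v : 'rV[R]_n.+1) :
  dot u v = u 0 0 * v 0 0 + \sum_i u 0 (lift 0 i) * v 0 (lift 0 i).
Proof. by rewrite /dot big_ord_recl. Qed.

Lemma dotNl n (u v : 'rV[R]_n) : dot (- u) v = - dot u v.
Proof. by rewrite -[- u]addr0 -scaleN1r dotDl (dotC 0) dot0r addr0 mulN1r. Qed.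

(** If [y_i] lies in [[- q_i y_0, p_i y_0]], then [y_i z >= - y_0 psi (q i) (p i) z], so a cross
    vector pairs nonnegatively with [y]. Conversely the facet inequalities come from pairing with
    [e_0], [e_0 + e_i / q_i] and [e_0 - e_i / p_i]. *)
Lemma cube_set_dual n (p q : 'I_n -> R) (y : 'rV[R]_n.+1) :
  (forall i, 0 < p i) -> (forall i, 0 < q i) ->
  cube_set p q y <-> forall w, cross_set q p w -> 0 <= dot y w.
Proof.
move=> p0 q0; split => [[y0 yC] w wC|H].
  have : 0 <= y 0 0 * (w 0 0 - \sum_i psi (q i) (p i) (w 0 (lift 0 i))).
    by rewrite mulr_ge0// subr_ge0.
  rewrite dot_cons mulrBr => h; apply: le_trans h _; rewrite lerD2l mulr_sumr -sumrN.
  apply: ler_sum => i _; have /andP[y1 y2] := yC i; set z := w 0 _.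
  have [z0|z0] := leP 0 z.
    by rewrite psi_pos ?(ltW (p0 i)) ?(ltW (q0 i))//; nra.
  rewrite -[z]opprK psiN psi_pos ?(ltW (p0 i)) ?(ltW (q0 i)) ?oppr_ge0 ?(ltW z0)//.
  nra.
have e0 : cross_set q p (evec 0).
  by rewrite /cross_set/= evec00 big1// => i _; rewrite evec0S psi0.
have D c i : dot y (evec 0 + c *: evec (lift 0 i)) = y 0 0 + c * y 0 (lift 0 i).
  by rewrite addrC dotDr !dot_evec addrC.
split => [|i]; first by have := H _ e0; rewrite dot_evec.
apply/andP; split.
  have : cross_set q p (evec 0 + (q i)^-1 *: evec (lift 0 i)).
    apply: cross_set_gen => //; first by rewrite mulVf// gt_eqF.
    by rewrite mulNr (le_trans _ ler01)// oppr_le0 mulr_ge0// ?invr_ge0 ltW.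
  move=> /H; rewrite D => h; rewrite -subr_ge0 opprK.
  rewrite (_ : _ + _ = q i * (y 0 0 + (q i)^-1 * y 0 (lift 0 i))).
    by rewrite mulr_ge0// ltW.
  by rewrite mulrDr mulrA mulfV ?gt_eqF// mul1r addrC.
have : cross_set q p (evec 0 + (- (p i)^-1) *: evec (lift 0 i)).
  apply: cross_set_gen => //; last by rewrite opprK mulVf// gt_eqF.
  by rewrite mulNr (le_trans _ ler01)// oppr_le0 mulr_ge0// ?invr_ge0 ltW.
move=> /H; rewrite D => h; rewrite -subr_ge0.
rewrite (_ : _ - _ = p i * (y 0 0 + - (p i)^-1 * y 0 (lift 0 i))).
  by rewrite mulr_ge0// ltW.
by rewrite mulrDr mulNr mulrN mulrA mulfV ?gt_eqF// mul1r.
Qed.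

Lemma lin_hull_lineality p n (A : set 'rV[R]_n) :
  (forall v, exists a b, [/\ A a, A b & v = a - b]) ->
  lin_hull (lineality_sum p A) = setT.
Proof.
move=> H; apply: lin_hull_full => v; have [a [b [Aa Ab vE]]] := H (rsubmx v).
exists (row_mx (lsubmx v) a), (row_mx 0 b); split.
- by rewrite /lineality_sum/= row_mxKr.
- by rewrite /lineality_sum/= row_mxKr.
by rewrite opp_row_mx add_row_mx oppr0 addr0 -vE hsubmxK.
Qed.

End ConesAtFace.

Section FaceCones.
Context {R : realType} {d : nat} (kappa : R) (taup taum : 'I_d -> R).
Hypothesis htaup : forall i, 0 < taup i.
Hypothesis htaum : forall i, 0 < taum i.
Variables (m : nat) (a : 'I_m -> 'rV[R]_d) (b : 'I_m -> R) (k : nat).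
Hypothesis hP : cross_polytope taup taum = [set y | forall r, dot (a r) y <= b r].
Hypothesis hk : (0 < k)%N.
Hypothesis hkd : (k <= d)%N.
Variable x : 'rV[R]_d.
Hypothesis hxF : cross_face taup k x.
Hypothesis hxB : klein_ball d kappa x.

Notation F := (cross_face taup k).
Notation g := (klein_form kappa x).
Notation s := (s_ taup k kappa).
Notation T := (tangent_cone a b F).
Notation N := (normal_cone a b kappa x F).
Notation mup := (fun j : 'I_(d - k) => taup (tail_ord hkd j) / s).
Notation mum := (fun j : 'I_(d - k) => taum (tail_ord hkd j) / s).

Lemma mup_gt0 j : 0 < mup j.
Proof. by rewrite divr_gt0// (s_gt0 hxB htaup hk hkd hxF). Qed.

Lemma mum_gt0 j : 0 < mum j.
Proof. by rewrite divr_gt0// (s_gt0 hxB htaup hk hkd hxF). Qed.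

(** A single isometry serves both cones, so the normal cone can be computed as a polar in the model.
    The minus signs in the frame flip the tail coordinates, which exchanges [mup] and [mum] in the
    cross cone. *)
Lemma face_cones : exists M : 'M[R]_(d, k.-1 + (d - k).+1),
  [/\ forall u v : 'rV_d, dot (u *m M) (v *m M) = g u v,
      forall y : 'rV_(k.-1 + (d - k).+1), exists u : 'rV_d, u *m M = y,
      forall u : 'rV_d, T u <-> cross_set mum mup (rsubmx (u *m M)) &
      forall u : 'rV_d, N u <-> lsubmx (u *m M) = 0 /\ cube_set mup mum (- rsubmx (u *m M))].
Proof.
have [M [M1 M2 M3 M4]] := klein_isometry hxB htaup hk hkd hxF.
have s0 := s_gt0 hxB htaup hk hkd hxF.
have sc0 : 0 < Num.sqrt (klein_weight kappa x) by rewrite sqrtr_gt0 klein_weight_gt0.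
have TM (u : 'rV_d) : T u <-> cross_set mum mup (rsubmx (u *m M)).
  rewrite (tangent_coneE htaup htaum hP hk hkd) /cross_set/= M3.
  under [in X in _ <-> X]eq_bigr do rewrite M4 psiN psi_div//.
  rewrite -mulr_suml -dot_head -[X in _ <-> is_true X]subr_ge0 -opprD.
  by rewrite -mulrDl oppr_ge0 pmulr_lle0 ?invr_gt0 ?mulr_gt0.
exists M; split => // u; split => [uN|[u0 uC] v /TM vT].
  have H (w : 'rV_(k.-1 + (d - k).+1)) : cross_set mum mup (rsubmx w) -> dot (u *m M) w <= 0.
    have [v <-] := M2 w; rewrite M1 => vT; apply: uN; exact/TM.
  split.
    apply: dot_eq0; apply/eqP; rewrite eq_le dot_ge0 andbT.
    (* The lineality block is itself a tangent direction; pairing [u] with it gives its squared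
       norm, which must be at most [0]. *)
    have := H (row_mx (lsubmx (u *m M)) 0); rewrite row_mxKr => /(_ (cross_set0 _ _)).
    by rewrite -{1}[u *m M]hsubmxK dot_row_mx dot0r addr0.
  apply/cube_set_dual; [exact: mup_gt0|exact: mum_gt0|move=> w wC].
  have := H (row_mx 0 w); rewrite row_mxKr => /(_ wC).
  by rewrite -{1}[u *m M]hsubmxK dot_row_mx dot0r add0r dotNl oppr_ge0.
rewrite -M1 -[u *m M]hsubmxK -[v *m M]hsubmxK dot_row_mx u0 dotC dot0r add0r.
rewrite -oppr_ge0 -dotNl.
by move/(cube_set_dual _ mup_gt0 mum_gt0) : uC; apply.
Qed.

Lemma isometric_tangent : isometric g T dot (lineality_sum k.-1 (cross_set mum mup)).
Proof.
have [M [M1 M2 TM _]] := face_cones.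
have flin (c : R) u v : (c *: u + v) *m M = c *: (u *m M) + v *m M.
  by rewrite mulmxDl -scalemxAl.
have fT : (fun u => u *m M) @` T = lineality_sum k.-1 (cross_set mum mup).
  apply/seteqP; split => [_ [u /TM uT <-]//|w wC].
  by have [u uw] := M2 w; exists u => //; apply/TM; rewrite uw.
have fl : forall (c : R) u v, lin_hull T u -> lin_hull T v ->
    (c *: u + v) *m M = c *: (u *m M) + v *m M.
  by move=> c u v _ _; exact: flin.
by exists (fun u => u *m M); split => //; rewrite (image_lin_hull fl) fT.
Qed.

(** Dropping the lineality block is isometric only on the hull of the normal cone, where that block
    vanishes. The sign turns the polar cone into the cube cone itself. *)
Lemma isometric_normal : isometric g N dot (cube_set mup mum).
Proof.
have [M [M1 M2 _ NM]] := face_cones.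
pose f (u : 'rV_d) := - rsubmx (u *m M).
have flin (c : R) u v : f (c *: u + v) = c *: f u + f v.
  by rewrite /f mulmxDl -scalemxAl linearP/= opprD scalerN.
have fN : f @` N = cube_set mup mum.
  apply/seteqP; split => [_ [u /NM [_ uN] <-]//|w wC].
  have [u uw] := M2 (row_mx 0 (- w)); exists u; last by rewrite /f uw row_mxKr opprK.
  by apply/NM; rewrite uw row_mxKl row_mxKr opprK.
have l0 u : lin_hull N u -> lsubmx (u *m M) = 0.
  move=> [n [c [p [Np ->]]]]; rewrite mulmx_suml linear_sum big1// => i _ /=.
  by rewrite -scalemxAl linearZ/=; have /NM [-> _] := Np i; rewrite scaler0.
have fl : forall (c : R) u v, lin_hull N u -> lin_hull N v -> f (c *: u + v) = c *: f u + f v.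
  by move=> c u v _ _; exact: flin.
exists f; split => //; last by rewrite (image_lin_hull fl) fN.
move=> u v _ /l0 v0; rewrite -M1 -[in RHS](hsubmxK (u *m M)) -[in RHS](hsubmxK (v *m M)).
  by rewrite dot_row_mx v0 dot0r add0r /f dotNl dotC dotNl opprK dotC.
Qed.

Lemma solid_angle_normal : solid_angle g N =
  fine (gvol (cube_set mup mum)) / Num.sqrt (2 * pi) ^+ (d - k).+1.
Proof.
apply: (solid_angle_isometric (klein_form_eq0 hxB) isometric_normal).
- by apply: lin_hull_full => v; apply: cube_set_diff; [exact: mup_gt0|exact: mum_gt0].
- exact: measurable_cube_set.
- exact: scalable_cube_set.
Qed.

Lemma solid_angle_tangent : solid_angle g T =
  fine (gvol (cross_set mum mup)) / Num.sqrt (2 * pi) ^+ (d - k).+1.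
Proof.
have mC := @measurable_cross_set R _ mum mup.
rewrite (solid_angle_isometric (klein_form_eq0 hxB) isometric_tangent).
(* The [k - 1] lineality directions contribute the same power of [sqrt (2 pi)] to the mass and to
   its normalisation. *)
- rewrite gvol_lineality// exprD invfM mulrACA mulfV ?mul1r//.
  by rewrite expf_neq0// sqrt2pi_neq0.
- by apply: lin_hull_lineality => v; exact: cross_set_diff.
- rewrite -[X in measurable X]setTI; exact: (measurable_rsubmx measurableT mC).
- by move=> c v c0 vC; rewrite /lineality_sum/= linearZ; exact: scalable_cross_set.
Qed.

End FaceCones.

Theorem theorem8p1 (R : realType) (d : nat) (hd : (2 <= d)%N) (kappa : R)
    (taup taum : 'I_d -> R)
    (htaup : forall i, 0 < taup i) (htaum : forall i, 0 < taum i)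
    (hP : cross_polytope taup taum `<=` closure (klein_ball d kappa))
    (m : nat) (a : 'I_m -> 'rV[R]_d) (b : 'I_m -> R)
    (hab : irredundant_description a b (cross_polytope taup taum))
    (k : nat) (hk1 : (1 <= k)%N) (hkd : (k <= d)%N)
    (x : 'rV[R]_d)
    (hxF : relint (cross_face taup k) x) (hxB : klein_ball d kappa x) :
  let F := cross_face taup k in
  let g := klein_form kappa x in
  let s := s_ taup k kappa in
  let T := tangent_cone a b F in
  let N := normal_cone a b kappa x F in
  let mup := fun j : 'I_(d - k) => taup (tail_ord hkd j) / s in
  let mum := fun j : 'I_(d - k) => taum (tail_ord hkd j) / s in
  [/\ 0 < s,
      isometric g N dot (cube_cone mup mum),
      (solid_angle g N)%:C =
        ((Num.sqrt (2 * pi))^-1)%:C *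
        Cintegral `[0, +oo[ (fun y : R =>
          (\prod_(j < d | (k <= j)%N)
             (Phi (taup j * y / s)%:C - Phi (- (taum j * y / s))%:C)) *
          (expR (- y ^+ 2 / 2))%:C),
      isometric g T dot (lineality_sum k.-1 (cross_cone mum mup))
    & (solid_angle g T)%:C =
        2^-1 + 'i%C / (2 * pi)%:C *
        Cintegral `]0, +oo[ (fun t : R =>
          (expR (- t ^+ 2 / 2) / t)%:C *
          (\prod_(j < d | (k <= j)%N)
             ((expR (- ((taum j * t) ^+ 2 / (2 * s ^+ 2))))%:C *
                Phi ('i%C * (taum j * t / s)%:C) +
              (expR (- ((taup j * t) ^+ 2 / (2 * s ^+ 2))))%:C *
                Phi ('i%C * (taup j * t / s)%:C)) -
           \prod_(j < d | (k <= j)%N)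
             ((expR (- ((taum j * t) ^+ 2 / (2 * s ^+ 2))))%:C *
                Phi (- ('i%C * (taum j * t / s)%:C)) +
              (expR (- ((taup j * t) ^+ 2 / (2 * s ^+ 2))))%:C *
                Phi (- ('i%C * (taup j * t / s)%:C)))))].
Proof.
move=> F g s T N mup mum.
have [hP' _ _] := hab; have [xF _] := hxF.
have s0 : 0 < s := s_gt0 hxB htaup hk1 hkd xF.
have mup0 j : 0 < mup j := mup_gt0 htaup hk1 hkd xF hxB j.
have mum0 j : 0 < mum j := mum_gt0 htaup htaum hk1 hkd xF hxB j.
have mup1 j : 0 <= mup j := ltW (mup0 j).
have mum1 j : 0 <= mum j := ltW (mum0 j).
have E1 (c t : R) : c * t / s = c / s * t by rewrite mulrAC.
have E2 (c t : R) : (c * t) ^+ 2 / (2 * s ^+ 2) = (c / s * t) ^+ 2 / 2.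
  by field; rewrite gt_eqF.
split => //.
- by rewrite cube_coneE//; exact: isometric_normal.
- rewrite (solid_angle_normal htaup htaum hP' hk1 hkd xF hxB) cube_angle_Phi//.
  congr (_ * Cintegral _ _); apply/funext => y; congr (_ * _).
  by rewrite (big_tail hkd); apply: eq_bigr => j _; rewrite !E1.
- by rewrite cross_coneE//; exact: isometric_tangent.
rewrite (solid_angle_tangent htaup htaum hP' hk1 hkd xF hxB) cross_angle_Phi//.
congr (_ + _ * Cintegral _ _); apply/funext => t; congr (_ * (_ - _)).
  by rewrite (big_tail hkd); apply: eq_bigr => j _; rewrite !E1 !E2.
by rewrite (big_tail hkd); apply: eq_bigr => j _; rewrite !E1 !E2.
Qed.
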